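(* Let $\theta,\ell\in\{1,2\}$ and $\nu\in(0,\ell)$. Let $X$ be a stationary, isotropic Gaussian random field on $\mathbb R^2$ with covariance function $K(\mathbf x,\mathbf y)=\tilde K(\mathbf x-\mathbf y)$ of the form described in the context, with smoothness parameter $\nu$. Let $\gamma$ be a curve and $t_i=t_{n,i}$, $1\le i\le n$, points satisfying Conditions 2, 3 and 4 stated in the context, and let $\tilde V_{\theta,\ell}$ be the $\ell$th-order quadratic variation based on $X(\gamma(t_1)),\dots,X(\gamma(t_n))$ defined in the context. Then, as $n\to\infty$, $$E(\tilde V_{\theta,\ell})\sim\tilde f_{\theta,\ell}(\nu)\asymp n^{2\ell+1-2\nu}.$$ In addition, let $\Gamma$ be a compact, convex set in $\mathbb R^2$ with $\{\gamma(t):0\le t\le L\}\subset\Gamma$ and suppose that (i) $\tilde K^{(a_1,a_2)}(\cdot)$ is a continuous function on an open set containing $\{\mathbf x-\mathbf y:\mathbf x,\mathbf y\in\Gamma,\ \mathbf x\ne\mathbf y\}$ whenever $a_1,a_2$ are nonnegative integers such that $a_1+a_2=2\ell$, and (ii) there exists a constant $C_4$ such that $$|\tilde K^{(a_1,a_2)}(\mathbf x-\mathbf y)|\le C_4\|\mathbf x-\mathbf y\|^{2\nu-2\ell}\qquad\text{for all nonnegative integers } a_1,a_2\text{ with } 2\le a_1+a_2\le2\ell,$$ for all $\mathbf x,\mathbf y\in\Gamma$, $\mathbf x\ne\mathbf y$. Then $\tilde V_{\theta,\ell}/E(\tilde V_{\theta,\ell})\to1$ almost surely and $$\operatorname{Var}\{\tilde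 V_{\theta,\ell}/E(\tilde V_{\theta,\ell})\}=\begin{cases}O(n^{-1}),&\text{if }\nu<(4\ell-1)/4,\\ O\{n^{-1}\log(n)\},&\text{if }\nu=(4\ell-1)/4,\\ O(n^{-4\ell+4\nu}),&\text{if }\nu>(4\ell-1)/4,\end{cases}$$ as $n\to\infty$.
   Context: Notation: $\|\cdot\|$ is the Euclidean norm; $\lfloor\cdot\rfloor$ is the greatest integer function; $a_n\sim b_n$ means $\lim a_n/b_n=1$; $a_n\asymp b_n$ means $0<\liminf a_n/b_n\le\limsup a_n/b_n<\infty$. Covariance model. $X$ is a stationary, isotropic Gaussian random field on $\mathbb R^2$ with constant mean $\mu$ and covariance function $$K(\mathbf x,\mathbf y)=\operatorname{Cov}\{X(\mathbf x),X(\mathbf y)\}=\sum_{j=0}^{\lfloor\nu\rfloor}\beta_j\|\mathbf x-\mathbf y\|^{2j}+\beta_\nu^*G_\nu(\|\mathbf x-\mathbf y\|)+r(\mathbf x,\mathbf y),$$ where $\nu>0$, $\beta_\nu^*\ne0$, $\beta_0,\dots,\beta_{\lfloor\nu\rfloor}$ are constants; $r(\mathbf x,\mathbf y)=O(\|\mathbf x-\mathbf y\|^{2\nu+\tau})$ as $\|\mathbf x-\mathbf y\|\to0$ for some constant $\tau>0$; and $G_\nu:[0,\infty)\to\mathbb R$ satisfies $G_\nu(0)=0$ and, for $s>0$, $G_\nu(s)=s^{2\nu}$ if $\nu\notin\mathbb Z$, $G_\nu(s)=s^{2\nu}\log(s)$ if $\nu\in\mathbb Z$. Write $\tilde K(\mathbf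 x-\mathbf y)=K(\mathbf x,\mathbf y)$ and, for $\mathbf x=(x_1,x_2)'$, $\tilde K^{(a_1,a_2)}(\mathbf x)=\frac{\partial^{a_1+a_2}}{\partial x_1^{a_1}\partial x_2^{a_2}}\tilde K(\mathbf x)$. Condition 2. There exist strictly positive constants $\varepsilon,L$ such that $\gamma:(-\varepsilon,L+\varepsilon)\to\mathbb R^2$ is a $C^2$-curve parametrised by arc length: the second derivative $\gamma^{(2)}(t)$ exists and is continuous and $\|\gamma^{(1)}(t)\|=1$ for all $t\in(-\varepsilon,L+\varepsilon)$. Condition 3. There exists a constant $C_3>0$ such that $\|\gamma(t^* )-\gamma(t)\|\ge C_3|t^*-t|$ for all $t^*,t\in[0,L]$. Condition 4. For $n\ge2$, $t_{n,i}=\varphi(L(i-1)/(n-1))$, $i=1,\dots,n$, where $\varphi:\mathbb R\to\mathbb R$ is twice continuously differentiable with $\varphi(0)=0$, $\varphi(L)=L$ and $\min_{0\le s\le L}\varphi^{(1)}(s)>0$. Quadratic variation. Write $t_i=t_{n,i}$, $X_i=X(\gamma(t_i))$, $d_{i,j}=\|\gamma(t_i)-\gamma(t_j)\|$. For $\theta,\ell\in\{1,2\}$ and $1\le i\le n-\theta\ell$ define $$b_{\theta,\ell;i,k}=\frac{\ell}{\prod_{0\le j\le\ell,\,j\ne k}(d_{i,i+\theta k}-d_{i,i+\theta j})},\quad k=0,\dots,\ell,\qquad\tilde\nabla_{\theta,\ell}X_i=\sum_{k=0}^\ell b_{\theta,\ell;i,k}X_{i+\theta k},$$ $$\tilde V_{\theta,\ell}=\sum_{i=1}^{n-\theta\ell}(\tilde\nabla_{\theta,\ell}X_i)^2,\qquad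 \tilde f_{\theta,\ell}(\nu)=2\beta_\nu^*\sum_{i=1}^{n-\theta\ell}\sum_{0\le k_1<k_2\le\ell}b_{\theta,\ell;i,k_1}b_{\theta,\ell;i,k_2}G_\nu(d_{i+\theta k_1,i+\theta k_2}),\ \ \nu\in(0,\ell).$$ (These are considered for $n$ large enough that the denominators do not vanish.) For all $n$ the observations come from the same realization of $X$. *)

(* Defs.v *)
From HB Require Import structures.
From mathcomp Require Import all_boot all_order all_algebra.
From mathcomp Require Import all_classical all_reals all_analysis.

Set Implicit Arguments.
Unset Strict Implicit.
Unset Printing Implicit Defensive.

Import Order.TTheory GRing.Theory Num.Theory.
Import numFieldNormedType.Exports.

Local Open Scope classical_set_scope.
Local Open Scope ring_scope.

(* The library norm on 'rV[R]_2 is the sup norm, hence a separate Euclidean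
   norm; the topology is the same. *)
Definition enorm (R : realType) (x : 'rV[R]_2) : R :=
  Num.sqrt (\sum_(j < 2) x 0 j ^+ 2).

Section asymptotics.
Variable R : realType.

Definition asymp_equiv (a b : nat -> R) : Prop :=
  (fun n => a n / b n) @ \oo --> (1 : R).

Definition same_order (a b : nat -> R) : Prop :=
  let q := fun n => (a n / b n)%:E in
  [/\ (0 < limn_einf q)%E, (limn_einf q <= limn_esup q)%E
    & (limn_esup q < +oo)%E].

(* v = O(u) for an extended-real v: in particular v is eventually finite. *)
Definition ebigO (v : nat -> \bar R) (u : nat -> R) : Prop :=
  exists C : R, \forall n \near \oo, (`|v n| <= (C * u n)%:E)%E.

End asymptotics.

Section partial_derivatives.
Variable R : realType.
Implicit Types (f : 'rV[R]_2 -> R) (U : set 'rV[R]_2).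

Definition pderiv (j : 'I_2) f : 'rV[R]_2 -> R :=
  fun x => 'D_(delta_mx 0 j) f x.

Definition mpderiv (a1 a2 : nat) f : 'rV[R]_2 -> R :=
  iter a1 (pderiv ord0) (iter a2 (pderiv ord_max) f).

(* 'D is total, so the existence of every derivative taken on the way to
   mpderiv a1 a2 f has to be stated separately. *)
Definition has_mpderiv (a1 a2 : nat) f U : Prop :=
  (forall j x, (j < a2)%N -> U x ->
     derivable (mpderiv 0 j f) x (delta_mx 0 ord_max)) /\
  (forall i x, (i < a1)%N -> U x ->
     derivable (mpderiv i a2 f) x (delta_mx 0 ord0)).

End partial_derivatives.

Section gaussian_fields.
Context d (T : measurableType d) (R : realType) (P : probability T R).

(* The Gaussian law with mean m and standard deviation s; normal_prob m 0 is
   not the point mass at m in the library, so s = 0 is treated apart. *)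
Definition gaussian_law (m s : R) (A : set R) : \bar R :=
  if s == 0 then \d_m A else normal_prob m s A.

Definition gaussian_rv (Z : T -> R) : Prop :=
  exists m s : R, 0 <= s /\
    forall A : set R, measurable A -> P (Z @^-1` A) = gaussian_law m s A.

Definition gaussian_field (X : 'rV[R]_2 -> {RV P >-> R}) : Prop :=
  forall (k : nat) (x : 'I_k -> 'rV[R]_2) (a : 'I_k -> R),
    gaussian_rv (fun w => \sum_(i < k) a i * X (x i) w).

(* Constant mean mu and covariance K(x, y) = Kt (x - y) depending on
   the Euclidean distance between x and y only. *)
Definition stationary_isotropic (X : 'rV[R]_2 -> {RV P >-> R})
    (mu : R) (Kt : 'rV[R]_2 -> R) : Prop :=
  [/\ forall x, 'E_P[X x]%E = mu%:E,
      forall x y, covariance P (X x) (X y) = (Kt (x - y))%:E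
    & forall h h', enorm h = enorm h' -> Kt h = Kt h'].

End gaussian_fields.

Section covariance_model.
Variable R : realType.

Definition Gfun (nu s : R) : R :=
  if s == 0 then 0
  else if nu \is a Num.int then s `^ (2 * nu) * ln s
  else s `^ (2 * nu).

(* The bound on r is also imposed at x = y, where it reads r x x = 0: there is
   no nugget effect. *)
Definition covariance_form (nu : R) (beta : nat -> R) (betastar : R)
    (Kt : 'rV[R]_2 -> R) : Prop :=
  betastar != 0 /\
  exists (r : 'rV[R]_2 -> 'rV[R]_2 -> R) (tau : R),
    [/\ 0 < tau,
        forall x y : 'rV[R]_2, Kt (x - y) =
          \sum_(j < (Num.truncn nu).+1) beta j * enorm (x - y) ^+ (2 * j)
          + betastar * Gfun nu (enorm (x - y)) + r x y
      & exists C delta : R, 0 < delta /\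
          forall x y : 'rV[R]_2, enorm (x - y) < delta ->
            `|r x y| <= C * enorm (x - y) `^ (2 * nu + tau)].

End covariance_model.

Section curve.
Variable R : realType.

Definition arclength_C2_curve (eps L : R) (gamma : R -> 'rV[R]_2) : Prop :=
  [/\ 0 < eps, 0 < L &
    forall t : R, t \in `](- eps), (L + eps)[ ->
      [/\ derivable gamma t 1, derivable (derive1 gamma) t 1,
          {for t, continuous (derive1n 2 gamma)} & enorm (derive1 gamma t) = 1]].

Definition chord_arc (L : R) (gamma : R -> 'rV[R]_2) : Prop :=
  exists2 C3 : R, 0 < C3 &
    forall t' t : R, t' \in `[0, L] -> t \in `[0, L] ->
      C3 * `|t' - t| <= enorm (gamma t' - gamma t).

Definition sampling_map (L : R) (phi : R -> R) : Prop :=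
  [/\ forall s : R, [/\ derivable phi s 1, derivable (derive1 phi) s 1
        & {for s, continuous (derive1n 2 phi)}],
      phi 0 = 0, phi L = L &
      exists s0 : R, [/\ s0 \in `[0, L],
        forall s : R, s \in `[0, L] -> derive1 phi s0 <= derive1 phi s & 0 < derive1 phi s0]].

(* i ranges over 1, ..., n *)
Definition design (L : R) (phi : R -> R) (n i : nat) : R :=
  phi (L * (i%:R - 1) / (n%:R - 1)).

End curve.

Section quadratic_variation.
Variable R : realType.
Implicit Type p : nat -> 'rV[R]_2.

Definition pdist p (i j : nat) : R := enorm (p i - p j).

Definition bcoef (theta l : nat) p (i k : nat) : R :=
  l%:R / \prod_(j < l.+1 | (j : nat) != k)
           (pdist p i (i + theta * k) - pdist p i (i + theta * j)).

Definition nabla (theta l : nat) p (x : nat -> R) (i : nat) : R :=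
  \sum_(k < l.+1) bcoef theta l p i k * x (i + theta * k)%N.

Definition quad_var (theta l n : nat) p (x : nat -> R) : R :=
  \sum_(1 <= i < (n - theta * l).+1) nabla theta l p x i ^+ 2.

Definition ftilde (theta l n : nat) p (betastar nu : R) : R :=
  2 * betastar *
  \sum_(1 <= i < (n - theta * l).+1)
    \sum_(k1 < l.+1) \sum_(k2 < l.+1 | (k1 < k2)%N)
      bcoef theta l p i k1 * bcoef theta l p i k2 *
      Gfun nu (pdist p (i + theta * k1) (i + theta * k2)).

End quadratic_variation.

Section sampled_field.
Context d (T : measurableType d) (R : realType) (P : probability T R).

Definition sample_points (L : R) (phi : R -> R) (gamma : R -> 'rV[R]_2)
    (n i : nat) : 'rV[R]_2 := gamma (design L phi n i).

Definition Vtilde (theta l : nat) (L : R) (phi : R -> R)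
    (gamma : R -> 'rV[R]_2) (X : 'rV[R]_2 -> {RV P >-> R}) (n : nat) (w : T) : R :=
  let p := sample_points L phi gamma n in
  quad_var theta l n p (fun i => X (p i) w).

Definition EVtilde (theta l : nat) (L : R) (phi : R -> R)
    (gamma : R -> 'rV[R]_2) (X : 'rV[R]_2 -> {RV P >-> R}) (n : nat) : \bar R :=
  'E_P[Vtilde theta l L phi gamma X n]%E.

End sampled_field.

Section regularity.
Variable R : realType.

Definition difference_set (Gam : set 'rV[R]_2) : set 'rV[R]_2 :=
  [set h | exists x y, [/\ Gam x, Gam y, x != y & h = x - y]].

Definition smooth_off_origin (l : nat) (Gam : set 'rV[R]_2)
    (Kt : 'rV[R]_2 -> R) : Prop :=
  forall a1 a2 : nat, (a1 + a2 = 2 * l)%N ->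
    exists U : set 'rV[R]_2,
      [/\ open U, difference_set Gam `<=` U, has_mpderiv a1 a2 Kt U
        & forall x, U x -> {for x, continuous (mpderiv a1 a2 Kt)}].

Definition derivative_bound (l : nat) (nu : R) (Gam : set 'rV[R]_2)
    (Kt : 'rV[R]_2 -> R) : Prop :=
  exists C4 : R, forall (a1 a2 : nat) (x y : 'rV[R]_2),
    (2 <= a1 + a2 <= 2 * l)%N -> Gam x -> Gam y -> x != y ->
    `|mpderiv a1 a2 Kt (x - y)| <= C4 * enorm (x - y) `^ (2 * nu - 2 * l%:R).

End regularity.

(* Main.v *)
Require Import Defs.
From HB Require Import structures.
From mathcomp Require Import all_boot all_order all_algebra.
From mathcomp Require Import all_classical all_reals all_analysis.
From mathcomp Require Import measurable_realfun ring lra zify.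

Import Order.TTheory GRing.Theory Num.Theory.
Import numFieldNormedType.Exports.

Local Open Scope classical_set_scope.
Local Open Scope ring_scope.

(** Write [V] for the quadratic variation. Because the weights of each window
    sum to zero, [V] is a sum of squares of centred, jointly Gaussian variables
    [Y_i], and everything is decided by the matrix [C_ij] of their covariances:
    the mean is the trace of [C], the variance is twice the sum of the [C_ij ^ 2].

    Mean. Insert the covariance model into [C_ii] ([diag_expansion]). Constants
    are annihilated. The squared distances, when present, contribute a bounded
    quantity: the weights are divided differences in the chord lengths, and the
    points of a C2 curve are affine functions of the chord length up to second
    order, so the weighted sum of the points is bounded. The remainder [r] is of
    lower order than the principal term. In units of the local spacing [c_i] the
    chords of a window tend to 1, 2 and 1, so that the principal term is
    asymptotic to a nonzero constant times [c_i] to the power [2 nu - 2 l]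
    ([diag_main_asymp]); for [nu = 1] the logarithm of the spacing only
    multiplies the bounded double sum of squared distances. Hence the mean and
    [ftilde] are both asymptotic to one constant times the sum of these powers,
    which has order [n ^ (2 l + 1 - 2 nu)]. The sign of the constant is not
    computed: it is positive because the mean is nonnegative ([main_const_gt0]).

    Variance. Applying the weights in both variables leaves only derivatives of
    the covariance function of order between [2] and [2 l], evaluated at points
    of norm comparable to [|i - j|] times the mesh; hence [|C_ij|] is at most a
    constant times that norm to the power [2 nu - 2 l] ([off_diag_bound]). The
    smoothness assumption speaks of partial derivatives taken in one fixed
    order; the Peano form of the symmetry theorem yields the other orders and
    the continuity of the lower ones ([mpderiv_family]). Near the diagonal the
    Cauchy--Schwarz inequality suffices. The sum of the [C_ij ^ 2] is therefore
    bounded through the sum of [k ^ (4 nu - 4 l)], whose three regimes are the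
    three cases of the statement.

    Almost sure convergence. Let [W = V - E V] and [Q = sum C_ij Y_i Y_j].
    Gaussian integration by parts gives
      [E (W ^ (k + 1)) = 2 k E (Q W ^ (k - 1))]   ([csumsq_moment_rec]),
    and [Q <= |C| V] with the Euclidean norm [|C|] of the matrix; consequently
    the moment of order [2 m] of [W / E V] is at most the [m]-th power of
    [12 m |C| / E V] ([csumsq_moment_le]). The ratio [|C| / E V] is bounded by a
    negative power of [n], so for [m] large the moments are summable.

    Integration by parts itself is obtained from the moments of one-dimensional
    Gaussian variables, by comparing coefficients of polynomials in [x] in the
    moments of [Z + x Y]; no multivariate density is involved, so degenerate
    covariance matrices need no special treatment. *)

(** * Moments of the normal density *)

Section normal_moments.
Context {R : realType}.
Variables (m s : R).
Hypothesis s0 : s != 0.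
Notation leb := (@lebesgue_measure R).

Lemma pow_le_exp (k : nat) (y : R) : 0 <= y -> y ^+ k <= k%:R ^+ k * expR y.
Proof.
case: k => [|k] y0; first by rewrite !expr0 mul1r -expR0 ler_expR.
have -> : y = k.+1%:R * (y / k.+1%:R) by rewrite mulrC divfK// pnatr_eq0.
rewrite exprMn ler_pM2l ?exprn_gt0 ?ltr0n//.
rewrite expRM_natl lerXn2r// ?nnegrE ?expR_ge0 ?divr_ge0//.
by apply: le_trans (expR_ge1Dx _); rewrite lerDr.
Qed.

(** Half of the exponent absorbs any power of [x - m]; what is left is
    a normal density with a larger standard deviation, known to be integrable. *)
Lemma pow_normal_pdf_le (k : nat) : exists C : R, forall x,
  (x - m) ^+ (2 * k) * normal_pdf m s x <= C * normal_pdf m (Num.sqrt 2 * s) x.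
Proof.
have s2 : Num.sqrt 2 * s != 0 :> R by rewrite mulf_neq0// gt_eqF// sqrtr_gt0.
pose p1 := (normal_peak s : R); pose p2 := (normal_peak (Num.sqrt 2 * s) : R).
exists ((4 * s ^+ 2) ^+ k * k%:R ^+ k * (p1 / p2)) => x.
rewrite !normal_pdfE// /normal_fun -/p1 -/p2.
set y : R := (x - m) ^+ 2 / (4 * s ^+ 2).
have ss : 0 < s ^+ 2 by rewrite exprn_even_gt0.
have e1 : - (x - m) ^+ 2 / (s ^+ 2 *+ 2) = - y - y.
  by rewrite /y; field.
have e2 : - (x - m) ^+ 2 / ((Num.sqrt 2 * s) ^+ 2 *+ 2) = - y.
  by rewrite exprMn sqr_sqrtr// /y; field.
rewrite e1 e2 expRD.
have -> : (x - m) ^+ (2 * k) = (4 * s ^+ 2) ^+ k * y ^+ k.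
  by rewrite -exprMn /y exprM; congr (_ ^+ _); field; rewrite s0.
have p20 : 0 < p2 by exact: normal_peak_gt0.
have p10 : 0 < p1 by exact: normal_peak_gt0.
have y0 : 0 <= y by rewrite divr_ge0 ?sqr_ge0// mulr_ge0// sqr_ge0.
have h := pow_le_exp k y y0.
have : expR y * expR (- y) = 1 by rewrite -expRD subrr expR0.
set u := expR y; set v := expR (- y) => uv.
set A := (4 * s ^+ 2) ^+ k.
rewrite [X in _ <= X](_ : _ = A * (k%:R ^+ k * u) * (p1 * (v * v))).
  rewrite ler_wpM2r ?mulr_ge0 ?expR_ge0 ?(ltW p10)//.
  by rewrite ler_wpM2l// exprn_ge0// mulr_ge0// ltW.
have -> : A * (k%:R ^+ k * u) * (p1 * (v * v)) = A * k%:R ^+ k * p1 * v * (u * v).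
  by ring.
by rewrite uv; field; rewrite gt_eqF.
Qed.

Lemma integrable_pow_pdf (k : nat) :
  leb.-integrable [set: R] (fun x => ((x - m) ^+ k * normal_pdf m s x)%:E).
Proof.
have mk j : measurable_fun [set: R] (fun x => (x - m) ^+ j * normal_pdf m s x).
  apply: measurable_funM; last exact: measurable_normal_pdf.
  by apply: measurable_funX; exact: measurable_funB.
have even j : leb.-integrable [set: R]
    (fun x => ((x - m) ^+ (2 * j) * normal_pdf m s x)%:E).
  have [C hC] := pow_normal_pdf_le j.
  pose g x := (C%:E * (normal_pdf m (Num.sqrt 2 * s) x)%:E)%E.
  have ig : leb.-integrable [set: R] g.
    by apply: integrableZl => //; exact: integrable_normal_pdf.
  apply: (le_integrable _ _ _ ig) => //; first by apply/measurable_EFinP; exact: mk.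
  move=> x _ /=; rewrite lee_fin ger0_norm ?(le_trans (hC x)) ?ler_norm//.
  by rewrite mulr_ge0 ?normal_pdf_ge0// exprM exprn_ge0// sqr_ge0.
(* [|a| <= 1 + a ^ 2] reduces the power [k] to even powers *)
have ig := integrableD measurableT (even 0%N) (even k).
apply: (le_integrable _ _ _ ig) => //; first by apply/measurable_EFinP; exact: mk.
move=> x _ /=; rewrite lee_fin muln0 expr0 -mulrDl !normrM.
  rewrite ler_wpM2r// mulnC exprM; set a := (x - m) ^+ k.
rewrite [X in _ <= X]ger0_norm ?addr_ge0 ?sqr_ge0// -[a ^+ 2]real_normK ?num_real//.
have := sqr_ge0 (`|a| - 1/2); have := normr_ge0 a; nra.
Qed.

Lemma is_derive_pow_pdf (k : nat) (x : R) : is_derive x 1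
  (fun x => (x - m) ^+ k * normal_pdf m s x)
  (k%:R * ((x - m) ^+ k.-1 * normal_pdf m s x)
   - (s ^+ 2)^-1 * ((x - m) ^+ k.+1 * normal_pdf m s x)).
Proof.
rewrite normal_pdfE//.
have h1 : is_derive x 1 ((fun x : R => x) - cst m) (1 : R).
  by apply: is_derive_eq; rewrite ?subr0.
have h2 : is_derive x 1 (- (s ^+ 2 *+ 2)^-1 \*: (((fun x : R => x) - cst m) ^+ 2))
   (- (x - m) / s ^+ 2).
  apply: is_derive_eq; rewrite /GRing.scale/= !fctE/=; field.
  done.
have h3 : is_derive x 1 (fun x => (x - m) ^+ k * (normal_peak s * normal_fun m s x))
  (normal_peak s * ((k%:R * (x - m) ^+ k.-1) * normal_fun m s x + (x - m) ^+ k * (normal_fun m s x * (- (x - m) / s ^+ 2)))).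
  rewrite (_ : (fun x => _) = normal_peak s \*: ((((fun x : R => x) - cst m) ^+ k) *
     (expR \o (- (s ^+ 2 *+ 2)^-1 \*: (((fun x : R => x) - cst m) ^+ 2))))); last first.
    apply/funext => z; rewrite !fctE/= /GRing.scale/= /normal_fun.
    rewrite [LHS]mulrCA; congr (_ * (_ * expR _)); ring.
  apply: is_derive_eq; rewrite /GRing.scale/= !fctE/= /GRing.scale/= /normal_fun.
  rewrite (_ : - (x - m) ^+ 2 / (s ^+ 2 *+ 2) = - (s ^+ 2 *+ 2)^-1 * (x - m) ^+ 2); ring.
apply: (is_derive_eq h3).
by rewrite [(x - m) ^+ k.+1]exprS; field.
Qed.

Definition pdf_moment k : R := fine (\int[leb]_x ((x - m) ^+ k * normal_pdf m s x)%:E)%E.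

Let F (k : nat) (x : R) : R := (x - m) ^+ k * normal_pdf m s x.
Let dF (k : nat) (x : R) : R := k%:R * F k.-1 x - (s ^+ 2)^-1 * F k.+1 x.

Lemma continuous_pow_pdf k : continuous (F k).
Proof.
move=> x; apply: differentiable_continuous; apply/derivable1_diffP.
by have [] := is_derive_pow_pdf k x.
Qed.

Lemma integral_dpow_pdf_sym k (n : nat) : (0 < n)%N ->
  (\int[leb]_(x in `[(m - n%:R)%R, (m + n%:R)%R]) (dF k x)%:E = (F k (m + n%:R))%:E - (F k (m - n%:R))%:E)%E.
Proof.
move=> n0; apply: continuous_FTC2.
- by rewrite ltrD2l gtrN// ltr0n.
- apply: continuous_subspaceT => x.
  by apply: cvgB; apply: cvgM; (exact: cvg_cst || exact: continuous_pow_pdf).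
- split.
  + by move=> x _; have [] := is_derive_pow_pdf k x.
  + exact/cvg_at_right_filter/continuous_pow_pdf.
  + exact/cvg_at_left_filter/continuous_pow_pdf.
- move=> x _; rewrite derive1E; by case: (is_derive_pow_pdf k x).
Qed.

Lemma pow_pdf_cvg0 k : F k (m + n%:R) @[n --> \oo] --> (0 : R) /\ F k (m - n%:R) @[n --> \oo] --> (0 : R).
Proof.
have [C hC] := pow_normal_pdf_le k.+1.
have key (b : bool) : F k (m + (-1) ^+ b * n%:R) @[n --> \oo] --> (0 : R).
  pose D := `|C| * normal_peak (Num.sqrt 2 * s).
  apply/cvgr0Pnorm_le => /= e e0; near=> n.
  have n0 : (0 : R) < n%:R by rewrite ltr0n; near: n; exact: nbhs_infty_gt.
  have hD : n%:R ^+ (2 * k.+1) * normal_pdf m s (m + (-1) ^+ b * n%:R) <= D.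
    have := hC (m + (-1) ^+ b * n%:R).
    rewrite addrAC subrr add0r exprMn exprM sqrr_sign expr1n mul1r.
    move=> /le_trans; apply.
    apply: (@le_trans _ _ (`|C| * normal_pdf m (Num.sqrt 2 * s) (m + (-1) ^+ b * n%:R))).
      by rewrite ler_wpM2r ?normal_pdf_ge0// ler_norm.
    rewrite ler_wpM2l// normal_pdf_ub// mulf_neq0// gt_eqF// sqrtr_gt0.
  have n1 : (1 : R) <= n%:R by rewrite ler1n; near: n; exact: nbhs_infty_gt.
  rewrite /F addrAC subrr add0r normrM normrX normrM normrX normrN normr1 expr1n mul1r.
  rewrite (ger0_norm (ltW n0)) (ger0_norm (normal_pdf_ge0 _ _ _)).
  set p := normal_pdf _ _ _ in hD *.
  have p0 : 0 <= p by exact: normal_pdf_ge0.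
  have h1 : n%:R ^+ k * p * n%:R <= D.
    apply: le_trans hD; rewrite (_ : (2 * k.+1)%N = (k + k.+2)%N); last first.
      by lia.
    rewrite exprD mulrAC ler_wpM2r// ler_wpM2l ?exprn_ge0 ?(ltW n0)//.
    by rewrite exprS ler_peMr ?(ltW n0)// exprn_ege1.
  have h2 : D <= e * n%:R.
    rewrite mulrC -ler_pdivrMr//; near: n; exact: nbhs_infty_ger.
  by rewrite -(ler_pM2r n0) (le_trans h1).
split; first by have := key false; under eq_fun do rewrite mul1r.
by have := key true; under eq_fun do rewrite mulN1r.
Unshelve. all: by end_near. Qed.

Lemma integrable_dpow_pdf k : leb.-integrable [set: R] (fun x => (dF k x)%:E).
Proof.
have := integrableB measurableT (integrableZl measurableT k%:R (integrable_pow_pdf k.-1))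
   (integrableZl measurableT (s ^+ 2)^-1 (integrable_pow_pdf k.+1)).
by apply: eq_integrable.
Qed.

(** The derivative of a function that tends to zero at both ends has
    integral zero; this is the integration by parts behind the recursion below. *)
Lemma integral_dpow_pdf k : (\int[leb]_x (dF k x)%:E = 0)%E.
Proof.
pose f_ (n : nat) := (fun x => (dF k x)%:E) \_ `[(m - n%:R)%R, (m + n%:R)%R].
have mf : measurable_fun [set: R] (fun x => (dF k x)%:E).
  by have /integrableP[] := integrable_dpow_pdf k.
have [|//||||_ _ h] := @dominated_convergence _ _ _ leb [set: R] measurableT f_ (fun x => (dF k x)%:E)
   (fun x => `|(dF k x)%:E|)%E.
- move=> n; apply/(measurable_restrict _ _ _) => //.
  exact: measurable_funS mf.
- apply/aeW => x _; apply: cvg_near_cst; near=> n.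
  rewrite /f_ patchE mem_set//= in_itv/= -ler_distlC.
  by near: n; exact: nbhs_infty_ger.
- exact/integrable_abse/integrable_dpow_pdf.
- apply/aeW => x n _ ; rewrite /f_ patchE; case: ifP => // _; rewrite abse0 abse_ge0//.
have [c1 c2] := pow_pdf_cvg0 k.
have h0 : (F k (m + n%:R) - F k (m - n%:R))%:E @[n --> \oo] --> 0%E.
  apply: cvg_EFin; first exact: nearW.
  by rewrite -[X in _ --> X]subr0; apply: cvgB.
apply: (cvg_unique _ h); first exact: ereal_hausdorff.
apply: cvg_trans h0; apply: near_eq_cvg; near=> n.
rewrite /f_ /= -integral_mkcond integral_dpow_pdf_sym//.
by near: n; exact: nbhs_infty_gt.
Unshelve. all: by end_near. Qed.

Lemma pdf_moment_rec k : pdf_moment k.+1 = k%:R * s ^+ 2 * pdf_moment k.-1.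
Proof.
have := integral_dpow_pdf k.
rewrite (_ : (fun x => _) = (fun x => k%:R%:E * ((x - m) ^+ k.-1 * normal_pdf m s x)%:E
    - (s ^- 2)%:E * ((x - m) ^+ k.+1 * normal_pdf m s x)%:E)%E); last first.
  by apply/funext => x.
rewrite integralB//; [|exact: integrableZl (integrable_pow_pdf _)..].
rewrite integralZl//; last exact: integrable_pow_pdf.
rewrite integralZl//; last exact: integrable_pow_pdf.
have fin j := integrable_fin_num measurableT (integrable_pow_pdf j).
rewrite -(fineK (fin k.-1)) -(fineK (fin k.+1)) -/(pdf_moment _) -/(pdf_moment _).
move=> [] /eqP; rewrite subr_eq0 => /eqP h.
by rewrite mulrAC h mulrAC mulVf ?mul1r// expf_neq0.
Qed.

End normal_moments.

(** * Moments of Gaussian random variables *)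

Section gaussian_law_integral.
Context {R : realType}.
Notation leb := (@lebesgue_measure R).

(** The Radon--Nikodym derivative of [normal_prob] is only almost
    everywhere equal to [normal_pdf]. *)
Lemma ge0_integral_normal_prob (m s : R) (f : R -> \bar R) :
  (forall x, 0 <= f x)%E -> measurable_fun [set: R] f ->
  (\int[normal_prob m s]_x f x = \int[leb]_x (f x * (normal_pdf m s x)%:E))%E.
Proof.
move=> f0 mf; have dom := @normal_prob_dominates R m s.
rewrite -(Radon_Nikodym_SigmaFinite.change_of_variables dom)//.
have ri := Radon_Nikodym_SigmaFinite.f_integrable dom.
have mpdf : measurable_fun [set: R] (fun x => (normal_pdf m s x)%:E).
  by apply/measurable_EFinP; exact: measurable_normal_pdf.
apply: ae_eq_integral => //.
- by apply: emeasurable_funM => //; exact: measurable_int ri.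
- by apply: emeasurable_funM.
- apply: ae_eqe_mul2l; apply: integral_ae_eq => // E _ mE.
  by rewrite -Radon_Nikodym_SigmaFinite.f_integral.
Qed.

Context d (T : measurableType d) (P : probability T R).

Lemma ge0_integral_gaussian (Z : T -> R) (m s : R) (mZ : measurable_fun setT Z) (f : R -> \bar R) :
  s != 0 -> (forall A, measurable A -> P (Z @^-1` A) = gaussian_law m s A) ->
  (forall x, 0 <= f x)%E -> measurable_fun [set: R] f ->
  (\int[P]_w f (Z w) = \int[leb]_x (f x * (normal_pdf m s x)%:E))%E.
Proof.
move=> s0 law f0 mf; rewrite -ge0_integral_normal_prob//.
have mZ' : measurable_fun setT (Z : T -> measurableTypeR R) by exact: mZ.
have mf' : measurable_fun [set: measurableTypeR R] f by exact: mf.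
transitivity (\int[pushforward P (Z : T -> measurableTypeR R)]_x f x)%E.
  by rewrite (ge0_integral_pushforward mZ').
apply: (eq_measure_integral (normal_prob m s)) => A mA _.
by have := law A mA; rewrite /gaussian_law (negbTE s0).
Qed.

Lemma integral_gaussian (Z : T -> R) (m s : R) (mZ : measurable_fun setT Z) (f : R -> R) :
  s != 0 -> (forall A, measurable A -> P (Z @^-1` A) = gaussian_law m s A) ->
  measurable_fun [set: R] f ->
  (\int[P]_w (f (Z w))%:E = \int[leb]_x (f x * normal_pdf m s x)%:E)%E.
Proof.
move=> s0 law mf; have mf' : measurable_fun [set: R] (EFin \o f) by exact/measurable_EFinP.
rewrite integralE [RHS]integralE.
have pos (g : R -> R) : measurable_fun [set: R] g ->
    (\int[P]_w ((fun w => (g (Z w))%:E)^\+) w = \int[leb]_x ((fun x => (g x * normal_pdf m s x)%:E)^\+ x))%E.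
  move=> mg; transitivity (\int[P]_w ((fun x => (Num.max (g x) 0)%:E) (Z w)))%E.
    by apply: eq_integral => w _; rewrite funeposE EFin_max.
  rewrite (ge0_integral_gaussian Z m s mZ (fun x => (Num.max (g x) 0)%:E) s0 law)//; last 2 first.
  - by move=> x; rewrite lee_fin le_max lexx orbT.
  - by apply/measurable_EFinP; apply: measurable_funTS; apply: measurable_maxr.
  apply: eq_integral => x _; rewrite funeposE EFin_max EFinM.
  by rewrite maxeMl ?lee_fin ?normal_pdf_ge0// mul0e.
congr (_ - _)%E; first exact: pos.
transitivity (\int[P]_w ((fun w => (- f (Z w))%:E)^\+ w))%E.
  by apply: eq_integral => w _; rewrite funenegE funeposE EFinN.
rewrite (pos (fun x => - f x) (measurable_funN mf)); apply: eq_integral => x _.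
by rewrite funenegE funeposE mulNr EFinN.
Qed.

(** A real number instead of an extended one, so that moments can be manipulated
    by ring identities; it is meaningful for integrable [f] only. *)
Definition expect (f : T -> R) : R := fine (\int[P]_w (f w)%:E)%E.

(** Integrability and this recursion are all that is used of the normal
    law. They also hold for a point mass, where the centred moments of positive
    order vanish. *)
Lemma gaussian_rv_moments (Z : T -> R) : measurable_fun setT Z -> gaussian_rv P Z ->
  exists m s : R, forall k : nat,
    P.-integrable setT (fun w => ((Z w - m) ^+ k)%:E) /\
    expect (fun w => (Z w - m) ^+ k.+1) = k%:R * s ^+ 2 * expect (fun w => (Z w - m) ^+ k.-1).
Proof.
move=> mZ [m [s [_ law]]]; exists m, s => k.
have mk j : measurable_fun [set: R] (fun x : R => (x - m) ^+ j).
  by apply: measurable_funX; exact: measurable_funB.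
have mZk j : measurable_fun setT (fun w => (Z w - m) ^+ j).
  by apply: measurable_funX; apply: measurable_funB.
have [s0|s0] := eqVneq s 0.
  have ae j : ae_eq P setT (fun w => ((Z w - m) ^+ j)%:E) (cst (0 ^+ j)%:E).
    have mm : measurable (Z @^-1` [set m]).
      by rewrite -[X in measurable X]setTI; exact: mZ.
    exists (~` (Z @^-1` [set m])); split; first exact: measurableC.
      rewrite [LHS]probability_setC// (law _ (measurable_set1 m)) /gaussian_law s0 eqxx.
      by rewrite /dirac/= indicE mem_set// subee.
    by move=> w /= h hw; apply: h => _; rewrite hw subrr.
  split.
    apply/integrableP; split; first exact/measurable_EFinP.
    rewrite (ae_eq_integral (cst `|0 ^+ k|%:E))//.
    - by rewrite integral_cst//= probability_setT mule1 ltry.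
    - by apply/measurable_EFinP; apply: measurableT_comp.
    - by apply: filterS (ae k) => w /= /(_ I)[->].
  rewrite s0 expr0n/= mulr0 mul0r /expect (ae_eq_integral (cst 0%:E))//.
  - by rewrite integral_cst//= mul0e.
  - exact/measurable_EFinP.
  - by apply: filterS (ae k.+1) => w /= /(_ I)[->]; rewrite expr0n.
split; last first.
  rewrite /expect (integral_gaussian Z m s mZ _ s0 law (mk k.+1)) (integral_gaussian Z m s mZ _ s0 law (mk k.-1)).
  exact: pdf_moment_rec.
apply/integrableP; split; first exact/measurable_EFinP.
have mnk : measurable_fun [set: R] (fun x : R => `|(x - m) ^+ k|) by exact: measurableT_comp.
rewrite (integral_gaussian Z m s mZ _ s0 law mnk).
have /integrableP[_] := integrable_pow_pdf m s s0 k.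
apply: le_lt_trans; rewrite le_eqVlt; apply/orP; left; apply/eqP.
by apply: eq_integral => x _; rewrite /= normrM [`|normal_pdf _ _ _|]ger0_norm// normal_pdf_ge0.
Qed.

End gaussian_law_integral.
Arguments expect {R d T} P f.

Set Implicit Arguments.
Unset Strict Implicit.

(** * Random variables with moments of all orders *)

Section expectation.
Context d (T : measurableType d) (R : realType) (P : probability T R).
Implicit Types f g h : T -> R.
Local Notation Ex := (expect P).

(** A class of integrable variables stable under the ring operations, so that
    integrability need not be checked anew for each polynomial expression. *)
Definition has_moments f := measurable_fun setT f /\
  forall k : nat, P.-integrable setT (fun w => (f w ^+ k)%:E).

Lemma has_moments_meas f : has_moments f -> measurable_fun setT f.
Proof. by case. Qed.

Lemma has_moments_int f : has_moments f -> P.-integrable setT (fun w => (f w)%:E).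
Proof. by case=> _ /(_ 1%N). Qed.

Lemma integrable_dom f g : measurable_fun setT f ->
  P.-integrable setT (fun w => (g w)%:E) -> (forall w, `|f w| <= g w) ->
  P.-integrable setT (fun w => (f w)%:E).
Proof.
move=> mf ig fg; apply: (le_integrable _ _ _ ig) => //; first exact/measurable_EFinP.
by move=> w _ /=; rewrite lee_fin (le_trans (fg w))// ler_norm.
Qed.

Lemma integrable_realD f g : P.-integrable setT (fun w => (f w)%:E) ->
  P.-integrable setT (fun w => (g w)%:E) -> P.-integrable setT (fun w => (f w + g w)%:E).
Proof. move=> fi gi; exact: (integrableD measurableT fi gi). Qed.

Lemma integrable_realZ c f : P.-integrable setT (fun w => (f w)%:E) ->
  P.-integrable setT (fun w => (c * f w)%:E).
Proof. move=> fi; exact: (integrableZl measurableT c fi). Qed.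

Lemma has_moments_cst c : has_moments (fun _ => c).
Proof.
split; first exact: measurable_cst.
by move=> k; exact: finite_measure_integrable_cst.
Qed.

Lemma has_momentsM f g : has_moments f -> has_moments g ->
  has_moments (fun w => f w * g w).
Proof.
move=> [mf If] [mg Ig]; split; first exact: measurable_funM.
move=> k; apply: (@integrable_dom _ (fun w => f w ^+ (2 * k) + g w ^+ (2 * k))).
- by apply: measurable_funX; exact: measurable_funM.
- exact: integrable_realD.
(* [|a b| <= a ^ 2 + b ^ 2] *)
- move=> w; rewrite exprMn mulnC !exprM; move: (f w ^+ k) (g w ^+ k) => a b.
  rewrite normrM -(real_normK (num_real a)) -(real_normK (num_real b)).
  have := sqr_ge0 (`|a| - `|b|); have := normr_ge0 a; have := normr_ge0 b; nra.
Qed.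

Lemma has_momentsD f g : has_moments f -> has_moments g ->
  has_moments (fun w => f w + g w).
Proof.
move=> [mf If] [mg Ig]; split; first exact: measurable_funD.
move=> k; apply: (@integrable_dom _ (fun w => 1 + 4 ^+ k * (f w ^+ (2 * k) + g w ^+ (2 * k)))).
- by apply: measurable_funX; exact: measurable_funD.
- apply: integrable_realD; first exact: finite_measure_integrable_cst.
  by apply: integrable_realZ; exact: integrable_realD.
- move=> w.
  have h1 (a : R) : `|a| <= 1 + a ^+ 2.
    rewrite -(real_normK (num_real a)); have := sqr_ge0 (`|a| - 1); have := normr_ge0 a; nra.
  apply: (le_trans (h1 _)); rewrite lerD2l -exprM mulnC exprM.
  move: (f w) (g w) => a b.
  (* the larger of the two squares dominates, up to the factor [4] *)
  have : ((a + b) ^+ 2) ^+ k <= (4 * Num.max (a ^+ 2) (b ^+ 2)) ^+ k.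
    rewrite lerXn2r ?nnegrE ?sqr_ge0 ?mulr_ge0 ?le_max ?sqr_ge0//.
    have := sqr_ge0 (a - b).
    by have [h|h] := leP (a ^+ 2) (b ^+ 2); nra.
  move=> /le_trans; apply; rewrite exprMn ler_wpM2l ?exprn_ge0// !exprM.
  have [h|h] := leP (a ^+ 2) (b ^+ 2); first by rewrite lerDr exprn_ge0 ?sqr_ge0.
  by rewrite lerDl exprn_ge0 ?sqr_ge0.
Qed.

Lemma has_momentsZ c f : has_moments f -> has_moments (fun w => c * f w).
Proof. by move=> ?; apply: has_momentsM => //; exact: has_moments_cst. Qed.

Lemma has_momentsX f k : has_moments f -> has_moments (fun w => f w ^+ k).
Proof.
move=> hf; elim: k => [|k ih]; first by under eq_fun do rewrite expr0; exact: has_moments_cst.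
by under eq_fun do rewrite exprS; exact: has_momentsM.
Qed.

Lemma has_moments_sum (I : Type) (r : seq I) (F : I -> T -> R) :
  (forall i, has_moments (F i)) -> has_moments (fun w => \sum_(i <- r) F i w).
Proof.
move=> hF; elim: r => [|i r ih].
  by under eq_fun do rewrite big_nil; exact: has_moments_cst.
by under eq_fun do rewrite big_cons; exact: has_momentsD.
Qed.

Lemma eq_expect f g : f =1 g -> Ex f = Ex g.
Proof. by move=> /funext ->. Qed.

Lemma Ex_cst c : Ex (fun _ => c) = c.
Proof. by rewrite /expect integral_cst//= probability_setT mule1. Qed.

Lemma ExD_int f g : P.-integrable setT (fun w => (f w)%:E) ->
  P.-integrable setT (fun w => (g w)%:E) -> Ex (fun w => f w + g w) = Ex f + Ex g.
Proof. by move=> fi gi; exact: RintegralD. Qed.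

Lemma ExD f g : has_moments f -> has_moments g -> Ex (fun w => f w + g w) = Ex f + Ex g.
Proof. by move=> /has_moments_int ? /has_moments_int ?; exact: ExD_int. Qed.

Lemma ExZ c f : has_moments f -> Ex (fun w => c * f w) = c * Ex f.
Proof. by move=> /has_moments_int ?; exact: RintegralZl. Qed.

Lemma Ex_sum (I : Type) (r : seq I) (F : I -> T -> R) :
  (forall i, has_moments (F i)) ->
  Ex (fun w => \sum_(i <- r) F i w) = \sum_(i <- r) Ex (F i).
Proof.
move=> hF; elim: r => [|i r ih].
  by rewrite big_nil -[RHS](Ex_cst 0); congr Ex; apply/funext => w; rewrite big_nil.
rewrite big_cons -ih -ExD//; last exact: has_moments_sum.
by congr Ex; apply/funext => w; rewrite big_cons.
Qed.

Lemma Ex_le f g : has_moments f -> has_moments g -> (forall w, f w <= g w) -> Ex f <= Ex g.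
Proof. by move=> /has_moments_int ? /has_moments_int ? fg; apply: le_Rintegral. Qed.

Lemma Ex_ge0 f : (forall w, 0 <= f w) -> 0 <= Ex f.
Proof. by move=> f0; apply: fine_ge0; apply: integral_ge0 => w _; rewrite lee_fin. Qed.

Lemma EFin_Ex f : has_moments f -> (Ex f)%:E = (\int[P]_w (f w)%:E)%E.
Proof. by move=> /has_moments_int h; rewrite fineK//; exact: integrable_fin_num. Qed.

Lemma expect_sqr_le f g : has_moments f -> has_moments g ->
  Ex (fun w => f w * g w) ^+ 2 <= Ex (fun w => f w * f w) * Ex (fun w => g w * g w).
Proof.
move=> hf hg.
have mff := has_momentsM hf hf; have mfg := has_momentsM hf hg; have mgg := has_momentsM hg hg.
have q t : 0 <= Ex (fun w => f w * f w) + 2 * t * Ex (fun w => f w * g w) + t ^+ 2 * Ex (fun w => g w * g w).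
  rewrite -!ExZ// -!ExD//; do ?apply: has_momentsD => //; do ?apply: has_momentsZ => //.
  apply: Ex_ge0 => w; rewrite (_ : _ + _ = (f w + t * g w) ^+ 2) ?sqr_ge0//; ring.
move: q; set a := Ex (fun w => f w * f w); set b := Ex (fun w => f w * g w); set c := Ex _ => q.
have c0 : 0 <= c by apply: Ex_ge0 => w; rewrite -expr2 sqr_ge0.
have [cz|cnz] := eqVneq c 0.
  have [->|bnz] := eqVneq b 0; first by rewrite cz mulr0 expr0n.
  (* a nonconstant affine function of [t] takes negative values *)
  have := q (- (a + 1) / (2 * b)); rewrite cz mulr0 addr0.
  rewrite (_ : a + _ = -1); last by field.
  by rewrite oppr_ge0 ler10.
have := q (- b / c); rewrite (_ : a + _ + _ = a - b ^+ 2 / c); last by field.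
by rewrite subr_ge0 ler_pdivrMr// lt_neqAle eq_sym cnz.
Qed.

End expectation.

(** * Gaussian integration by parts *)

Section poly_ident.
Context {R : realType}.

Lemma poly_fun_inj (p q : {poly R}) : (forall x, p.[x] = q.[x]) -> p = q.
Proof.
move=> pq; apply/eqP; rewrite -subr_eq0; apply/negPn/negP => d0.
pose s := [seq (i%:R : R) | i <- iota 0 (size (p - q))].
have us : uniq s by rewrite map_inj_uniq ?iota_uniq// => i j /eqP; rewrite eqr_nat => /eqP.
have rs : all (root (p - q)) s.
  by apply/allP => x _; rewrite rootE !hornerE pq subrr.
by have := max_poly_roots d0 rs us; rewrite size_map size_iota ltnn.
Qed.

End poly_ident.

Section gaussian_calculus.
Context d (T : measurableType d) (R : realType) (P : probability T R).
Implicit Types f g h Y Z H : T -> R.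
Local Notation Ex := (expect P).
Local Notation mom := (has_moments P).

(** The moments of [Z + x Y] against [H] as a polynomial in [x]: an identity
    between such moments, valid for all [x], can be read off coefficientwise. *)
Definition shift_poly H Z Y (k : nat) : {poly R} :=
  \poly_(j < k.+1) (Ex (fun w => H w * (Z w ^+ (k - j) * Y w ^+ j)) *+ 'C(k, j)).

Lemma shift_polyE H Z Y k x : mom H -> mom Z -> mom Y ->
  (shift_poly H Z Y k).[x] = Ex (fun w => H w * (Z w + x * Y w) ^+ k).
Proof.
move=> hH hZ hY; rewrite horner_poly.
have hm j : mom (fun w => H w * (Z w ^+ (k - j) * Y w ^+ j)).
  by do 2! apply: has_momentsM => //; exact: has_momentsX.
transitivity (Ex (fun w => \sum_(j < k.+1) ('C(k, j)%:R * x ^+ j) * (H w * (Z w ^+ (k - j) * Y w ^+ j)))).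
  rewrite Ex_sum; last by move=> j; exact: has_momentsZ.
  by apply: eq_bigr => j _; rewrite ExZ// -mulr_natr; ring.
congr Ex; apply/funext => w; rewrite exprDn mulr_sumr; apply: eq_bigr => j _.
by rewrite -mulr_natr exprMn; ring.
Qed.

Lemma shift_poly0 H Z Y k : (shift_poly H Z Y k)`_0 = Ex (fun w => H w * Z w ^+ k).
Proof.
rewrite coef_poly/= bin0 mulr1n subn0.
by congr Ex; apply/funext => w; rewrite expr0 mulr1.
Qed.

Lemma shift_poly1 H Z Y k : (shift_poly H Z Y k)`_1 =
  k%:R * Ex (fun w => H w * (Z w ^+ k.-1 * Y w)).
Proof.
rewrite coef_poly/=; case: k => [|k]/=; first by rewrite mul0r.
by rewrite bin1 -[LHS]mulr_natl; congr (_ * _); apply: eq_expect => w; rewrite subSS subn0 expr1.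
Qed.

Variable S : (T -> R) -> Prop.

(** A linear space of centred Gaussian variables, seen through moments:
    with [k = 0] the recursion says that the mean vanishes. *)
Definition gaussian_family :=
  [/\ forall a f g, S f -> S g -> S (fun w => f w + a * g w),
      forall f, S f -> mom f &
      forall f k, S f -> Ex (fun w => f w ^+ k.+1) =
        k%:R * Ex (fun w => f w ^+ 2) * Ex (fun w => f w ^+ k.-1)].

Hypothesis HS : gaussian_family.

Let S_lin a f g : S f -> S g -> S (fun w => f w + a * g w).
Proof. by case: HS => h _ _; exact: h. Qed.

Let S_mom f : S f -> mom f. Proof. by case: HS => _ h _; exact: h. Qed.

Let S_rec f k : S f -> Ex (fun w => f w ^+ k.+1) =
  k%:R * Ex (fun w => f w ^+ 2) * Ex (fun w => f w ^+ k.-1).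
Proof. by case: HS => _ _ h; exact: h. Qed.

Let mom1 : mom (fun _ => 1). Proof. exact: has_moments_cst. Qed.

Let Ex1 f : Ex (fun w => 1 * f w) = Ex f.
Proof. by congr Ex; apply/funext => w; rewrite mul1r. Qed.

(** The coefficient of [x] in the moment recursion for [Z + x Y]. *)
Lemma gaussian_ibp_pow Y Z k : S Y -> S Z ->
  Ex (fun w => Y w * Z w ^+ k) = k%:R * Ex (fun w => Y w * Z w) * Ex (fun w => Z w ^+ k.-1).
Proof.
move=> SY SZ; have [k' kk'] := ubnP k; elim: k' k kk' => // n ih k; rewrite ltnS => kn.
have e : shift_poly (fun _ => 1) Z Y k.+1 =
    (k%:R : R) *: (shift_poly (fun _ => 1) Z Y 2 * shift_poly (fun _ => 1) Z Y k.-1).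
  apply: poly_fun_inj => x; rewrite !hornerE !shift_polyE; try exact: S_mom; try exact: mom1.
  by rewrite !Ex1 S_rec ?mulrA//; exact: S_lin.
have := congr1 (fun p : {poly R} => p`_1) e.
rewrite coefZ coefM !big_ord_recl big_ord0 addr0 /= !shift_poly1 !shift_poly0 !Ex1/=.
rewrite (_ : (fun w => Z w ^+ 1 * Y w) = (fun w => Y w * Z w)); last by apply/funext => w; rewrite expr1 mulrC.
rewrite (_ : (fun w => Z w ^+ k * Y w) = (fun w => Y w * Z w ^+ k)); last by apply/funext => w; rewrite mulrC.
rewrite (_ : (fun w => Z w ^+ k.-2 * Y w) = (fun w => Y w * Z w ^+ k.-2)); last by apply/funext => w; rewrite mulrC.
case: k kn {e} => [|[|k]] kn /=.
- by rewrite !mul0r mul1r.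
- by move=> e; lra.
- rewrite (ih k); last exact: leq_trans kn.
  rewrite (S_rec k SZ) => e.
  have k0 : (k.+3%:R : R) != 0 by rewrite pnatr_eq0.
  apply: (mulfI k0); rewrite e; rewrite -[k.+3]addn3 -[k.+2]addn2 -[k.+1]addn1 !natrD; ring.
Qed.

Definition prods (s : seq (T -> R)) w : R := \prod_(f <- s) f w.

(** The derivative of a product along [Y], for which the derivative of a factor [f]
    is the covariance of [Y] and [f]. *)
Fixpoint dprods Y (s : seq (T -> R)) w : R :=
  if s is f :: s' then Ex (fun w => Y w * f w) * prods s' w + f w * dprods Y s' w
  else 0.

Definition allS (s : seq (T -> R)) := foldr (fun f Q => S f /\ Q) True s.

Lemma prods_cons f s w : prods (f :: s) w = f w * prods s w.
Proof. by rewrite /prods big_cons. Qed.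

Lemma prods_nil w : prods [::] w = 1.
Proof. by rewrite /prods big_nil. Qed.

Lemma has_moments_prods s : allS s -> mom (prods s).
Proof.
elim: s => [_|f s ih /= [Sf Ss]].
  rewrite (_ : prods [::] = fun _ => 1) //; exact/funext/prods_nil.
rewrite (_ : prods (f :: s) = fun w => f w * prods s w); last exact/funext/prods_cons.
by apply: has_momentsM; [exact: S_mom|exact: ih].
Qed.

Lemma has_moments_dprods Y s : allS s -> mom (dprods Y s).
Proof.
elim: s => [_|f s ih /= [Sf Ss]]; first exact: has_moments_cst.
apply: has_momentsD; first by apply: has_momentsZ; exact: has_moments_prods.
by apply: has_momentsM; [exact: S_mom|exact: ih].
Qed.

(** Polarization: the identity for [s] and [Z + x f], at order one in
    [x], is the identity for [f :: s] and [Z]. The power of [Z] is what makes the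
    induction possible. *)
Lemma gaussian_ibp_prods_pow Y s Z k : S Y -> allS s -> S Z ->
  Ex (fun w => Y w * prods s w * Z w ^+ k) = Ex (fun w => dprods Y s w * Z w ^+ k) +
    k%:R * Ex (fun w => Y w * Z w) * Ex (fun w => prods s w * Z w ^+ k.-1).
Proof.
move=> SY; elim: s k Z => [|f s ih] k Z.
  move=> _ SZ; rewrite (@eq_expect _ _ _ P _ (fun w => Y w * Z w ^+ k)); last first.
    by move=> w; rewrite prods_nil mulr1.
  rewrite gaussian_ibp_pow// (@eq_expect _ _ _ P (fun w => dprods _ _ _ * _) (fun _ => 0)); last first.
    by move=> w; rewrite /= mul0r.
  by rewrite Ex_cst add0r; congr (_ * _); apply: eq_expect => w; rewrite prods_nil mul1r.
move=> /= [Sf Ss] SZ.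
have mY := S_mom SY; have mf := S_mom Sf; have mZ := S_mom SZ.
have mP := has_moments_prods Ss; have mdP := has_moments_dprods Y Ss.
have e : shift_poly (fun w => Y w * prods s w) Z f k.+1 =
  shift_poly (dprods Y s) Z f k.+1 +
  (k.+1%:R : R) *: (((Ex (fun w => Y w * Z w))%:P + (Ex (fun w => Y w * f w)) *: 'X) * shift_poly (prods s) Z f k).
  apply: poly_fun_inj => x.
  rewrite hornerD hornerZ hornerM hornerD hornerZ hornerC hornerX !shift_polyE//; last exact: has_momentsM.
  have SW := S_lin x SZ Sf.
  rewrite (ih k.+1 _ Ss SW)/= mulrA; congr (_ + _ * _ * _).
  rewrite (@eq_expect _ _ _ P _ (fun w => Y w * Z w + x * (Y w * f w))); last by move=> w; ring.
  rewrite ExD ?ExZ//; try (apply: has_momentsZ); try exact: has_momentsM.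
  by rewrite mulrC.
have := congr1 (fun p : {poly R} => p`_1) e.
rewrite coefD coefZ coefM !big_ord_recl big_ord0 !addr0 /= !coefD !coefC !coefZ !coefX /=.
rewrite !shift_poly1 !shift_poly0 /= mulr0 add0r mulr1 addr0 => h.
have k0 : (k.+1%:R : R) != 0 by rewrite pnatr_eq0.
apply: (mulfI k0).
rewrite (@eq_expect _ _ _ P _ (fun w => Y w * prods s w * (Z w ^+ k * f w))); last first.
  by move=> w; rewrite prods_cons; ring.
rewrite h.
rewrite (@eq_expect _ _ _ P (fun w => (_ + _) * _) (fun w => Ex (fun w => Y w * f w) * (prods s w * Z w ^+ k)
   + dprods Y s w * (Z w ^+ k * f w))); last by move=> w; ring.
rewrite (@eq_expect _ _ _ P (fun w => prods (f :: s) w * _) (fun w => prods s w * (Z w ^+ k.-1 * f w))); last first.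
  by move=> w; rewrite prods_cons; ring.
rewrite ExD ?ExZ; [ring|..]; do ?apply: has_momentsM => //; do ?apply: has_momentsX => //; do ?exact: has_moments_cst.
Qed.

Lemma gaussian_ibp_prods Y s : S Y -> allS s ->
  Ex (fun w => Y w * prods s w) = Ex (dprods Y s).
Proof.
move=> SY Ss; have := @gaussian_ibp_prods_pow Y s Y 0 SY Ss SY.
rewrite !mul0r addr0.
rewrite (@eq_expect _ _ _ P _ (fun w => Y w * prods s w)); last by move=> w; rewrite expr0 mulr1.
by move=> ->; apply: eq_expect => w; rewrite expr0 mulr1.
Qed.

(** The polynomial [g] is the derivative of the polynomial [f] along [Y]. Integration
    by parts is required against all products: then the Leibniz rule for a factor
    [Z] follows by moving [Z] into the test product. *)
Definition gderiv Y f g := [/\ mom f, mom g & forall s, allS s ->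
  Ex (fun w => Y w * f w * prods s w) =
  Ex (fun w => g w * prods s w) + Ex (fun w => f w * dprods Y s w)].

Lemma gderiv_cst Y c : S Y -> gderiv Y (fun _ => c) (fun _ => 0).
Proof.
move=> SY; split; try exact: has_moments_cst.
move=> s Ss; rewrite (@eq_expect _ _ _ P _ (fun w => c * (Y w * prods s w))); last by move=> w; ring.
have mY := S_mom SY; have mP := has_moments_prods Ss; have mdP := has_moments_dprods Y Ss.
rewrite !ExZ//; last exact: has_momentsM.
by rewrite gaussian_ibp_prods// mul0r add0r.
Qed.

Lemma gderiv_lin Y f g f' g' c : S Y -> gderiv Y f g -> gderiv Y f' g' ->
  gderiv Y (fun w => f w + c * f' w) (fun w => g w + c * g' w).
Proof.
move=> SY [mf mg h] [mf' mg' h']; split; try by apply: has_momentsD => //; exact: has_momentsZ.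
move=> s Ss; have mY := S_mom SY; have mP := has_moments_prods Ss; have mdP := has_moments_dprods Y Ss.
rewrite (@eq_expect _ _ _ P _ (fun w => Y w * f w * prods s w + c * (Y w * f' w * prods s w))); last by move=> w; ring.
rewrite (@eq_expect _ _ _ P (fun w => (g w + _) * _) (fun w => g w * prods s w + c * (g' w * prods s w))); last by move=> w; ring.
rewrite (@eq_expect _ _ _ P (fun w => (f w + _) * _) (fun w => f w * dprods Y s w + c * (f' w * dprods Y s w))); last by move=> w; ring.
rewrite !ExD ?ExZ ?h ?h'//; first ring; do ?apply: has_momentsM => //; do ?exact: has_moments_cst.
Qed.

Lemma gderivM Y Z f g : S Y -> S Z -> gderiv Y f g ->
  gderiv Y (fun w => Z w * f w) (fun w => Ex (fun w => Y w * Z w) * f w + Z w * g w).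
Proof.
move=> SY SZ [mf mg h]; have mZ := S_mom SZ; have mY := S_mom SY.
split; first exact: has_momentsM.
  by apply: has_momentsD; [exact: has_momentsZ|exact: has_momentsM].
move=> s Ss; have mP := has_moments_prods Ss; have mdP := has_moments_dprods Y Ss.
rewrite (@eq_expect _ _ _ P _ (fun w => Y w * f w * prods (Z :: s) w)); last by move=> w; rewrite prods_cons; ring.
rewrite h//=.
rewrite (@eq_expect _ _ _ P (fun w => g w * _) (fun w => Z w * g w * prods s w)); last by move=> w; rewrite prods_cons; ring.
rewrite (@eq_expect _ _ _ P (fun w => f w * _) (fun w => Ex (fun w => Y w * Z w) * (f w * prods s w) + Z w * f w * dprods Y s w)); last by move=> w; ring.
rewrite (@eq_expect _ _ _ P (fun w => (_ + _) * _) (fun w => Ex (fun w => Y w * Z w) * (f w * prods s w) + Z w * g w * prods s w)); last by move=> w; ring.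
rewrite !ExD; first ring; do ?apply: has_momentsM => //; do ?exact: has_moments_cst.
Qed.

Lemma gderiv_ibp Y f g : S Y -> gderiv Y f g -> Ex (fun w => Y w * f w) = Ex g.
Proof.
move=> SY [mf mg h]; have := h [::] I.
rewrite (@eq_expect _ _ _ P _ (fun w => Y w * f w)); last by move=> w; rewrite prods_nil mulr1.
rewrite (@eq_expect _ _ _ P (fun w => g w * _) g); last by move=> w; rewrite prods_nil mulr1.
rewrite (@eq_expect _ _ _ P (fun w => f w * _) (fun _ => 0)); last by move=> w; rewrite /= mulr0.
by rewrite Ex_cst addr0.
Qed.

End gaussian_calculus.

(** * Moments of a centred sum of squares *)

Section quadratic_forms.
Context d (T : measurableType d) (R : realType) (P : probability T R).
Implicit Types f g h Z : T -> R.
Local Notation Ex := (expect P).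
Local Notation mom := (has_moments P).
Variable S : (T -> R) -> Prop.
Hypothesis HS : gaussian_family P S.
Variables (I : Type) (r : seq I) (Y : I -> T -> R).
Hypothesis SY : forall i, S (Y i).

Let mY i : mom (Y i). Proof. by case: HS => _ h _; exact/h/SY. Qed.

Definition cov_of i j := Ex (fun w => Y i w * Y j w).
Definition sumsq w := \sum_(i <- r) Y i w ^+ 2.
Definition sumsq_mean := \sum_(i <- r) cov_of i i.
Definition csumsq w := sumsq w - sumsq_mean.
Definition cov_form w := \sum_(i <- r) \sum_(j <- r) cov_of i j * (Y i w * Y j w).
Definition cov_sq := \sum_(i <- r) \sum_(j <- r) cov_of i j ^+ 2.

Local Notation C := cov_of.
Local Notation V := sumsq.
Local Notation W := csumsq.
Local Notation e := sumsq_mean.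
Local Notation Q := cov_form.

Lemma eq_gderiv Z f g f' g' : f =1 f' -> g =1 g' -> gderiv P S Z f g -> gderiv P S Z f' g'.
Proof. by move=> /funext -> /funext ->. Qed.

Let DV (s : seq I) Z w := \sum_(i <- s) Ex (fun w => Z w * Y i w) * Y i w.

Lemma gderiv_sumsq_mul Z f g (s : seq I) : S Z -> gderiv P S Z f g ->
  gderiv P S Z (fun w => (\sum_(i <- s) Y i w ^+ 2) * f w)
    (fun w => 2 * DV s Z w * f w + (\sum_(i <- s) Y i w ^+ 2) * g w).
Proof.
move=> SZ fg; elim: s => [|i s ih].
  apply: (eq_gderiv _ _ (gderiv_cst HS 0 SZ)) => w; rewrite /DV !big_nil; ring.
have h := gderivM HS SZ (SY i) (gderivM HS SZ (SY i) fg).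
apply: (eq_gderiv _ _ (gderiv_lin HS 1 SZ h ih)) => w; rewrite /DV !big_cons; ring.
Qed.

Lemma gderiv_csumsq_mul Z f g : S Z -> gderiv P S Z f g ->
  gderiv P S Z (fun w => W w * f w) (fun w => 2 * DV r Z w * f w + W w * g w).
Proof.
move=> SZ fg; have h := gderiv_sumsq_mul r SZ fg.
apply: (eq_gderiv _ _ (gderiv_lin HS (- e) SZ h fg)) => w; rewrite /csumsq /sumsq; ring.
Qed.

Lemma gderiv_csumsqX Z k : S Z ->
  gderiv P S Z (fun w => W w ^+ k) (fun w => k%:R * (2 * DV r Z w) * W w ^+ k.-1).
Proof.
move=> SZ; elim: k => [|k ih].
  by apply: (eq_gderiv _ _ (gderiv_cst HS 1 SZ)) => w; rewrite ?expr0 ?mul0r.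
apply: (eq_gderiv _ _ (gderiv_csumsq_mul SZ ih)) => w; first by rewrite exprS.
case: k {ih} => [|k] /=; first by rewrite expr0; ring.
by rewrite !exprS -[k.+2]addn1 natrD; ring.
Qed.

Lemma has_moments_sumsq : mom V.
Proof. by apply: has_moments_sum => i; exact: has_momentsX. Qed.

Lemma has_moments_csumsq : mom W.
Proof. by apply: has_momentsD; [exact: has_moments_sumsq|exact: has_moments_cst]. Qed.

Lemma has_moments_cov_form : mom Q.
Proof. by do 2! (apply: has_moments_sum => ?); apply: has_momentsZ; exact: has_momentsM. Qed.

Lemma sumsq_meanE : Ex V = e.
Proof. by rewrite Ex_sum//; move=> i; exact: has_momentsX. Qed.

(** Integrate by parts in the first factor of each [Y i * (Y i * W ^ k)].
    The derivative of the second factor produces the mean, which cancels the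
    centring of [W]; the derivative of [W ^ k] produces the quadratic form. *)
Lemma csumsq_moment_rec k :
  Ex (fun w => W w ^+ k.+1) = 2 * k%:R * Ex (fun w => Q w * W w ^+ k.-1).
Proof.
have mW := has_moments_csumsq; have mQ := has_moments_cov_form.
have mWk j : mom (fun w => W w ^+ j) by exact: has_momentsX.
rewrite (@eq_expect _ _ _ P _ (fun w => \sum_(i <- r) Y i w * (Y i w * W w ^+ k) + - e * W w ^+ k)); last first.
  move=> w; rewrite exprS {1}/csumsq mulrDl mulNr /sumsq mulr_suml; congr (_ - _).
  by apply: eq_bigr => i _; ring.
rewrite ExD ?ExZ ?Ex_sum//; first last.
- by apply: has_momentsZ.
- by apply: has_moments_sum => i; do 2! apply: has_momentsM => //.
- by move=> i; do 2! apply: has_momentsM => //.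
have mD i : mom (DV r (Y i)) by apply: has_moments_sum => j; exact: has_momentsZ.
have h i : Ex (fun w => Y i w * (Y i w * W w ^+ k)) = C i i * Ex (fun w => W w ^+ k) +
    2 * k%:R * Ex (fun w => Y i w * DV r (Y i) w * W w ^+ k.-1).
  rewrite (gderiv_ibp (SY i) (gderivM HS (SY i) (SY i) (gderiv_csumsqX k (SY i)))).
  rewrite -!ExZ -?ExD//; first by apply: eq_expect => w; rewrite /cov_of; ring.
  all: do ?apply: has_momentsM => //; try exact: has_moments_cst.
under eq_bigr do rewrite h.
rewrite big_split/= -mulr_suml -/e addrAC mulNr subrr add0r -mulr_sumr; congr (_ * _).
rewrite -Ex_sum; last by move=> i; do 2! apply: has_momentsM => //.
apply: eq_expect => w; rewrite /cov_form -mulr_suml; congr (_ * _).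
by apply: eq_bigr => i _; rewrite /DV mulr_sumr; apply: eq_bigr => j _; rewrite /cov_of; ring.
Qed.

Lemma csumsq_variance : Ex (fun w => W w ^+ 2) = 2 * cov_sq.
Proof.
rewrite csumsq_moment_rec mulr1; congr (_ * _).
rewrite (@eq_expect _ _ _ P _ Q); last by move=> w; rewrite expr0 mulr1.
rewrite Ex_sum; last by move=> i; apply: has_moments_sum => j; apply: has_momentsZ; exact: has_momentsM.
apply: eq_bigr => i _; rewrite Ex_sum; last by move=> j; apply: has_momentsZ; exact: has_momentsM.
by apply: eq_bigr => j _; rewrite ExZ ?expr2//; exact: has_momentsM.
Qed.

Lemma sum_ge0 (F : I -> R) : (forall i, 0 <= F i) -> 0 <= \sum_(i <- r) F i.
Proof. by move=> h; apply: sumr_ge0. Qed.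

Lemma cov_sq_ge0 : 0 <= cov_sq.
Proof. by do 2! (apply: sum_ge0 => ?); exact: sqr_ge0. Qed.

Lemma sumsq_ge0 w : 0 <= V w. Proof. by apply: sum_ge0 => i; exact: sqr_ge0. Qed.

(** The Cauchy--Schwarz inequality for matrices, the matrix [Y i * Y j] having
    Euclidean norm [V]. *)
Lemma cov_form_le w : Q w <= Num.sqrt cov_sq * V w.
Proof.
set F := Num.sqrt _.
have F0 : 0 <= F by exact: sqrtr_ge0.
have V0 := sumsq_ge0 w.
have FF : F ^+ 2 = cov_sq by rewrite sqr_sqrtr// cov_sq_ge0.
have VV : V w ^+ 2 = \sum_(i <- r) \sum_(j <- r) (Y i w * Y j w) ^+ 2.
  rewrite expr2 {1}/sumsq mulr_suml; apply: eq_bigr => i _.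
  by rewrite mulr_sumr; apply: eq_bigr => j _; rewrite exprMn.
have lin (a b c : R) (A B D : I -> I -> R) :
    \sum_(i <- r) \sum_(j <- r) (a * A i j + b * B i j + c * D i j) =
    a * (\sum_(i <- r) \sum_(j <- r) A i j) + b * (\sum_(i <- r) \sum_(j <- r) B i j)
    + c * (\sum_(i <- r) \sum_(j <- r) D i j).
  rewrite !mulr_sumr -!big_split/=; apply: eq_bigr => i _.
  by rewrite !mulr_sumr -!big_split.
have key : 0 <= \sum_(i <- r) \sum_(j <- r) (F ^+ 2 * (Y i w * Y j w) ^+ 2
     + (- (2 * (F * V w))) * (C i j * (Y i w * Y j w)) + V w ^+ 2 * C i j ^+ 2).
  do 2! (apply: sum_ge0 => ?); set y := Y _ w * Y _ w; set c := C _ _.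
  by rewrite (_ : _ + _ = (F * y - V w * c) ^+ 2) ?sqr_ge0//; ring.
move: key; rewrite lin -VV -/cov_sq -/(Q w) -FF => key.
have {}key : 0 <= (F * V w) * (F * V w - Q w) by lra.
(* if the bound is zero, one of the two matrices vanishes, and so does [Q] *)
have [FV|FV] := eqVneq (F * V w) 0; last first.
  have FV0 : 0 < F * V w by rewrite lt_neqAle eq_sym FV mulr_ge0.
  by rewrite -subr_ge0 -(pmulr_rge0 _ FV0).
rewrite FV; suff -> : Q w = 0 by [].
have z (F2 : I -> I -> R) : (forall i j, 0 <= F2 i j) -> 0 = \sum_(i <- r) \sum_(j <- r) F2 i j ->
    forall G : I -> I -> R, (forall i j, F2 i j = 0 -> G i j = 0) -> \sum_(i <- r) \sum_(j <- r) G i j = 0.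
  move=> F20 + G FG; elim: {1 3}r => [|i s ih]; first by rewrite !big_nil.
  rewrite !big_cons => /esym/eqP; rewrite paddr_eq0; last 2 first.
  - by apply: sum_ge0.
  - by apply: sumr_ge0 => *; exact: sum_ge0.
  move=> /andP[/eqP h1 /eqP h2]; rewrite ih// addr0.
  elim: r h1 => [|j t iht]; first by rewrite !big_nil.
  rewrite !big_cons => /eqP; rewrite paddr_eq0//; last exact: sumr_ge0.
  by move=> /andP[/eqP /FG -> /eqP /iht ->]; rewrite addr0.
move/eqP : FV; rewrite mulf_eq0 => /orP[/eqP F00|/eqP V00].
  apply: (z (fun i j => C i j ^+ 2)); first by move=> *; exact: sqr_ge0.
    by rewrite -/cov_sq -FF F00 expr0n.
  by move=> i j /eqP; rewrite sqrf_eq0 => /eqP ->; rewrite mul0r.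
apply: (z (fun i j => (Y i w * Y j w) ^+ 2)); first by move=> *; exact: sqr_ge0.
  by rewrite -VV V00 expr0n.
by move=> i j /eqP; rewrite sqrf_eq0 => /eqP ->; rewrite mulr0.
Qed.

(** In the recursion bound [Q] by [|C| V = |C| (W + e)]. The resulting odd power
    of [W] is absorbed by the next even one, whose coefficient stays below one half
    as long as [m |C|] is small against [e]; so each step gains a factor
    [12 m |C| e]. *)
Lemma csumsq_moment_le m : 0 < e -> 4 * m%:R * Num.sqrt cov_sq <= e ->
  Ex (fun w => W w ^+ (2 * m)) <= (12 * m%:R * Num.sqrt cov_sq * e) ^+ m.
Proof.
move=> e0; set F := Num.sqrt _ => small.
have F0 : 0 <= F by exact: sqrtr_ge0.
have mW := has_moments_csumsq; have mQ := has_moments_cov_form; have mV := has_moments_sumsq.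
have mWk j : mom (fun w => W w ^+ j) by exact: has_momentsX.
have Meven j : 0 <= Ex (fun w => W w ^+ (2 * j)).
  by apply: Ex_ge0 => w; rewrite exprM exprn_ge0// sqr_ge0.
have step j : (j < m)%N -> Ex (fun w => W w ^+ (2 * j.+1)) <=
    12 * m%:R * F * e * Ex (fun w => W w ^+ (2 * j)).
  move=> jm.
  have h1 : Ex (fun w => Q w * W w ^+ (2 * j)) <=
     F / e / 2 * Ex (fun w => W w ^+ (2 * j.+1)) + 3 / 2 * F * e * Ex (fun w => W w ^+ (2 * j)).
    rewrite -!ExZ// -ExD//; [|exact: has_momentsZ..].
    apply: Ex_le; [exact: has_momentsM|by apply: has_momentsD; exact: has_momentsZ|].
    move=> w; rewrite mulnS addnC exprD.
    set x := W w ^+ (2 * j); have x0 : 0 <= x by rewrite /x exprM exprn_ge0// sqr_ge0.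
    rewrite (le_trans (ler_wpM2r x0 (cov_form_le w)))// -/F.
    have -> : V w = W w + e by rewrite /csumsq subrK.
    rewrite [leRHS](_ : _ = F * (W w ^+ 2 / e / 2 + 3 / 2 * e) * x); last by ring.
    rewrite ler_wpM2r// ler_wpM2l// -subr_ge0.
    (* [W <= (W ^ 2 / e + e) / 2] *)
    rewrite (_ : _ - _ = (W w - e) ^+ 2 / e / 2); last by field; rewrite gt_eqF.
    by rewrite !divr_ge0// ?sqr_ge0// ltW.
  have := csumsq_moment_rec (2 * j).+1; rewrite /= (_ : (2 * j).+2 = (2 * j.+1)%N); last by rewrite mulnS.
  set A := Ex (fun w => W w ^+ (2 * j.+1)) in h1 *.
  set B := Ex (fun w => W w ^+ (2 * j)) in h1 *.
  have A0 : 0 <= A by exact: Meven.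
  have B0 : 0 <= B by exact: Meven.
  set q := Ex _ in h1 * => Aq.
  have jm' : ((2 * j).+1%:R : R) <= 2 * m%:R by rewrite -natrM ler_nat; lia.
  set n : R := (2 * j).+1%:R in Aq jm'.
  have n0 : 0 <= n by rewrite ler0n.
  have h2 : A <= n * (F / e) * A + 3 * n * (F * e) * B.
    rewrite Aq; apply: le_trans (ler_wpM2l (mulr_ge0 _ n0) h1) _ => //; rewrite -/A -Aq.
    by rewrite le_eqVlt; apply/orP; left; apply/eqP; field; rewrite gt_eqF.
  have h3 : n * (F / e) <= 2^-1.
    rewrite mulrA ler_pdivrMr//.
    have : n * F <= 2 * m%:R * F by rewrite ler_wpM2r.
    by lra.
  have h4 : n * (F / e) * A <= 2^-1 * A by rewrite ler_wpM2r.
  have h5 : 3 * n * (F * e) * B <= 3 * (2 * m%:R) * (F * e) * B.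
    by rewrite !ler_wpM2r// ?mulr_ge0// ?(ltW e0)// ler_wpM2l.
  by lra.
have H j : (j <= m)%N -> Ex (fun w => W w ^+ (2 * j)) <= (12 * m%:R * F * e) ^+ j.
  elim: j => [|j ih] jm.
    by rewrite (@eq_expect _ _ _ P _ (fun _ => 1)) ?Ex_cst ?expr0// => w; rewrite muln0 expr0.
  apply: (le_trans (step j jm)); rewrite exprS ler_wpM2l ?ih ?(ltnW jm)//.
  by rewrite !mulr_ge0 ?ler0n// ltW.
exact: H.
Qed.

End quadratic_forms.

(** * Almost sure convergence from moments *)

Section ae_convergence.
Context d (T : measurableType d) (R : realType) (P : probability T R).
Local Notation Ex := (expect P).
Local Notation mom := (has_moments P).

(** The expectations of the powers [f n ^ (2 * m)] are summable, hence their
    series is almost everywhere finite and its terms tend to zero. *)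
Lemma ae_cvg0_moments (f : nat -> T -> R) (m : nat) (C : R) : (0 < m)%N ->
  (forall n, mom (f n)) ->
  (\forall n \near \oo, Ex (fun w => f n w ^+ (2 * m)) <= C * (n%:R ^+ 2)^-1) ->
  {ae P, forall w, f n w @[n --> \oo] --> (0 : R)}.
Proof.
move=> m0 hf [N _ hN].
have C0 : 0 <= C.
  have /= := hN N.+1 (leqnSn N).
  have e0 : 0 <= Ex (fun w => f N.+1 w ^+ (2 * m)).
    by apply: Ex_ge0 => w; rewrite exprM exprn_ge0// sqr_ge0.
  by move=> /(le_trans e0); rewrite pmulr_lge0// invr_gt0 exprn_gt0.
pose g n w : R := f (n + N.+1)%N w ^+ (2 * m).
have g0 n w : 0 <= g n w by rewrite /g exprM exprn_ge0// sqr_ge0.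
have mg n : mom (g n) by exact: has_momentsX.
(* compare with a telescoping series *)
have bound n : Ex (g n) <= 2 * C * (n.+1%:R^-1 - n.+2%:R^-1).
  have h : Ex (g n) <= C * ((n + N.+1)%:R ^+ 2)^-1.
    by apply: hN => /=; rewrite addnS ltnW// ltnS leq_addl.
  apply: (le_trans h); rewrite (mulrC 2) -mulrA ler_wpM2l//.
  have n1 : (0 : R) < n.+1%:R by [].
  have n2 : (n.+2%:R : R) = n.+1%:R + 1 by rewrite -[n.+2]addn1 natrD.
  rewrite n2; set a : R := n.+1%:R in n1 *.
  have n1' : (1 : R) <= a by rewrite /a ler1n.
  apply: (@le_trans _ _ (a ^+ 2)^-1).
    by rewrite lef_pV2 ?posrE ?exprn_gt0 ?ltr0n ?addnS// lerXn2r ?nnegrE// ler_nat ltnS leq_addr.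
  rewrite -subr_ge0 (_ : _ - _ = (a - 1) / (a ^+ 2 * (a + 1))); last by field; rewrite !gt_eqF// addr_gt0.
  by rewrite divr_ge0 ?subr_ge0// mulr_ge0// ?exprn_ge0// ?addr_ge0// ltW.
pose G w := (\sum_(0 <= n <oo) (g n w)%:E)%E.
have mgE n : measurable_fun setT (fun w => (g n w)%:E).
  by apply/measurable_EFinP; exact: has_moments_meas (mg n).
have intG : (\int[P]_w G w <= (2 * C)%:E)%E.
  rewrite integral_nneseries//; last by move=> n w _; rewrite lee_fin.
  apply: lime_le.
    by apply: is_cvg_nneseries => n _ _; apply: integral_ge0 => w _; rewrite lee_fin.
  apply: nearW => n.
  under eq_bigr do rewrite -EFin_Ex//.
  rewrite sumEFin lee_fin; apply: (le_trans (ler_sum _ (fun i _ => bound i))).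
  rewrite -mulr_sumr; apply: (@le_trans _ _ (2 * C * 1)); last by rewrite mulr1.
  rewrite ler_wpM2l ?mulr_ge0//.
  rewrite (_ : \sum_(0 <= i < n) _ = 1 - n.+1%:R^-1); last first.
    elim: n => [|n ih]; first by rewrite big_nil invr1 subrr.
    by rewrite big_nat_recr//= ih addrA subrK.
  by rewrite gerBl invr_ge0.
have G0 w : (0 <= G w)%E by apply: nneseries_ge0 => n _ _; rewrite lee_fin.
have mG : measurable_fun setT G.
  by apply: ge0_emeasurable_sum => // n w _ _; rewrite lee_fin.
have iG : P.-integrable setT G.
  apply/integrableP; split => //.
  under eq_integral do rewrite gee0_abs//.
  by rewrite (le_lt_trans intG)// ltry.
have := integrable_ae measurableT iG.
apply: filterS => w /(_ I) Gfin.
have gc : g n w @[n --> \oo] --> (0 : R).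
  apply: cvg_series_cvg_0; apply: nondecreasing_is_cvgn.
    by apply/nondecreasing_seqP => n; rewrite /series/= big_nat_recr//= lerDl.
  exists (fine (G w)) => _ [n _ <-]; rewrite -lee_fin fineK// /series/= -sumEFin.
  by apply: nneseries_lim_ge => k _ _; rewrite lee_fin.
rewrite -(cvg_shiftn N.+1); apply/cvgr0Pnorm_lt => eps eps0.
have e2 : 0 < eps ^+ (2 * m) by exact: exprn_gt0.
move/cvgr0Pnorm_lt: gc => /(_ _ e2); apply: filterS => n /=.
rewrite /g [`|_ ^+ _|]normrX => h.
by rewrite ltNge; apply/negP => h'; move: h; rewrite ltNge lerXn2r// nnegrE// ltW.
Qed.

End ae_convergence.

(** * Quadratic variations of a Gaussian field *)

Section field.
Context d (T : measurableType d) (R : realType) (P : probability T R).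
Variables (X : 'rV[R]_2 -> {RV P >-> R}) (mu : R) (Kt : 'rV[R]_2 -> R).
Hypothesis hgauss : gaussian_field X.
Hypothesis hstat : stationary_isotropic X mu Kt.
Local Notation Ex := (expect P).
Local Notation mom := (has_moments P).

Definition field_span (f : T -> R) := exists (k : nat) (x : 'I_k -> 'rV[R]_2) (a : 'I_k -> R),
  f = fun w => \sum_(i < k) a i * (X (x i) w - mu).

Lemma has_moments_field x : mom (fun w => X x w).
Proof.
have mX : measurable_fun setT (fun w => X x w) by exact: measurable_funPT.
have h : gaussian_rv P (X x).
  have [m [s [s0 h]]] := hgauss (fun _ : 'I_1 => x) (fun _ => 1).
  exists m, s; split=> // A mA; rewrite -(h A mA); congr (P (_ @^-1` A)).
  by apply/funext => w; rewrite big_ord1 mul1r.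
have [m [s hm]] := gaussian_rv_moments _ _ _ _ mX h.
have : mom (fun w => X x w - m).
  by split=> [|k]; [exact: measurable_funB|have [] := hm k].
move=> /(has_momentsD (has_moments_cst P m)).
by rewrite (_ : (fun w => _) = fun w => X x w)//; apply/funext => w; rewrite addrC subrK.
Qed.

Lemma expect_field x : Ex (fun w => X x w) = mu.
Proof. by have [h _ _] := hstat; have := h x; rewrite unlock /expect => ->. Qed.

Lemma expect_field_cov x y : Ex (fun w => (X x w - mu) * (X y w - mu)) = Kt (x - y).
Proof.
have [h c _] := hstat; have := c x y; rewrite unlock !h/= unlock /expect.
by move=> e; rewrite (_ : Kt (x - y) = fine (Kt (x - y))%:E)// -e.
Qed.

Lemma field_span_comb (k : nat) (x : 'I_k -> 'rV[R]_2) (a : 'I_k -> R) :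
  let f := fun w => \sum_(i < k) a i * (X (x i) w - mu) in
  mom f /\ forall j, Ex (fun w => f w ^+ j.+1) =
        j%:R * Ex (fun w => f w ^+ 2) * Ex (fun w => f w ^+ j.-1).
Proof.
move=> f; pose Z w := \sum_(i < k) a i * X (x i) w.
have mZ : mom Z by apply: has_moments_sum => i; apply: has_momentsZ; exact: has_moments_field.
have [m [s hm]] := gaussian_rv_moments _ _ _ _ (has_moments_meas mZ) (hgauss x a).
have EZ : Ex Z = \sum_(i < k) a i * mu.
  rewrite Ex_sum; last by move=> i; apply: has_momentsZ; exact: has_moments_field.
  by apply: eq_bigr => i _; rewrite ExZ ?expect_field//; exact: has_moments_field.
have EZm : Ex Z = m.
  have [_] := hm 0%N; rewrite !mul0r => h0.
  apply/eqP; rewrite -subr_eq0 -h0; apply/eqP.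
  transitivity (Ex (fun w => Z w + - m)); last by apply: eq_expect => w; rewrite expr1.
  by rewrite (@ExD _ _ _ P Z (fun _ => - m)) ?Ex_cst//; exact: has_moments_cst.
have fE w : f w = Z w - m.
  rewrite -EZm EZ /Z /f -sumrB; apply: eq_bigr => i _; exact: mulrBr.
have mf : mom f.
  by rewrite (_ : f = fun w => Z w + - m); [apply: has_momentsD => //; exact: has_moments_cst|exact/funext].
have ff j : Ex (fun w => f w ^+ j) = Ex (fun w => (Z w - m) ^+ j).
  by apply: eq_expect => w; rewrite fE.
split=> // j; rewrite !ff; have [_ ->] := hm j; congr (_ * _ * _).
have [_ ->] := hm 1%N; rewrite /= mul1r -[LHS]mulr1; congr (_ * _).
by rewrite -[LHS](Ex_cst P); apply: eq_expect => w; rewrite expr0.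
Qed.

(** Joint normality of the field in the form needed for integration by parts. *)
Lemma field_span_family : gaussian_family P field_span.
Proof.
split.
- move=> c f g [k1 [x1 [a1 ->]]] [k2 [x2 [a2 ->]]].
  exists (k1 + k2)%N, (fun i => match fintype.split i with inl j => x1 j | inr j => x2 j end),
    (fun i => match fintype.split i with inl j => a1 j | inr j => c * a2 j end).
  apply/funext => w; rewrite big_split_ord/= mulr_sumr; congr (_ + _); apply: eq_bigr => i _.
    by rewrite (unsplitK (inl i)).
  by rewrite (unsplitK (inr i)) mulrA.
- by move=> f [k [x [a ->]]]; have [] := field_span_comb x a.
- by move=> f j [k [x [a ->]]]; have [] := field_span_comb x a.
Qed.

Section variation.
Variables (theta l : nat) (p : nat -> 'rV[R]_2) (n : nat).
Hypothesis hb : forall i, (1 <= i <= n - theta * l)%N -> \sum_(k < l.+1) bcoef theta l p i k = 0.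

Definition field_nabla i w := nabla theta l p (fun j => X (p j) w - mu) i.
Local Notation Y := field_nabla.
Local Notation r := (index_iota 1 (n - theta * l).+1).

Lemma field_nabla_span i : field_span (Y i).
Proof. by exists l.+1, (fun k : 'I_l.+1 => p (i + theta * k)%N), (fun k : 'I_l.+1 => bcoef theta l p i k). Qed.

(** Weights of total zero do not see the mean of the field. *)
Lemma quad_var_sumsq w : quad_var theta l n p (fun i => X (p i) w) = sumsq r Y w.
Proof.
rewrite /quad_var /sumsq !big_nat; apply: eq_bigr => i hi; congr (_ ^+ 2).
rewrite /Y /nabla; under [RHS]eq_bigr do rewrite mulrBr.
by rewrite sumrB -mulr_suml hb ?mul0r ?subr0// -ltnS.
Qed.

Definition nabla_cov i j := \sum_(k1 < l.+1) \sum_(k2 < l.+1)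
  bcoef theta l p i k1 * bcoef theta l p j k2 * Kt (p (i + theta * k1)%N - p (j + theta * k2)%N).

Lemma cov_of_nabla i j : cov_of P Y i j = nabla_cov i j.
Proof.
have mX x : mom (fun w => X x w - mu).
  by apply: has_momentsD; [exact: has_moments_field|exact: has_moments_cst].
rewrite /cov_of; transitivity (Ex (fun w => \sum_(k1 < l.+1) \sum_(k2 < l.+1)
  bcoef theta l p i k1 * bcoef theta l p j k2 * ((X (p (i + theta * k1)%N) w - mu) * (X (p (j + theta * k2)%N) w - mu)))).
  apply: eq_expect => w; rewrite /Y /nabla mulr_suml; apply: eq_bigr => k1 _.
  by rewrite mulr_sumr; apply: eq_bigr => k2 _; ring.
rewrite Ex_sum; last first.
  by move=> k1; apply: has_moments_sum => k2; apply: has_momentsZ; exact: has_momentsM.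
apply: eq_bigr => k1 _; rewrite Ex_sum; last by move=> k2; apply: has_momentsZ; exact: has_momentsM.
by apply: eq_bigr => k2 _; rewrite ExZ ?expect_field_cov//; exact: has_momentsM.
Qed.

Definition nabla_var := \sum_(1 <= i < (n - theta * l).+1) nabla_cov i i.
Definition nabla_cov_sq := \sum_(1 <= i < (n - theta * l).+1) \sum_(1 <= j < (n - theta * l).+1) nabla_cov i j ^+ 2.

Let meanE : sumsq_mean P r Y = nabla_var.
Proof. by apply: eq_bigr => i _; exact: cov_of_nabla. Qed.

Let covsqE : cov_sq P r Y = nabla_cov_sq.
Proof. by apply: eq_bigr => i _; apply: eq_bigr => j _; rewrite cov_of_nabla. Qed.

Let V w := quad_var theta l n p (fun i => X (p i) w).
Let VE : V = sumsq r Y. Proof. by apply/funext => w; exact: quad_var_sumsq. Qed.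

Lemma quad_var_mean : fine ('E_P[V])%E = nabla_var.
Proof.
rewrite unlock -meanE -(sumsq_meanE field_span_family) -?VE//; exact: field_nabla_span.
Qed.

Lemma nabla_cov_ge0 i : 0 <= nabla_cov i i.
Proof. by rewrite -cov_of_nabla; apply: Ex_ge0 => w; rewrite -expr2 sqr_ge0. Qed.

Lemma nabla_var_ge0 : 0 <= nabla_var.
Proof. by apply: sumr_ge0 => i _; exact: nabla_cov_ge0. Qed.

Lemma nabla_cov_sq_ge0 : 0 <= nabla_cov_sq.
Proof. by rewrite -covsqE cov_sq_ge0. Qed.

Lemma nabla_cov_sqr_le i j : nabla_cov i j ^+ 2 <= nabla_cov i i * nabla_cov j j.
Proof.
have mY k : mom (Y k) by have [_ h _] := field_span_family; exact/h/field_nabla_span.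
by rewrite -!cov_of_nabla; exact: expect_sqr_le.
Qed.

Lemma quad_var_has_moments : mom V.
Proof. by rewrite VE; apply: (has_moments_sumsq field_span_family); exact: field_nabla_span. Qed.

Lemma quad_var_variance : nabla_var != 0 ->
  ('V_P[(fun w => V w / nabla_var)%R] = (2 * nabla_cov_sq / nabla_var ^+ 2)%:E)%E.
Proof.
move=> e0; have mV := quad_var_has_moments.
have EV : expect P (fun w => V w / nabla_var) = 1.
  rewrite (@eq_expect _ _ _ P _ (fun w => nabla_var^-1 * V w)); last by move=> w; rewrite mulrC.
  by rewrite ExZ// VE (sumsq_meanE field_span_family) ?meanE ?mulVf//; exact: field_nabla_span.
have mW : mom (csumsq P r Y) by apply: (has_moments_csumsq field_span_family); exact: field_nabla_span.
rewrite /variance unlock unlock -/(expect P (fun w => V w / nabla_var)) EV.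
have mq : mom (fun w => V w / nabla_var - 1).
  by apply: has_momentsD; [apply: has_momentsM => //|]; exact: has_moments_cst.
rewrite -EFin_Ex; last exact: (has_momentsM mq mq).
congr EFin; rewrite -covsqE -(csumsq_variance field_span_family r field_nabla_span).
rewrite [RHS]mulrC -ExZ; last exact: has_momentsX.
apply: eq_expect => w; transitivity ((V w / nabla_var - 1) * (V w / nabla_var - 1)); first by [].
by rewrite /= /csumsq meanE -VE; field; exact: e0.
Qed.

Lemma quad_var_moment_le m : 0 < nabla_var -> 4 * m%:R * Num.sqrt nabla_cov_sq <= nabla_var ->
  Ex (fun w => (V w / nabla_var - 1) ^+ (2 * m)) <= (12 * m%:R * (Num.sqrt nabla_cov_sq / nabla_var)) ^+ m.
Proof.
move=> e0 h; have := @csumsq_moment_le _ _ _ P _ field_span_family _ r _ field_nabla_span m.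
rewrite meanE covsqE => /(_ e0 h) h1.
rewrite (@eq_expect _ _ _ P _ (fun w => (nabla_var^-1) ^+ (2 * m) * csumsq P r Y w ^+ (2 * m))); last first.
  by move=> w; rewrite -exprMn /csumsq meanE VE; congr (_ ^+ _); field; rewrite gt_eqF.
rewrite ExZ; last by apply: has_momentsX; apply: (has_moments_csumsq field_span_family); exact: field_nabla_span.
apply: (le_trans (ler_wpM2l _ h1)); first by rewrite exprn_ge0// invr_ge0 ltW.
rewrite exprM -exprMn le_eqVlt; apply/orP; left; apply/eqP; congr (_ ^+ _).
by field; rewrite gt_eqF.
Qed.

End variation.
End field.

(** * Euclidean norm and Taylor bounds *)

Section euclidean_norm.
Context {R : realType}.
Implicit Types x y : 'rV[R]_2.

Lemma sum2E (F : 'I_2 -> R) : \sum_(j < 2) F j = F ord0 + F ord_max.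
Proof. by rewrite big_ord_recl big_ord1; congr (_ + F _); apply/val_inj. Qed.

Lemma enormE x : enorm x = Num.sqrt (x 0 ord0 ^+ 2 + x 0 ord_max ^+ 2).
Proof. by rewrite /enorm sum2E. Qed.

Lemma enorm_ge0 x : 0 <= enorm x. Proof. exact: sqrtr_ge0. Qed.

Lemma enorm_sqr x : enorm x ^+ 2 = x 0 ord0 ^+ 2 + x 0 ord_max ^+ 2.
Proof. by rewrite enormE sqr_sqrtr// addr_ge0 ?sqr_ge0. Qed.

Lemma enorm0 : enorm (0 : 'rV[R]_2) = 0.
Proof. by rewrite enormE !mxE expr0n/= addr0 sqrtr0. Qed.

Lemma enormZ a x : enorm (a *: x) = `|a| * enorm x.
Proof. by rewrite !enormE !mxE !exprMn -mulrDr sqrtrM ?sqr_ge0// sqrtr_sqr. Qed.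

Lemma enormN x : enorm (- x) = enorm x.
Proof. by rewrite -scaleN1r enormZ normrN normr1 mul1r. Qed.

Lemma enormB x y : enorm (x - y) = enorm (y - x).
Proof. by rewrite -enormN opprB. Qed.

Lemma coord_le_enorm x j : `|x 0 j| <= enorm x.
Proof.
rewrite -[X in X <= _]ger0_norm// -ler_sqr ?nnegrE ?enorm_ge0//.
rewrite enorm_sqr normr_id real_normK ?num_real//.
case: j => -[|[|//]] i.
  by rewrite (_ : Ordinal i = ord0) ?lerDl ?sqr_ge0//; apply/val_inj.
by rewrite (_ : Ordinal i = ord_max) ?lerDr ?sqr_ge0//; apply/val_inj.
Qed.

Lemma enorm_le_coord x : enorm x <= `|x 0 ord0| + `|x 0 ord_max|.
Proof.
rewrite -ler_sqr ?nnegrE ?enorm_ge0 ?addr_ge0// enorm_sqr.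
rewrite -(real_normK (num_real (x 0 ord0))) -(real_normK (num_real (x 0 ord_max))).
have := normr_ge0 (x 0 ord0); have := normr_ge0 (x 0 ord_max); nra.
Qed.

Lemma enormD x y : enorm (x + y) <= enorm x + enorm y.
Proof.
rewrite -ler_sqr ?nnegrE ?enorm_ge0 ?addr_ge0 ?enorm_ge0//.
rewrite sqrrD !enorm_sqr !mxE.
set a := x 0 ord0; set b := x 0 ord_max; set c := y 0 ord0; set e := y 0 ord_max.
have h : a * c + b * e <= enorm x * enorm y.
  apply: le_trans (ler_norm _) _.
  rewrite -ler_sqr ?nnegrE ?mulr_ge0 ?enorm_ge0// exprMn !enorm_sqr real_normK ?num_real//.
  by have := sqr_ge0 (a * e - b * c); rewrite -/a -/b -/c -/e; nra.
nra.
Qed.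

Lemma enorm_sum (I : Type) (r : seq I) (F : I -> 'rV[R]_2) :
  enorm (\sum_(i <- r) F i) <= \sum_(i <- r) enorm (F i).
Proof.
elim: r => [|i r ih]; first by rewrite !big_nil enorm0.
by rewrite !big_cons; apply: le_trans (enormD _ _) _; rewrite lerD2l.
Qed.

Lemma enorm_subr_le x y : `|enorm x - enorm y| <= enorm (x - y).
Proof.
have h (u v : 'rV[R]_2) : enorm u - enorm v <= enorm (u - v).
  by rewrite lerBlDr; have := enormD (u - v) v; rewrite subrK.
by rewrite ler_norml h andbT lerNl opprB (enormB x y) h.
Qed.

End euclidean_norm.

Section taylor.
Context {R : realType}.
Implicit Types (f : R -> R) (a b s t : R).

(** The mean value theorem with no order imposed on [s] and [t]. *)
Lemma mean_value f f1 a b s t :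
  (forall t, a <= t <= b -> is_derive t 1 f (f1 t)) ->
  a <= s <= b -> a <= t <= b ->
  exists c, [/\ a <= c <= b, `|c - s| <= `|t - s|, `|c - t| <= `|t - s| & f t - f s = f1 c * (t - s)].
Proof.
move=> df; wlog st : s t / s <= t => [h hs ht|].
  have [|/ltW ts] := leP s t; first by move=> ?; exact: h.
  have [c [hc c2 c3 c4]] := h _ _ ts ht hs.
  by exists c; rewrite (distrC t s); split=> //; rewrite -[LHS]opprB c4; ring.
move=> /andP[h1 h2] /andP[h3 h4].
have sub x : x \in `[s, t] -> a <= x <= b.
  by rewrite in_itv/= => /andP[h5 h6]; rewrite (le_trans h1 h5) (le_trans h6 h4).
have [x xst||c cst e] := @MVT_segment R f f1 s t st.
- apply: df; apply: sub; move: xst; rewrite !in_itv/= => /andP[/ltW-> /ltW->]//.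
- apply: continuous_in_subspaceT => x; rewrite inE/= => /sub /df[d _].
  by apply: differentiable_continuous; apply/derivable1_diffP.
exists c; split=> //; first exact: sub.
  move: cst; rewrite in_itv/= => /andP[h5 h6].
  by rewrite !ger0_norm ?subr_ge0// lerB.
move: cst; rewrite in_itv/= => /andP[h5 h6].
by rewrite distrC !ger0_norm ?subr_ge0// lerB.
Qed.

Lemma taylor_bounds f f1 f2 a b : a <= b ->
  (forall t, a <= t <= b -> is_derive t 1 f (f1 t)) ->
  (forall t, a <= t <= b -> is_derive t 1 f1 (f2 t)) ->
  (forall t, a <= t <= b -> {for t, continuous f2}) ->
  exists2 M, 0 < M & forall s t, a <= s <= b -> a <= t <= b ->
    `|f1 t - f1 s| <= M * `|t - s| /\ `|f t - f s - (t - s) * f1 s| <= M * `|t - s| ^+ 2.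
Proof.
move=> ab df df1 cf2.
have [|c _ hc] := @EVT_max R (fun t => `|f2 t|) a b ab.
  apply: continuous_in_subspaceT => x; rewrite inE/= in_itv/= => /cf2 h.
  exact: cvg_norm.
pose M := `|f2 c| + 1; have M0 : 0 < M by rewrite ltr_wpDl.
have h1 s t : a <= s <= b -> a <= t <= b -> `|f1 t - f1 s| <= M * `|t - s|.
  move=> hs ht; have [x [hx _ _ ->]] := mean_value df1 hs ht.
  rewrite normrM ler_wpM2r// (le_trans (hc x _)) ?lerDl//.
exists M => // s t hs ht; split; first exact: h1.
have [x [hx xs _ ->]] := mean_value df hs ht.
rewrite (mulrC (t - s)) -mulrBl normrM expr2 mulrA ler_wpM2r//.
by apply: le_trans (h1 _ _ hs hx) _; rewrite ler_wpM2l// ltW.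
Qed.

End taylor.

(** * Regularly sampled curves *)

Section regular_path.
Context {R : realType}.

(** What is used of the sampled curve [P], with unit tangents [tau] and speed
    [a]: chords are comparable to parameter differences, and agree to second order
    with the speed and with the direction of the tangent. *)
Definition regular_path (L : R) (P tau : R -> 'rV[R]_2) (a : R -> R) (M m : R) : Prop :=
  [/\ 0 < L, 0 < m, 0 < M & forall u v, 0 <= u <= L -> 0 <= v <= L -> u <= v ->
    [/\ m <= a u <= M, enorm (tau u) = 1,
        m * (v - u) <= enorm (P v - P u) <= M * (v - u),
        `|enorm (P v - P u) - (v - u) * a u| <= M * (v - u) ^+ 2 /\ `|a v - a u| <= M * (v - u)
      & enorm (P v - P u - enorm (P v - P u) *: tau u) <= M * (v - u) ^+ 2]].

Lemma curve_taylor (eps L : R) (gamma : R -> 'rV[R]_2) : arclength_C2_curve eps L gamma ->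
  exists2 M, 0 < M & forall s t, 0 <= s <= L -> 0 <= t <= L ->
    enorm (gamma t - gamma s - (t - s) *: derive1 gamma s) <= M * (t - s) ^+ 2.
Proof.
move=> [e0 L0 hg].
have sub t : 0 <= t <= L -> t \in `](- eps), (L + eps)[.
  by move=> /andP[h1 h2]; rewrite in_itv/= (lt_le_trans _ h1) ?oppr_lt0//= (le_lt_trans h2)// ltrDl.
have key j : exists2 M, 0 < M & forall s t, 0 <= s <= L -> 0 <= t <= L ->
    `|(gamma t - gamma s - (t - s) *: derive1 gamma s) 0 j| <= M * (t - s) ^+ 2.
  have [||||M M0 hM] := @taylor_bounds R (fun t => gamma t 0 j) (fun t => derive1 gamma t 0 j)
     (fun t => derive1n 2 gamma t 0 j) 0 L.
  - exact: ltW.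
  - move=> t /sub /hg[h _ _ _]; split; first by move/derivable_mxP: h => /(_ 0 j).
    by rewrite derive1E derive_mx// mxE.
  - move=> t /sub /hg[_ h _ _]; split; first by move/derivable_mxP: h => /(_ 0 j).
    by rewrite /derive1n/= (derive1E (derive1 gamma)) derive_mx// mxE.
  - move=> t /sub /hg[_ _ h _]; apply: (@cvg_comp _ _ _ _ (fun M : 'rV[R]_2 => M 0 j) _ _ _ h).
    exact: coord_continuous.
  exists M => // s t hs ht; have [_] := hM s t hs ht.
  by rewrite !mxE real_normK ?num_real.
have [M1 M10 h1] := key ord0; have [M2 M20 h2] := key ord_max.
exists (M1 + M2); first exact: addr_gt0.
move=> s t hs ht; apply: le_trans (enorm_le_coord _) _.
by rewrite mulrDl lerD ?h1 ?h2.
Qed.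

(** The lower bound on chords combines the chord-arc condition with the
    minimum of the derivative of [phi]; the second-order bounds come from the
    Taylor expansion of the curve at arc length [phi u]. *)
Lemma sampled_curve_regular (eps L : R) (gamma : R -> 'rV[R]_2) (phi : R -> R) :
  arclength_C2_curve eps L gamma -> chord_arc L gamma -> sampling_map L phi ->
  (forall u, 0 <= u <= L -> 0 <= phi u <= L) /\
  exists M m, regular_path L (fun u => gamma (phi u)) (fun u => derive1 gamma (phi u)) (derive1 phi) M m.
Proof.
move=> hg [C3 C30 hC3] [hphi phi0 phiL [s0 [hs0 mins0 a0pos]]].
have [e0 L0 hg1] := hg.
have dphi (t : R) : is_derive t 1 phi (derive1 phi t).
  by have [h _ _] := hphi t; split=> //; rewrite derive1E.
have [M1 M10 hM1] := curve_taylor hg.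
have [||M2 M20 hM2] := @taylor_bounds R phi (derive1 phi) (derive1n 2 phi) 0 L (ltW L0) (fun t _ => dphi t).
- by move=> t _; have [_ h _] := hphi t; exact: (DeriveDef h (esym (derive1E _ _))).
- by move=> t _; have [_ _ h] := hphi t.
set m0 := derive1 phi s0 in a0pos mins0.
have am u : 0 <= u <= L -> m0 <= derive1 phi u by move=> hu; apply: mins0; rewrite in_itv.
have incr u v : 0 <= u <= L -> 0 <= v <= L -> u <= v -> m0 * (v - u) <= phi v - phi u.
  move=> hu hv uv.
  have [c [hc _ _ ->]] := mean_value (fun t _ => dphi t) hu hv.
  by rewrite ler_wpM2r ?subr_ge0// am.
have L00 : 0 <= (0 : R) <= L by apply/andP; split; [exact: lexx|exact: ltW].
have LL : 0 <= L <= L by apply/andP; split; [exact: ltW|exact: lexx].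
have range u : 0 <= u <= L -> 0 <= phi u <= L.
  move=> hu; have /andP[u0 uL] := hu.
  have := incr 0 u L00 hu u0; have := incr u L hu LL uL; rewrite phi0 phiL.
  have : 0 <= m0 * (L - u) by rewrite mulr_ge0 ?subr_ge0// ltW.
  have : 0 <= m0 * (u - 0) by rewrite mulr_ge0 ?subr_ge0// ltW.
  by move=> *; apply/andP; split; lra.
split=> //.
pose A := derive1 phi 0 + M2 * L.
have aA u : 0 <= u <= L -> derive1 phi u <= A.
  move=> hu; have /andP[u0 uL] := hu; have [h _] := hM2 0 u L00 hu.
  have : `|derive1 phi u - derive1 phi 0| <= M2 * L.
    by apply: le_trans h _; rewrite subr0 ger0_norm// ler_wpM2l// ltW.
  by move=> /ler_distlDr; rewrite /A addrC.
have A0 : 0 < A by apply: lt_le_trans (aA 0 L00); apply: lt_le_trans (am 0 L00).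
pose B := M1 * A ^+ 2; have B0 : 0 < B by rewrite mulr_gt0// exprn_gt0.
pose M := A + B * L + 2 * B + M2.
have BL0 : 0 <= B * L by rewrite mulr_ge0// ltW.
exists M, (Num.min m0 (C3 * m0)); split=> //.
- by rewrite lt_min a0pos mulr_gt0.
- by rewrite /M; lra.
move=> u v hu hv uv; set h := v - u; have h0 : 0 <= h by rewrite subr_ge0.
have hL : h <= L by move: hu hv => /andP[? ?] /andP[? ?]; rewrite /h; lra.
set s := phi u; set t := phi v.
have hs := range u hu; have ht := range v hv; rewrite -/s -/t in hs ht.
have tsA : t - s <= A * h.
  have [c [hc _ _ e]] := mean_value (fun t _ => dphi t) hu hv.
  by rewrite /t /s e ler_wpM2r// aA.
have tsm : m0 * h <= t - s by exact: incr.
have ts0 : 0 <= t - s by apply: le_trans tsm; rewrite mulr_ge0// ltW.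
have tau1 : enorm (derive1 gamma s) = 1.
  have /andP[s1 s2] := hs.
  have [|_ _ _ ->//] := hg1 s.
  by rewrite in_itv/= (lt_le_trans _ s1) ?oppr_lt0//= (le_lt_trans s2)// ltrDl.
have w := hM1 s t hs ht.
have ts2 : (t - s) ^+ 2 <= A ^+ 2 * h ^+ 2 by rewrite -exprMn lerXn2r// nnegrE// mulr_ge0// ltW.
have {}w : enorm (gamma t - gamma s - (t - s) *: derive1 gamma s) <= B * h ^+ 2.
  by apply: le_trans w _; rewrite /B -mulrA ler_wpM2l// ltW.
have Dts : `|enorm (gamma t - gamma s) - (t - s)| <= B * h ^+ 2.
  apply: le_trans w; apply: le_trans (enorm_subr_le _ _).
  by rewrite enormZ tau1 mulr1 (ger0_norm ts0).
set D := enorm (gamma t - gamma s) in Dts *.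
have h20 : 0 <= h ^+ 2 by exact: sqr_ge0.
have Bh : B * h ^+ 2 <= B * L * h by rewrite expr2 mulrA ler_wpM2r// ler_wpM2l// ltW.
have /andP[Dl Du] : (t - s) - B * h ^+ 2 <= D <= (t - s) + B * h ^+ 2 by rewrite -ler_distl.
have [a1 a2] := hM2 u v hu hv.
split.
- by rewrite ge_min am//= (le_trans (aA u hu))// /M; lra.
- exact: tau1.
- apply/andP; split.
    apply: (@le_trans _ _ (C3 * (t - s))).
      apply: (@le_trans _ _ (C3 * m0 * h)); first by rewrite ler_wpM2r// ge_min lexx orbT.
      by rewrite -mulrA ler_wpM2l// ltW.
    have := hC3 t s; rewrite !in_itv/= => /(_ ht hs); rewrite ger0_norm//.
  apply: le_trans Du _; apply: (@le_trans _ _ (A * h + B * L * h)); first by lra.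
  by rewrite -mulrDl ler_wpM2r// /M; lra.
- rewrite -/h (ger0_norm h0) in a1; split.
    have -> : D - h * derive1 phi u = (D - (t - s)) + (t - s - h * derive1 phi u) by ring.
    apply: le_trans (ler_normD _ _) _; rewrite (ger0_norm h0) -/h in a2.
    apply: (le_trans (lerD Dts a2)); rewrite -mulrDl ler_wpM2r// /M; lra.
  by apply: le_trans a1 _; rewrite ler_wpM2r// /M; lra.
- have -> : gamma t - gamma s - D *: derive1 gamma s =
     (gamma t - gamma s - (t - s) *: derive1 gamma s) + ((t - s) - D) *: derive1 gamma s.
    by rewrite [in RHS](scalerBl (t - s) D) addrA subrK.
  apply: le_trans (enormD _ _) _; rewrite enormZ tau1 mulr1 distrC.
  apply: (le_trans (lerD w Dts)); rewrite -mulrDl ler_wpM2r// /M; lra.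
Qed.

End regular_path.

(** * Divided differences on a grid *)

Section divided_differences.
Context {R : realType}.
Implicit Types (p : nat -> 'rV[R]_2) (theta i : nat).

Lemma pdist_self p i : pdist p i i = 0.
Proof. by rewrite /pdist subrr enorm0. Qed.

Lemma pdistC p i j : pdist p i j = pdist p j i.
Proof. exact: enormB. Qed.

Lemma bcoef1E theta p i : let x := pdist p i (i + theta * 1) in
  bcoef theta 1 p i 0 = - x^-1 /\ bcoef theta 1 p i 1 = x^-1.
Proof.
move=> x; rewrite /bcoef; split; rewrite big_mkcond !big_ord_recl big_ord0 /= /bump/=
  ?add0n ?muln0 ?addn0 pdist_self -/x ?mul1r ?mulr1 ?sub0r ?subr0//.
by rewrite invrN.
Qed.

Lemma bcoef2E theta p i : let x := pdist p i (i + theta * 1) in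
  let y := pdist p i (i + theta * 2) in
  [/\ bcoef theta 2 p i 0 = 2 / (x * y), bcoef theta 2 p i 1 = - 2 / (x * (y - x))
    & bcoef theta 2 p i 2 = 2 / (y * (y - x))].
Proof.
move=> x y; rewrite /bcoef; split; rewrite big_mkcond !big_ord_recl big_ord0 /= /bump/=
  ?add0n ?muln0 ?addn0 pdist_self -/x -/y ?mul1r ?mulr1 ?sub0r ?subr0//.
- by rewrite mulrNN.
- by rewrite -[in LHS](opprB y x) mulrN invrN mulNr mulrN.
Qed.

Lemma sum_bcoef1 theta p i : \sum_(k < 2) bcoef theta 1 p i k = 0.
Proof. by have [e0 e1] := bcoef1E theta p i; rewrite !big_ord_recl big_ord0/= /bump/= e0 e1 addr0 addNr. Qed.

(** The weights are those of a second divided difference at the abscissae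
    [0], [x], [y]: they annihilate constants and the abscissae themselves. *)
Lemma sum_bcoef2 theta p i : let x := pdist p i (i + theta * 1) in
  let y := pdist p i (i + theta * 2) in x != 0 -> y != 0 -> y - x != 0 ->
  \sum_(k < 3) bcoef theta 2 p i k = 0 /\
  \sum_(k < 3) bcoef theta 2 p i k * pdist p i (i + theta * k) = 0.
Proof.
move=> x y x0 y0 xy; have [e0 e1 e2] := bcoef2E theta p i.
rewrite !big_ord_recl !big_ord0/= /bump/= e0 e1 e2 muln0 addn0 pdist_self -/x -/y.
by split; field; rewrite ?x0 ?y0 ?xy.
Qed.

End divided_differences.

Section grid.
Context {R : realType}.
Variables (L : R) (P tau : R -> 'rV[R]_2) (a : R -> R) (M m : R).
Hypothesis HP : regular_path L P tau a M m.

Definition mesh (n : nat) : R := L / (n%:R - 1).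
Definition node (n i : nat) : R := L * (i%:R - 1) / (n%:R - 1).
Definition gridpt (n i : nat) : 'rV[R]_2 := P (node n i).

Let L0 : 0 < L. Proof. by case: HP. Qed.
Let m0 : 0 < m. Proof. by case: HP. Qed.
Let M0 : 0 < M. Proof. by case: HP. Qed.

Lemma mesh_gt0 n : (1 < n)%N -> 0 < mesh n.
Proof. by move=> n1; rewrite divr_gt0// subr_gt0 ltr1n. Qed.

Lemma node_in n i : (1 < n)%N -> (1 <= i <= n)%N -> 0 <= node n i <= L.
Proof.
move=> n1 /andP[i1 i2]; have n1' : 0 < (n%:R : R) - 1 by rewrite subr_gt0 ltr1n.
have -> /= : 0 <= node n i.
  by rewrite /node; apply: divr_ge0; [apply: mulr_ge0; [exact: ltW|rewrite subr_ge0 ler1n]|exact: ltW].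
by rewrite /node ler_pdivrMr// ler_wpM2l ?(ltW L0)// lerB// ler_nat.
Qed.

Lemma nodeB n i j : (1 < n)%N -> (i <= j)%N -> node n j - node n i = (j - i)%:R * mesh n.
Proof.
move=> n1 ij; have n1' : (n%:R : R) - 1 != 0 by rewrite gt_eqF// subr_gt0 ltr1n.
by rewrite /node /mesh natrB//; field.
Qed.

Lemma gridP n i j : (1 < n)%N -> (1 <= i)%N -> (i <= j)%N -> (j <= n)%N ->
  let h := (j - i)%:R * mesh n in let u := node n i in
    [/\ m <= a u <= M, enorm (tau u) = 1,
        m * h <= pdist (gridpt n) i j <= M * h,
        `|pdist (gridpt n) i j - h * a u| <= M * h ^+ 2 /\ `|a (node n j) - a u| <= M * h
      & enorm (gridpt n j - gridpt n i - pdist (gridpt n) i j *: tau u) <= M * h ^+ 2].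
Proof.
move=> n1 i1 ij jn h u.
have hi : 0 <= node n i <= L by apply: node_in => //; rewrite i1 (leq_trans ij).
have hj : 0 <= node n j <= L by apply: node_in => //; rewrite jn (leq_trans i1).
have uv : node n i <= node n j by rewrite -subr_ge0 nodeB// mulr_ge0// ltW// mesh_gt0.
have [_ _ _ /(_ _ _ hi hj uv)] := HP.
have e : node n j - node n i = h by exact: nodeB.
have e2 : enorm (P (node n j) - P (node n i)) = pdist (gridpt n) i j by rewrite /pdist enormB.
rewrite e.
rewrite e2.
exact: id.
Qed.

End grid.

(* [mesh] is a quotient: kept folded, so that lemmas on products do not see
   through it *)
Global Opaque mesh.

(** * Windows of observations *)

Section windows.
Context {R : realType}.
Variables (L : R) (P tau : R -> 'rV[R]_2) (a : R -> R) (M m : R).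
Hypothesis HP : regular_path L P tau a M m.
Local Notation p n := (gridpt L P n).
Local Notation mesh := (mesh L).

Let m0 : 0 < m. Proof. by case: HP. Qed.
Let M0 : 0 < M. Proof. by case: HP. Qed.
Let mesh0 n : (1 < n)%N -> 0 < mesh n. Proof. exact: (mesh_gt0 HP). Qed.

Lemma window_dist n i k theta : (1 < n)%N -> (1 <= i)%N -> (i + theta * k <= n)%N ->
  [/\ m * ((theta * k)%:R * mesh n) <= pdist (p n) i (i + theta * k),
      pdist (p n) i (i + theta * k) <= M * ((theta * k)%:R * mesh n),
      `|pdist (p n) i (i + theta * k) - (theta * k)%:R * mesh n * a (node L n i)| <=
         M * ((theta * k)%:R * mesh n) ^+ 2,
      m <= a (node L n i) <= M &
      enorm (p n (i + theta * k)%N - p n i - pdist (p n) i (i + theta * k) *: tau (node L n i)) <=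
       M * ((theta * k)%:R * mesh n) ^+ 2].
Proof.
move=> n1 i1 ikn; have := gridP HP n1 i1 (leq_addr _ _) ikn.
by rewrite addKn => -[h1 _ /andP[h2 h3] [h4 _] h5]; split.
Qed.

(** Twice the first chord and the second one agree to first order; the
    difference of the two is therefore a positive multiple of the mesh. *)
Lemma window_gap n i theta : (1 < n)%N -> (1 <= i)%N -> (i + theta * 2 <= n)%N ->
  (0 < theta <= 2)%N -> mesh n <= m / (20 * M) ->
  m * mesh n / 2 <= pdist (p n) i (i + theta * 2) - pdist (p n) i (i + theta * 1).
Proof.
move=> n1 i1 i2 th hd; have d0 := mesh0 n1.
have i2' : (i + theta * 1 <= n)%N by apply: leq_trans i2; rewrite leq_add2l leq_mul2l orbT.
have [_ _ h2 /andP[am _] _] := window_dist n1 i1 i2.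
have [_ _ h1 _ _] := window_dist n1 i1 i2'.
move: h1 h2 hd; rewrite !ler_distl !natrM; set x := pdist _ _ _; set y := pdist _ _ _.
set e := mesh n in d0 *; set b := a _ in am *; rewrite ler_pdivlMr ?mulr_gt0// => h1 h2 hd.
have [th1 th2] : (1 : R) <= theta%:R /\ (theta%:R : R) <= 2.
  by move: th => /andP[? ?]; rewrite ler1n ler_nat.
move: h1 h2 th1 th2; set t : R := theta%:R; rewrite mulr1 => /andP[h1 h1'] /andP[h2 h2'] t1 t2.
have t20 : t ^+ 2 <= 2 * t by nra.
have Me : 0 < M * e ^+ 2 by rewrite mulr_gt0// exprn_gt0.
have Mte : M * (t * e) ^+ 2 <= 2 * t * (M * e ^+ 2).
  by rewrite exprMn mulrCA ler_wpM2r// ltW.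
have M4 : M * (t * 2 * e) ^+ 2 = 4 * (M * (t * e) ^+ 2) by ring.
have tb : t * e * m <= t * e * b by rewrite ler_wpM2l// mulr_ge0// ltW// (lt_le_trans ltr01).
have k1 : t * (e * (20 * M)) * e <= t * m * e by rewrite ler_wpM2r ?(ltW d0)// ler_wpM2l// (le_trans ler01).
have k2 : 1 * (m * e) <= t * (m * e) by rewrite ler_wpM2r// mulr_ge0 ?ltW.
lra.
Qed.

(** All that later estimates use of a window. The third clause is the essential
    one: for [l = 2] the size of the weights alone would only give the bound
    [B / dlt]. *)
Definition window_ok (theta l : nat) (B : R) (q : nat -> 'rV[R]_2) (dlt : R) (i : nat) : Prop :=
  [/\ \sum_(k < l.+1) bcoef theta l q i k = 0,
     forall k : 'I_l.+1, `|bcoef theta l q i k| <= B / dlt ^+ l,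
     enorm (\sum_(k < l.+1) bcoef theta l q i k *: (q (i + theta * k)%N - q i)) <= B &
     forall k : 'I_l.+1, enorm (q (i + theta * k)%N - q i) <= B * dlt].

Lemma window_bounds theta l : theta \in [:: 1%N; 2%N] -> l \in [:: 1%N; 2%N] ->
  exists B d0, [/\ 0 < B, 0 < d0 & forall n i, (1 < n)%N -> mesh n <= d0 ->
    (1 <= i <= n - theta * l)%N -> window_ok theta l B (p n) (mesh n) i].
Proof.
move=> hth hl.
have th : (0 < theta <= 2)%N by move: hth; rewrite !inE => /orP[] /eqP ->.
have l2 : (0 < l <= 2)%N by move: hl; rewrite !inE => /orP[] /eqP ->.
have [B [B0 hB1 hB2 hB3 hB4]] : exists B, [/\ 0 < B, 1 <= B, m^-1 <= B, 4 / m ^+ 2 <= B & 192 * M / m ^+ 2 <= B /\ 4 * M <= B].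
  have c1 : 0 < m^-1 by rewrite invr_gt0.
  have c2 : 0 < 4 / m ^+ 2 by rewrite divr_gt0// exprn_gt0.
  have c3 : 0 < 192 * M / m ^+ 2 by rewrite divr_gt0 ?mulr_gt0// exprn_gt0.
  move: c1 c2 c3 M0; move: (m^-1) (4 / m ^+ 2) (192 * M / m ^+ 2) => e1 e2 e3 *.
  exists (1 + e1 + e2 + e3 + 4 * M); split; lra.
move: hB4 => [hB4 hB5].
exists B, (m / (20 * M)); split=> //; first by rewrite divr_gt0// mulr_gt0.
move=> n i n1 hd /andP[i1 i2]; have d0 := mesh0 n1.
have ik (k : 'I_l.+1) : (i + theta * k <= n)%N.
  have : (theta * k <= theta * l)%N by rewrite leq_mul2l -ltnS ltn_ord orbT.
  have tl : (theta * l <= n)%N by apply: ltnW; rewrite -subn_gt0; exact: leq_trans i2.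
  move=> h; apply: (@leq_trans (i + theta * l)); first by rewrite leq_add2l.
  by rewrite addnC -leq_subRL.
have thk (k : 'I_l.+1) : ((theta * k)%:R : R) <= 4.
  have k2 : (k <= 2)%N by case/andP: l2 => _; apply: leq_trans; rewrite -ltnS.
  rewrite ler_nat; case/andP: th => _ th2; exact: (leq_mul th2 k2).
have uk (k : 'I_l.+1) : enorm (p n (i + theta * k)%N - p n i) <= B * mesh n.
  have [_ h _ _ _] := window_dist n1 i1 (ik k).
  rewrite enormB; apply: le_trans h _; rewrite mulrA ler_wpM2r ?(ltW d0)//.
  apply: (@le_trans _ _ (M * 4)); first by rewrite ler_wpM2l ?(ltW M0).
  by rewrite mulrC.
move: hl; rewrite !inE => /orP[] /eqP el; subst l.
  have [b0 b1] := bcoef1E theta (p n) i.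
  have [h1 h2 h3 h4 h5] := window_dist n1 i1 (ik ord_max).
  rewrite /= in h1 b0 b1; set x := pdist _ _ _ in b0 b1 h1.
  have mx : m * mesh n <= x.
    apply: le_trans h1; rewrite ler_wpM2l ?(ltW m0)// ler_peMl ?(ltW d0)// ler1n muln1.
    by case/andP: th.
  have x0 : 0 < x by apply: lt_le_trans mx; rewrite mulr_gt0.
  have xinv : x^-1 <= B / mesh n ^+ 1.
    rewrite expr1 ler_pdivlMr// mulrC ler_pdivrMr//; apply: (@le_trans _ _ (m^-1 * x)).
      by rewrite mulrC ler_pdivlMr// mulrC.
    by rewrite ler_wpM2r ?(ltW x0).
  split=> //.
  - exact: sum_bcoef1.
  - move=> [[|[|//]] k1]; rewrite /= ?b0 ?b1 ?normrN ger0_norm// invr_ge0 ltW//.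
  - rewrite !big_ord_recl big_ord0/= /bump/= b1 muln0 addn0 subrr scaler0 add0r addr0.
    by rewrite enormZ enormB -/(pdist (p n) _ _) -/x ger0_norm ?invr_ge0 ?(ltW x0)// mulVf ?gt_eqF.
have i2' : (i + theta * 2 <= n)%N by exact: (ik ord_max).
have [b0 b1 b2] := bcoef2E theta (p n) i.
have gap := window_gap n1 i1 i2' th hd.
have [hx _ _ _ _] := window_dist n1 i1 (ik (Ordinal (isT : (1 < 3)%N))).
have [hy _ _ _ _] := window_dist n1 i1 (ik ord_max).
rewrite /= in hx hy; set x := pdist _ _ (i + theta * 1) in b0 b1 b2 hx gap.
set y := pdist _ _ (i + theta * 2) in b0 b1 b2 hy gap.
have th1 : (1 : R) <= theta%:R by rewrite ler1n; case/andP: th.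
have mx : m * mesh n <= x.
  by apply: le_trans hx; rewrite ler_wpM2l ?(ltW m0)// ler_peMl ?(ltW d0)// muln1.
have my : m * mesh n <= y.
  apply: le_trans hy; rewrite ler_wpM2l ?(ltW m0)// ler_peMl ?(ltW d0)// natrM; nra.
have md0 : 0 < m * mesh n by rewrite mulr_gt0.
have x0 : 0 < x by exact: lt_le_trans mx.
have y0 : 0 < y by exact: lt_le_trans my.
have yx0 : 0 < y - x by apply: lt_le_trans gap; rewrite divr_gt0.
have key u v : m * mesh n <= u -> m * mesh n / 2 <= v -> 0 < u -> 0 < v ->
    2 / (u * v) <= 4 / m ^+ 2 / mesh n ^+ 2.
  move=> hu hv u0 v0; rewrite ler_pdivrMr ?mulr_gt0//.
  have : (m * mesh n) * (m * mesh n / 2) <= u * v by rewrite ler_pM// ?divr_ge0// ltW.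
  move=> h; apply: (@le_trans _ _ (4 / m ^+ 2 / mesh n ^+ 2 * (m * mesh n * (m * mesh n / 2)))).
    by rewrite le_eqVlt; apply/orP; left; apply/eqP; field; rewrite !gt_eqF.
  by rewrite ler_wpM2l// !divr_ge0// ?exprn_ge0// ltW.
have my2 : m * mesh n / 2 <= y by lra.
have bk (k : 'I_3) : `|bcoef theta 2 (p n) i k| <= 4 / m ^+ 2 / mesh n ^+ 2.
  case: k => -[|[|[|//]]] k3 /=; rewrite ?b0 ?b1 ?b2 ?mulNr ?normrN ger0_norm ?key//.
  - by rewrite divr_ge0// mulr_ge0// ltW.
  - by rewrite divr_ge0// mulr_ge0// ltW.
  - by rewrite divr_ge0// mulr_ge0// ltW.
have [s0 s1] : \sum_(k < 3) bcoef theta 2 (p n) i k = 0 /\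
  \sum_(k < 3) bcoef theta 2 (p n) i k * pdist (p n) i (i + theta * k) = 0.
  by apply: sum_bcoef2; rewrite gt_eqF.
split=> //.
  by move=> k; apply: le_trans (bk k) _; rewrite ler_wpM2r ?invr_ge0 ?exprn_ge0 ?(ltW d0).
(* the weights annihilate the chord lengths, hence the tangential parts; the rest
   is quadratic in the mesh *)
have -> : \sum_(k < 3) bcoef theta 2 (p n) i k *: (p n (i + theta * k)%N - p n i) =
  \sum_(k < 3) bcoef theta 2 (p n) i k *: (p n (i + theta * k)%N - p n i -
     pdist (p n) i (i + theta * k) *: tau (node L n i)).
  under [RHS]eq_bigr do rewrite scalerBr scalerA.
  by rewrite sumrB -scaler_suml s1 scale0r subr0.
apply: le_trans (enorm_sum _ _) _.
have hk (k : 'I_3) : enorm (bcoef theta 2 (p n) i k *: (p n (i + theta * k)%N - p n i -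
     pdist (p n) i (i + theta * k) *: tau (node L n i))) <= 64 * M / m ^+ 2.
  have [_ _ _ _ h] := window_dist n1 i1 (ik k).
  rewrite enormZ; apply: le_trans (ler_pM _ _ (bk k) h) _; rewrite ?enorm_ge0//.
  apply: (@le_trans _ _ (4 / m ^+ 2 / mesh n ^+ 2 * (M * (4 * mesh n) ^+ 2))).
    rewrite ler_wpM2l ?divr_ge0 ?exprn_ge0 ?(ltW d0) ?(ltW m0)// ler_wpM2l ?(ltW M0)//.
    have hh : (theta * k)%:R * mesh n <= 4 * mesh n by rewrite ler_wpM2r ?(ltW d0).
    by apply: lerXn2r hh; rewrite nnegrE mulr_ge0// ltW.
  by rewrite le_eqVlt; apply/orP; left; apply/eqP; field; rewrite !gt_eqF.
apply: le_trans (ler_sum _ (fun k _ => hk k)) _.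
rewrite sumr_const card_ord -mulr_natl; apply: le_trans hB4.
by rewrite le_eqVlt; apply/orP; left; apply/eqP; ring.
Qed.

End windows.

(** * Variance of one increment *)

Section diagonal.
Context {R : realType}.

Lemma sum_sym_offdiag n (F : 'I_n -> 'I_n -> R) :
  (forall i j, F i j = F j i) -> (forall i, F i i = 0) ->
  \sum_(i < n) \sum_(j < n) F i j = 2 * \sum_(i < n) \sum_(j < n | (i < j)%N) F i j.
Proof.
move=> Fs F0.
have e i : \sum_(j < n) F i j = \sum_(j < n | (i < j)%N) F i j + \sum_(j < n | (j < i)%N) F i j.
  rewrite (bigID (fun j : 'I_n => (i < j)%N))/=; congr (_ + _).
  rewrite (bigD1 i) ?ltnn//= F0 add0r; apply: eq_bigl => j.
  by rewrite -leqNgt [RHS]ltn_neqAle andbC.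
under eq_bigr do rewrite e.
rewrite big_split/= mulr_natl mulr2n; congr (_ + _).
rewrite (exchange_big_dep predT)//=; apply: eq_bigr => i _.
by apply: eq_bigr => j _.
Qed.

(** Expand the square: since the weights have total zero, only the mixed terms
    survive. *)
Lemma sum_sqr_dist n (b x : 'I_n -> R) : \sum_i b i = 0 ->
  \sum_i \sum_j b i * b j * (x i - x j) ^+ 2 = - 2 * (\sum_i b i * x i) ^+ 2.
Proof.
move=> b0.
transitivity (\sum_i (b i * x i ^+ 2 * (\sum_j b j) + b i * (\sum_j b j * x j ^+ 2)
   - 2 * (b i * x i) * (\sum_j b j * x j))).
  apply: eq_bigr => i _; rewrite !mulr_sumr -!big_split/= -sumrB.
  by apply: eq_bigr => j _; ring.
rewrite sumrB !big_split/= b0 -!mulr_suml b0 mul0r mulr0 !addr0 sub0r -mulr_sumr expr2; ring.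
Qed.

Lemma sum_enorm_dist n (b : 'I_n -> R) (x : 'I_n -> 'rV[R]_2) : \sum_i b i = 0 ->
  \sum_i \sum_j b i * b j * enorm (x i - x j) ^+ 2 = - 2 * enorm (\sum_i b i *: x i) ^+ 2.
Proof.
move=> b0; rewrite enorm_sqr mulrDr.
have e c : (\sum_i b i *: x i) 0 c = \sum_i b i * x i 0 c.
  by rewrite summxE; apply: eq_bigr => i _; rewrite mxE.
rewrite !e -!sum_sqr_dist// -big_split/=; apply: eq_bigr => i _.
rewrite -big_split/=; apply: eq_bigr => j _.
by rewrite enorm_sqr !mxE mulrDr.
Qed.

(** The contribution of one window to [ftilde], without the factor
    [2 * betastar]. *)
Definition diag_main theta l (q : nat -> 'rV[R]_2) (nu : R) i : R :=
  \sum_(k1 < l.+1) \sum_(k2 < l.+1 | (k1 < k2)%N)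
      bcoef theta l q i k1 * bcoef theta l q i k2 *
      Gfun nu (pdist q (i + theta * k1) (i + theta * k2)).

Lemma window_dist2 theta l B (q : nat -> 'rV[R]_2) dlt i (k1 k2 : 'I_l.+1) : window_ok theta l B q dlt i ->
  enorm (q (i + theta * k1)%N - q (i + theta * k2)%N) <= 2 * B * dlt.
Proof.
move=> [_ _ _ h].
have -> : q (i + theta * k1)%N - q (i + theta * k2)%N =
  (q (i + theta * k1)%N - q i) - (q (i + theta * k2)%N - q i).
  by rewrite opprB addrA subrK.
apply: le_trans (enormD _ _) _; rewrite enormN -mulrA mulr_natl mulr2n lerD//; exact: h.
Qed.

(** The double sum is minus twice the squared norm of the weighted sum of the
    points of the window. *)
Lemma window_sq_dist theta l B (q : nat -> 'rV[R]_2) dlt i : window_ok theta l B q dlt i ->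
  `|\sum_(k1 < l.+1) \sum_(k2 < l.+1) bcoef theta l q i k1 * bcoef theta l q i k2 *
     pdist q (i + theta * k1) (i + theta * k2) ^+ 2| <= 2 * B ^+ 2.
Proof.
move=> [b0 _ h _].
rewrite (_ : \sum_(k1 < l.+1) _ = \sum_(k1 < l.+1) \sum_(k2 < l.+1) bcoef theta l q i k1 * bcoef theta l q i k2 *
    enorm ((q (i + theta * k1)%N - q i) - (q (i + theta * k2)%N - q i)) ^+ 2); last first.
  by apply: eq_bigr => k1 _; apply: eq_bigr => k2 _; rewrite /pdist opprB addrA subrK.
rewrite (sum_enorm_dist _ b0) mulNr normrN.
set u := enorm _ in h *; have u0 : 0 <= u by exact: enorm_ge0.
have uB : u ^+ 2 <= B ^+ 2 by rewrite lerXn2r ?nnegrE// (le_trans u0 h).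
by rewrite ger0_norm; [rewrite ler_pM2l|rewrite mulr_ge0// sqr_ge0].
Qed.

Lemma norm_mul3_le (x y z s t : R) : `|x| <= s -> `|y| <= s -> `|z| <= t ->
  `|x * y * z| <= s ^+ 2 * t.
Proof.
move=> hx hy hz; rewrite !normrM expr2; apply: ler_pM => //.
exact: ler_pM.
Qed.

(** Of the polynomial part of the covariance, degree zero is annihilated and
    degree two is bounded; no further degree occurs because [nu < 2]. The remainder
    is estimated term by term with the size of the weights. *)
Lemma diag_expansion (nu : R) (beta : nat -> R) (bs : R) (Kt : 'rV[R]_2 -> R) l :
  l \in [:: 1%N; 2%N] -> 0 < nu < l%:R -> covariance_form nu beta bs Kt ->
  exists2 tau, 0 < tau & forall B, 0 < B -> exists C d0, [/\ 0 < C, 0 < d0 &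
    forall theta q dlt i, 0 < dlt <= d0 -> window_ok theta l B q dlt i ->
    `|nabla_cov Kt theta l q i i - 2 * bs * diag_main theta l q nu i| <=
      C * (1 + dlt `^ (2 * nu + tau) / dlt ^+ (2 * l))].
Proof.
move=> hl /andP[nu0 nul] [_ [r [tau [tau0 hK [C0 [dr [dr0 hr]]]]]]].
exists tau => // B B0.
pose e := 2 * nu + tau.
have e0 : 0 < e by rewrite /e; lra.
pose C := 1 + `|beta 1%N| * (2 * B ^+ 2) + (l.+1 ^ 2)%:R * B ^+ 2 * (`|C0| * (2 * B) `^ e).
exists C, (dr / (4 * B)).
have c1 : 0 <= `|beta 1%N| * (2 * B ^+ 2) by rewrite !mulr_ge0 ?(ltW B0).
have c2 : 0 <= (l.+1 ^ 2)%:R * B ^+ 2 * (`|C0| * (2 * B) `^ e).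
  by rewrite !mulr_ge0 ?(ltW B0) ?powR_ge0.
split; first by rewrite /C; lra.
  by rewrite divr_gt0// mulr_gt0.
move=> theta q dlt i /andP[d0 hd] W; have [b0 hb hu huk] := W.
pose b := fun k : 'I_l.+1 => bcoef theta l q i k.
pose dd (k1 k2 : 'I_l.+1) := pdist q (i + theta * k1) (i + theta * k2).
pose poly := \sum_(k1 < l.+1) \sum_(k2 < l.+1) b k1 * b k2 *
   \sum_(j < (Num.truncn nu).+1) beta j * dd k1 k2 ^+ (2 * j).
pose rem := \sum_(k1 < l.+1) \sum_(k2 < l.+1) b k1 * b k2 *
   r (q (i + theta * k1)%N) (q (i + theta * k2)%N).
have -> : nabla_cov Kt theta l q i i - 2 * bs * diag_main theta l q nu i = poly + rem.
  have -> : 2 * bs * diag_main theta l q nu i = bs * \sum_(k1 < l.+1) \sum_(k2 < l.+1)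
      b k1 * b k2 * Gfun nu (dd k1 k2).
    rewrite sum_sym_offdiag; first by rewrite mulrAC mulrC (mulrC 2).
      by move=> k1 k2; rewrite /dd pdistC (mulrC (b k1)).
    by move=> k; rewrite /dd pdist_self /Gfun eqxx mulr0.
  rewrite /nabla_cov /poly /rem mulr_sumr -sumrB -big_split/=; apply: eq_bigr => k1 _.
  rewrite mulr_sumr -sumrB -big_split/=; apply: eq_bigr => k2 _.
  by rewrite hK -/(pdist q _ _) -/(dd k1 k2) /b; ring.
have hpoly : `|poly| <= `|beta 1%N| * (2 * B ^+ 2).
  have -> : poly = \sum_(j < (Num.truncn nu).+1) beta j *
      \sum_(k1 < l.+1) \sum_(k2 < l.+1) b k1 * b k2 * dd k1 k2 ^+ (2 * j).
    under [RHS]eq_bigr do rewrite mulr_sumr.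
    rewrite exchange_big/=; apply: eq_bigr => k1 _.
    under [RHS]eq_bigr do rewrite mulr_sumr.
    rewrite exchange_big/=; apply: eq_bigr => k2 _.
    by rewrite mulr_sumr; apply: eq_bigr => j _; ring.
  rewrite big_ord_recl/= [X in beta 0%N * X](_ : _ = 0); last first.
    under eq_bigr do under eq_bigr do rewrite muln0 expr0 mulr1.
    by under eq_bigr do rewrite -mulr_sumr; rewrite -mulr_suml b0 mul0r.
  rewrite mulr0 add0r.
  have : (Num.truncn nu < 2)%N.
    rewrite truncn_lt_nat ?(ltW nu0)// (lt_le_trans nul)//.
    by move: hl; rewrite !inE => /orP[] /eqP ->; rewrite ler_nat.
  case: (Num.truncn nu) => [|[|//]] _; first by rewrite big_ord0 normr0.
  rewrite big_ord1 /bump/= addn0 normrM ler_wpM2l// muln1.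
  exact: window_sq_dist W.
have hrem : `|rem| <= (l.+1 ^ 2)%:R * B ^+ 2 * (`|C0| * (2 * B) `^ e) * (dlt `^ e / dlt ^+ (2 * l)).
  have t k1 k2 : `|b k1 * b k2 * r (q (i + theta * k1)%N) (q (i + theta * k2)%N)| <=
     (B / dlt ^+ l) ^+ 2 * (`|C0| * (2 * B * dlt) `^ e).
    apply: norm_mul3_le; [exact: hb|exact: hb|].
    have hw := @window_dist2 theta l B q dlt i k1 k2 W.
    apply: le_trans (hr _ _ _) _.
      apply: le_lt_trans hw _; apply: (@le_lt_trans _ _ (2 * B * (dr / (4 * B)))).
        by rewrite ler_wpM2l// mulr_ge0// ltW.
      rewrite (_ : 2 * B * _ = dr / 2); last by field; rewrite gt_eqF.
      lra.
    apply: le_trans (ler_wpM2r (powR_ge0 _ _) (ler_norm C0)) _; rewrite ler_wpM2l//.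
    apply: ge0_ler_powR => //; rewrite ?nnegrE ?enorm_ge0 ?(ltW e0)//.
    by rewrite !mulr_ge0// ltW.
  have -> : (l.+1 ^ 2)%:R * B ^+ 2 * (`|C0| * (2 * B) `^ e) * (dlt `^ e / dlt ^+ (2 * l)) =
     \sum_(k1 < l.+1) \sum_(k2 < l.+1) (B / dlt ^+ l) ^+ 2 * (`|C0| * (2 * B * dlt) `^ e).
    rewrite !sumr_const !card_ord -mulrnA -[RHS]mulr_natl.
    have -> : (2 * B * dlt) `^ e = (2 * B) `^ e * dlt `^ e.
      by rewrite powRM ?mulr_ge0 ?(ltW B0) ?(ltW d0).
    rewrite (mulnC 2 l) (exprM dlt) -mulnn.
    by field; rewrite gt_eqF// exprn_gt0.
  apply: le_trans (ler_norm_sum _ _ _) _; apply: ler_sum => k1 _.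
  by apply: le_trans (ler_norm_sum _ _ _) _; apply: ler_sum => k2 _.
apply: le_trans (ler_normD _ _) _; apply: le_trans (lerD hpoly hrem) _.
set z := dlt `^ e / dlt ^+ (2 * l).
have z0 : 0 <= z by rewrite divr_ge0 ?powR_ge0// exprn_ge0// ltW.
rewrite mulrDr mulr1; apply: lerD; first by rewrite /C; lra.
by rewrite ler_wpM2r// /C; lra.
Qed.

End diagonal.

(** * The second difference of the principal function *)

Section main_term.
Context {R : realType}.

(** [Gfun] without the exception at zero, hence continuous on the positive axis by
    composition. *)
Definition gpos (nu s : R) : R :=
  if nu \is a Num.int then s `^ (2 * nu) * ln s else s `^ (2 * nu).

Lemma Gfun_pos nu s : 0 < s -> Gfun nu s = gpos nu s.
Proof. by move=> s0; rewrite /Gfun gt_eqF. Qed.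

(** For integral [nu] homogeneity fails by a term carrying the logarithm of the
    scale. *)
Lemma gpos_scale nu c s : 0 < c -> 0 < s ->
  gpos nu (c * s) = c `^ (2 * nu) * gpos nu s +
   (if nu \is a Num.int then c `^ (2 * nu) * ln c * s `^ (2 * nu) else 0).
Proof.
move=> c0 s0; rewrite /gpos; case: ifP => _; rewrite powRM ?(ltW c0) ?(ltW s0)//; last by rewrite addr0.
by rewrite lnM ?posrE//; ring.
Qed.

Lemma continuous_powR_pos (e s : R) : 0 < s -> {for s, continuous (fun x : R => x `^ e)}.
Proof.
move=> s0; apply: differentiable_continuous; apply/derivable1_diffP.
by have [] := is_derive1_powR e s0.
Qed.

Lemma continuous_gpos nu s : 0 < s -> {for s, continuous (gpos nu)}.
Proof.
move=> s0; have cp := @continuous_powR_pos (2 * nu) s s0.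
rewrite /gpos; case: (nu \is a Num.int); last exact: cp.
by apply: cvgM; [exact: cp|exact: continuous_ln].
Qed.

Lemma int_lt2 (nu : R) : 0 < nu < 2 -> nu \is a Num.int -> nu = 1.
Proof.
move=> /andP[h1 h2] /intrP[z ez]; move: h1 h2; rewrite ez ltr0z.
move=> z0 z2; have {}z2 : (z < 2)%R by rewrite -(ltr_int R).
by have -> : z = 1 by lia.
Qed.

Lemma int_lt1 (nu : R) : 0 < nu < 1 -> nu \is a Num.int = false.
Proof.
move=> /andP[h1 h2]; apply/negP => /intrP[z ez]; move: h1 h2; rewrite ez ltr0z ltrz1.
lia.
Qed.

(** [diag_main] for a window with chords [X], [Y] from its first point and
    [Z] between the other two. *)
Definition second_diff_form (nu X Y Z : R) : R :=
  2 / (X * Y) * (- 2 / (X * (Y - X))) * gpos nu X +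
  2 / (X * Y) * (2 / (Y * (Y - X))) * gpos nu Y +
  (- 2 / (X * (Y - X))) * (2 / (Y * (Y - X))) * gpos nu Z.

Lemma second_diff_form_cvg nu (eps : R) : 0 < eps -> exists2 eta, 0 < eta & forall X Y Z,
  `|X - 1| < eta -> `|Y - 2| < eta -> `|Z - 1| < eta ->
  `|second_diff_form nu X Y Z - (gpos nu 2 - 4 * gpos nu 1)| <= eps.
Proof.
move=> e0.
pose F (w : R * R * R) := second_diff_form nu w.1.1 w.1.2 w.2.
pose w0 : R * R * R := ((1, 2), 1).
have cF : F w @[w --> w0] --> F w0.
  have c2 : (w.2 : R) @[w --> w0] --> (1 : R) by exact: cvg_snd.
  have c11 : (w.1.1 : R) @[w --> w0] --> (1 : R).
    by apply: (@cvg_comp _ _ _ (@fst (R * R) R) (@fst R R) _ (nbhs w0.1)); exact: cvg_fst.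
  have c12 : (w.1.2 : R) @[w --> w0] --> (2 : R).
    by apply: (@cvg_comp _ _ _ (@fst (R * R) R) (@snd R R) _ (nbhs w0.1)); [exact: cvg_fst|exact: cvg_snd].
  have g2 : gpos nu w.2 @[w --> w0] --> gpos nu 1.
    by apply: cvg_comp c2 _; exact: continuous_gpos.
  have g11 : gpos nu w.1.1 @[w --> w0] --> gpos nu 1.
    by apply: cvg_comp c11 _; exact: continuous_gpos.
  have g12 : gpos nu w.1.2 @[w --> w0] --> gpos nu 2.
    by apply: cvg_comp c12 _; exact: continuous_gpos.
  have cst c : (fun _ : R * R * R => c) w @[w --> w0] --> (c : R) by exact: cvg_cst.
  have v1 : (w.1.1 * w.1.2)^-1 @[w --> w0] --> (1 * 2 : R)^-1.
    by apply: cvgV; [rewrite mul1r|exact: cvgM].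
  have v2 : (w.1.1 * (w.1.2 - w.1.1))^-1 @[w --> w0] --> (1 * (2 - 1) : R)^-1.
    by apply: cvgV; [rewrite gt_eqF//; lra|apply: cvgM => //; exact: cvgB].
  have v3 : (w.1.2 * (w.1.2 - w.1.1))^-1 @[w --> w0] --> (2 * (2 - 1) : R)^-1.
    by apply: cvgV; [rewrite gt_eqF//; lra|apply: cvgM => //; exact: cvgB].
  rewrite /F /second_diff_form /=.
  by apply: cvgD; [apply: cvgD|]; repeat (apply: cvgM => //).
have eF : F w0 = gpos nu 2 - 4 * gpos nu 1.
  by rewrite /F /second_diff_form /=; field.
move/cvgrPdist_le: cF => /(_ _ e0) /nbhs_ballP[eta /= eta0 h].
exists eta => // X Y Z hX hY hZ.
have := h ((X, Y), Z); rewrite eF /F /= distrC; apply.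
by split; [split|]; rewrite /ball/= distrC.
Qed.

(** For nonintegral [nu] the difference is the [2 * nu]-th power of [2] minus [4],
    which vanishes for [nu = 1] only; and for [nu = 1] the logarithm takes over. *)
Lemma second_diff_limit_neq0 nu : 0 < nu < 2 -> gpos nu 2 - 4 * gpos nu 1 != 0.
Proof.
move=> hnu; rewrite /gpos; case: ifPn => [hint|hint].
  rewrite (int_lt2 hnu hint) ln1 mulr0 mulr0 subr0 mulf_neq0//.
  by rewrite gt_eqF// ln_gt0// ltr1n.
rewrite powR1 mulr1 subr_eq0; apply/negP => /eqP h.
have : ln ((2 : R) `^ (2 * nu)) = ln ((2 : R) `^ 2).
  by rewrite h; congr ln; rewrite (powR_mulrn 2)//; ring.
rewrite !ln_powR => /mulIf; rewrite gt_eqF ?ln_gt0 ?ltr1n// => /(_ isT) h2.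
have nu1 : nu = 1 by lra.
by move: hint; rewrite nu1 int_num1.
Qed.

End main_term.

(** * Asymptotics of the principal term *)

Section main_term_asymptotics.
Context {R : realType}.

Lemma powR_subn (c e : R) k : 0 < c -> c `^ (e - k%:R) = c `^ e / c ^+ k.
Proof.
move=> c0; rewrite powRD ?(gt_eqF c0) ?implybT//.
by rewrite powRN powR_mulrn// ltW.
Qed.

Lemma abs_ln_le_inv (c : R) : 0 < c -> c <= 1 -> `|ln c| <= c^-1.
Proof.
move=> c0 c1; rewrite ler0_norm; last by rewrite -ln1 ler_ln ?posrE.
by rewrite -lnV ?posrE// ltW// ln_sublinear// invr_gt0.
Qed.

Variables (L : R) (P tau : R -> 'rV[R]_2) (a : R -> R) (M m : R).
Hypothesis HP : regular_path L P tau a M m.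
Local Notation p n := (gridpt L P n).
Local Notation mesh := (mesh L).

Let m0 : 0 < m. Proof. by case: HP. Qed.
Let M0 : 0 < M. Proof. by case: HP. Qed.
Let mesh0 n : (1 < n)%N -> 0 < mesh n. Proof. exact: (mesh_gt0 HP). Qed.

(** The distance between the points [i] and [i + theta], to first order. *)
Definition spacing theta n i := theta%:R * mesh n * a (node L n i).

Lemma spacing_bounds theta n i : (0 < theta <= 2)%N -> (1 < n)%N -> (1 <= i <= n)%N ->
  m * mesh n <= spacing theta n i <= 2 * M * mesh n.
Proof.
move=> /andP[t1 t2] n1 /andP[i1 i2].
have [/andP[am aM] _ _ _ _] := gridP HP n1 i1 (leqnn i) i2.
have d0 := mesh0 n1; rewrite /spacing.
have [th1 th2] : (1 : R) <= theta%:R /\ (theta%:R : R) <= 2 by rewrite ler1n ler_nat.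
apply/andP; split.
  by rewrite mulrC; apply: ler_pM; rewrite ?(ltW m0) ?(ltW d0)// ler_peMl// ltW.
rewrite mulrAC ler_wpM2r ?(ltW d0)//.
by apply: ler_pM => //; apply: le_trans am; exact: ltW.
Qed.

(** In units of the spacing, the chords of a window tend to those of equally
    spaced points on a line. *)
Lemma rel_chord theta n i : (0 < theta <= 2)%N -> (1 < n)%N -> (1 <= i)%N ->
  let c := spacing theta n i in
  (forall k, (k <= 2)%N -> (i + theta * k <= n)%N ->
     `|pdist (p n) i (i + theta * k) / c - k%:R| <= 16 * M / m * mesh n) /\
  ((i + theta * 2 <= n)%N -> `|pdist (p n) (i + theta * 1) (i + theta * 2) / c - 1| <= 16 * M / m * mesh n).
Proof.
move=> th n1 i1 c; have d0 := mesh0 n1.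
have /andP[t1 t2] := th.
have [th1 th2] : (1 : R) <= theta%:R /\ (theta%:R : R) <= 2 by rewrite ler1n ler_nat.
have red (D k : R) : 0 < c -> `|D - k * c| <= 8 * M * (theta%:R * mesh n ^+ 2) -> theta%:R * mesh n * m <= c ->
    `|D / c - k| <= 16 * M / m * mesh n.
  move=> c0 h hc; have -> : D / c - k = (D - k * c) / c by field; rewrite gt_eqF.
  rewrite normrM normfV (gtr0_norm c0) ler_pdivrMr//; apply: le_trans h _.
  apply: (@le_trans _ _ (16 * M / m * mesh n * (theta%:R * mesh n * m))); last first.
    rewrite ler_wpM2l//; apply: mulr_ge0 (ltW d0).
    by apply: divr_ge0 (ltW m0); apply: mulr_ge0 (ltW M0).
  rewrite [leRHS](_ : _ = 16 * M * (theta%:R * mesh n ^+ 2)); last by field; rewrite gt_eqF.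
  rewrite ler_wpM2r//; first by apply: mulr_ge0 (sqr_ge0 _).
  by rewrite ler_wpM2r ?(ltW M0)// ler_nat.
have in_n k : (i + theta * k <= n)%N -> (1 <= i <= n)%N by move=> h; rewrite i1 (leq_trans (leq_addr _ _) h).
have cpos k : (i + theta * k <= n)%N -> 0 < c /\ theta%:R * mesh n * m <= c.
  move=> /in_n hi; have /andP[h1 _] := spacing_bounds th n1 hi.
  split; first by apply: lt_le_trans h1; rewrite mulr_gt0.
  have [/andP[am _] _ _ _ _] := gridP HP n1 i1 (leqnn i) (proj2 (andP hi)).
  by rewrite /c /spacing ler_wpM2l// mulr_ge0// ltW.
split.
  move=> k k2 hk; have [c0 hc] := cpos k hk.
  apply: red => //; have [_ _ h _ _] := window_dist HP n1 i1 hk.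
  have -> : k%:R * c = (theta * k)%:R * mesh n * a (node L n i) by rewrite /c /spacing natrM; ring.
  apply: le_trans h _; rewrite natrM.
  have k2' : (k%:R : R) <= 2 by rewrite ler_nat.
  have k0 : (0 : R) <= k%:R by [].
  have k4 : (k%:R : R) ^+ 2 <= 4 by nra.
  have t4 : (theta%:R : R) ^+ 2 <= 2 * theta%:R by nra.
  have e0 := sqr_ge0 (mesh n).
  have tk : (theta%:R : R) ^+ 2 * k%:R ^+ 2 <= 2 * theta%:R * 4 by apply: ler_pM; rewrite ?sqr_ge0.
  have := ler_wpM2r (mulr_ge0 (ltW M0) e0) tk.
  by rewrite !exprMn; move: (theta%:R : R) (k%:R : R) => t kk; lra.
move=> h2; have [c0 hc] := cpos 2%N h2; apply: red => //.
have i1' : (1 <= i + theta * 1)%N by apply: leq_trans i1 (leq_addr _ _).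
have h2' : (i + theta * 1 <= i + theta * 2)%N by rewrite leq_add2l leq_mul2l orbT.
have := gridP HP n1 i1' h2' h2.
rewrite subnDl -mulnBr (_ : 2 - 1 = 1)%N// muln1 => -[_ _ _ [h _] _].
have := gridP HP n1 i1 (leq_addr (theta * 1) i) (leq_trans h2' h2).
rewrite addKn muln1 => -[_ _ _ [_ h3] _].
set D := pdist _ _ _ in h *.
rewrite (_ : D - 1 * c = (D - theta%:R * mesh n * a (node L n (i + theta)%N))
  + theta%:R * mesh n * (a (node L n (i + theta)%N) - a (node L n i))); last by rewrite /c /spacing; ring.
apply: le_trans (ler_normD _ _) _.
have td0 : 0 <= theta%:R * mesh n by rewrite mulr_ge0// ltW.
have h4 : `|theta%:R * mesh n * (a (node L n (i + theta)%N) - a (node L n i))| <= M * (theta%:R * mesh n) ^+ 2.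
  rewrite (_ : M * _ = theta%:R * mesh n * (M * (theta%:R * mesh n))); last by ring.
  by rewrite normrM (ger0_norm td0) ler_wpM2l.
apply: le_trans (lerD h h4) _.
have t4 : (theta%:R : R) ^+ 2 <= 2 * theta%:R by nra.
have := ler_wpM2r (mulr_ge0 (ltW M0) (sqr_ge0 (mesh n))) t4.
have pos : 0 <= theta%:R * (M * mesh n ^+ 2) by apply: mulr_ge0 => //; apply: mulr_ge0 (ltW M0) (sqr_ge0 _).
by move: pos; move: (theta%:R : R) (mesh n) => t e; rewrite exprMn; lra.
Qed.

(** The value of [diag_main] for collinear points at distance one. *)
Definition main_const (l : nat) (nu : R) : R :=
  if l == 1%N then - 1 else gpos nu 2 - 4 * gpos nu 1.

Lemma main_const_neq0 l nu : l \in [:: 1%N; 2%N] -> 0 < nu < l%:R -> main_const l nu != 0.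
Proof.
rewrite !inE /main_const => /orP[] /eqP -> /= h; first by rewrite oppr_eq0 oner_eq0.
exact: second_diff_limit_neq0.
Qed.

Lemma sum_lt2 (F : nat -> nat -> R) :
  \sum_(k1 < 2) \sum_(k2 < 2 | (k1 < k2)%N) F k1 k2 = F 0%N 1%N.
Proof.
under eq_bigr do rewrite big_mkcond.
by rewrite !big_ord_recl !big_ord0 /= /bump/= !addn0 !add0r !addr0.
Qed.

Lemma sum_lt3 (F : nat -> nat -> R) :
  \sum_(k1 < 3) \sum_(k2 < 3 | (k1 < k2)%N) F k1 k2 = F 0%N 1%N + F 0%N 2%N + F 1%N 2%N.
Proof.
under eq_bigr do rewrite big_mkcond.
by rewrite !big_ord_recl !big_ord0 /= /bump/= !addn0 !add0r !addr0.
Qed.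

Lemma diag_main1 theta (q : nat -> 'rV[R]_2) nu i c :
  let x := pdist q i (i + theta * 1) in 0 < nu < 1 -> 0 < x -> 0 < c ->
  diag_main theta 1 q nu i = c `^ (2 * nu - 2) * - ((x / c)^-1 ^+ 2 * (x / c) `^ (2 * nu)).
Proof.
move=> x hnu x0 c0; have [b0 b1] := bcoef1E theta q i.
rewrite /diag_main (sum_lt2 (fun k1 k2 => bcoef theta 1 q i k1 * bcoef theta 1 q i k2 *
      Gfun nu (pdist q (i + theta * k1) (i + theta * k2)))).
rewrite b0 b1 muln0 addn0 -/x (Gfun_pos _ x0) /gpos int_lt1//.
have y0 : 0 < x / c by rewrite divr_gt0.
have -> : x `^ (2 * nu) = c `^ (2 * nu) * (x / c) `^ (2 * nu).
  by rewrite -powRM ?(ltW c0) ?(ltW y0)//; congr (_ `^ _); field; rewrite gt_eqF.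
rewrite (powR_subn _ 2 c0) -/x.
by field; rewrite !gt_eqF.
Qed.

(** Rescaling by [c]. For [nu = 1] the logarithm of [c] is multiplied by a double
    sum of squared distances, bounded by [window_sq_dist]. *)
Lemma diag_main2 theta (q : nat -> 'rV[R]_2) nu i c :
  let x := pdist q i (i + theta * 1) in let y := pdist q i (i + theta * 2) in
  let z := pdist q (i + theta * 1) (i + theta * 2) in
  0 < nu < 2 -> 0 < x -> 0 < y -> 0 < z -> y - x != 0 -> 0 < c ->
  diag_main theta 2 q nu i = c `^ (2 * nu - 4) * second_diff_form nu (x / c) (y / c) (z / c) +
   (if nu \is a Num.int then ln c / 2 * \sum_(k1 < 3) \sum_(k2 < 3) bcoef theta 2 q i k1 * bcoef theta 2 q i k2 *
     pdist q (i + theta * k1) (i + theta * k2) ^+ 2 else 0).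
Proof.
move=> x y z hnu x0 y0 z0 yx c0; have [b0 b1 b2] := bcoef2E theta q i.
have e : diag_main theta 2 q nu i = 2 / (x * y) * (- 2 / (x * (y - x))) * gpos nu x +
  2 / (x * y) * (2 / (y * (y - x))) * gpos nu y +
  (- 2 / (x * (y - x))) * (2 / (y * (y - x))) * gpos nu z.
  rewrite /diag_main (sum_lt3 (fun k1 k2 => bcoef theta 2 q i k1 * bcoef theta 2 q i k2 *
      Gfun nu (pdist q (i + theta * k1) (i + theta * k2)))).
  by rewrite b0 b1 b2 muln0 addn0 -/x -/y -/z (Gfun_pos _ x0) (Gfun_pos _ y0) (Gfun_pos _ z0).
have e2 : \sum_(k1 < 3) \sum_(k2 < 3) bcoef theta 2 q i k1 * bcoef theta 2 q i k2 *
     pdist q (i + theta * k1) (i + theta * k2) ^+ 2 = 2 * (2 / (x * y) * (- 2 / (x * (y - x))) * x ^+ 2 +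
  2 / (x * y) * (2 / (y * (y - x))) * y ^+ 2 +
  (- 2 / (x * (y - x))) * (2 / (y * (y - x))) * z ^+ 2).
  rewrite sum_sym_offdiag; last 2 first.
  - by move=> k1 k2; rewrite pdistC; ring.
  - by move=> k; rewrite pdist_self expr0n mulr0.
  rewrite (sum_lt3 (fun k1 k2 => bcoef theta 2 q i k1 * bcoef theta 2 q i k2 *
      pdist q (i + theta * k1) (i + theta * k2) ^+ 2)).
  by rewrite b0 b1 b2 muln0 addn0 -/x -/y -/z.
have g (s : R) : 0 < s -> gpos nu s = c `^ (2 * nu) * gpos nu (s / c) +
   (if nu \is a Num.int then ln c * s ^+ 2 else 0).
  move=> s0; have sc : 0 < s / c by rewrite divr_gt0.
  have -> : gpos nu s = gpos nu (c * (s / c)) by congr gpos; field; rewrite gt_eqF.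
  rewrite gpos_scale//; congr (_ + _); case: ifPn => // hint.
  rewrite (int_lt2 hnu hint) mulr1 !powR_mulrn ?(ltW c0) ?(ltW sc)//.
  by field; rewrite gt_eqF.
rewrite e e2 (g x x0) (g y y0) (g z z0) (powR_subn _ 4 c0) /second_diff_form.
have cn : c != 0 by rewrite gt_eqF.
have xn : x != 0 by rewrite gt_eqF.
have yn : y != 0 by rewrite gt_eqF.
have -> : 2 / (x / c * (y / c)) = c ^+ 2 * (2 / (x * y)) by field; rewrite xn yn.
have -> : y / c - x / c = (y - x) / c by rewrite mulrBl.
have -> : - 2 / (x / c * ((y - x) / c)) = c ^+ 2 * (- 2 / (x * (y - x))) by field; rewrite xn yx.
have -> : 2 / (y / c * ((y - x) / c)) = c ^+ 2 * (2 / (y * (y - x))) by field; rewrite yn yx.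
move: (2 / (x * y)) (- 2 / (x * (y - x))) (2 / (y * (y - x))) (c `^ (2 * nu)) => u v w t.
move: (gpos nu (x / c)) (gpos nu (y / c)) (gpos nu (z / c)) => gx gy gz.
by case: ifP => _; field.
Qed.

End main_term_asymptotics.

Section diag_asymptotics.
Context {R : realType}.
Variables (L : R) (P tau : R -> 'rV[R]_2) (a : R -> R) (M m : R).
Hypothesis HP : regular_path L P tau a M m.
Local Notation p n := (gridpt L P n).
Local Notation mesh := (mesh L).
Local Notation spacing := (spacing L a).

Let m0 : 0 < m. Proof. by case: HP. Qed.
Let M0 : 0 < M. Proof. by case: HP. Qed.
Let mesh0 n : (1 < n)%N -> 0 < mesh n. Proof. exact: (mesh_gt0 HP). Qed.

Lemma window_in theta l n i : (1 <= i <= n - theta * l)%N -> (i + theta * l <= n)%N.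
Proof.
move=> /andP[i1 i2]; rewrite addnC -leq_subRL//.
by apply: ltnW; rewrite -subn_gt0; exact: leq_trans i2.
Qed.

Lemma first_diff_form_cvg nu (eps : R) : 0 < eps -> exists2 eta, 0 < eta & forall X : R,
  `|X - 1| < eta -> `| - (X^-1 ^+ 2 * X `^ (2 * nu)) - (- 1)| <= eps.
Proof.
move=> e0.
have c : - (X^-1 ^+ 2 * X `^ (2 * nu)) @[X --> (1 : R)] --> - ((1 : R)^-1 ^+ 2 * (1 : R) `^ (2 * nu)).
  apply: cvgN; apply: cvgM; last exact: continuous_powR_pos.
  have ci : (X : R)^-1 @[X --> (1 : R)] --> (1 : R)^-1 by apply: cvgV => //; exact: cvg_id.
  by rewrite expr2; under eq_cvg do rewrite expr2; exact: cvgM.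
move: c; rewrite invr1 expr1n powR1 mulr1 => /cvgrPdist_le /(_ _ e0) /nbhs_ballP[eta /= eta0 h].
exists eta => // X hX; rewrite distrC; apply: h.
by rewrite /ball/= distrC.
Qed.

(** The rescaled form is continuous at the limiting chords. For [nu = 1] the extra
    term is of order [ln c], negligible against [c ^ (-2)]. *)
Lemma diag_main_asymp theta l nu : theta \in [:: 1%N; 2%N] -> l \in [:: 1%N; 2%N] ->
  0 < nu < l%:R -> forall eps, 0 < eps -> exists2 d1, 0 < d1 & forall n i, (1 < n)%N ->
  mesh n <= d1 -> (1 <= i <= n - theta * l)%N ->
  `|diag_main theta l (p n) nu i - main_const l nu * spacing theta n i `^ (2 * nu - (2 * l)%:R)| <=
     eps * spacing theta n i `^ (2 * nu - (2 * l)%:R).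
Proof.
move=> hth hl hnu eps eps0.
have th : (0 < theta <= 2)%N by move: hth; rewrite !inE => /orP[] /eqP ->.
pose K := 16 * M / m.
have K0 : 0 < K by rewrite divr_gt0// mulr_gt0.
have small eta n : 0 < eta -> mesh n <= eta / (2 * K) -> 16 * M / m * mesh n < eta.
  move=> eta0 h; apply: (@le_lt_trans _ _ (K * (eta / (2 * K)))); first by rewrite ler_wpM2l// ltW.
  by rewrite (_ : K * _ = eta / 2); [lra|field; rewrite gt_eqF].
have th1 : (1 : R) <= theta%:R by rewrite ler1n; case/andP: th.
have chord_pos n i j : (1 < n)%N -> (1 <= i)%N -> (i < j)%N -> (j <= n)%N -> 0 < pdist (p n) i j.
  move=> n1 i1 ij jn; have [_ _ /andP[h _] _ _] := gridP HP n1 i1 (ltnW ij) jn.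
  by apply: lt_le_trans h; apply: mulr_gt0 => //; apply: mulr_gt0 (mesh0 n1); rewrite ltr0n subn_gt0.
move: hl hnu; rewrite !inE => /orP[] /eqP -> hnu.
  have [eta eta0 heta] := @first_diff_form_cvg nu eps eps0.
  exists (eta / (2 * K)); first by rewrite divr_gt0// mulr_gt0.
  move=> n i n1 hd hi; set c := spacing theta n i; have hin := window_in hi; have /andP[i1 _] := hi.
  have i_n : (1 <= i <= n)%N by rewrite i1 (leq_trans (leq_addr _ _) hin).
  have /andP[cl _] := spacing_bounds HP th n1 i_n.
  have c0 : 0 < c by apply: lt_le_trans cl; exact: mulr_gt0 (mesh0 n1).
  have x0 : 0 < pdist (p n) i (i + theta * 1).
    by apply: chord_pos => //; rewrite -[X in (X < _)%N]addn0 ltn_add2l muln1; case/andP: th.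
  rewrite (diag_main1 hnu x0 c0) /main_const eqxx.
  have [h _] := rel_chord HP th n1 i1.
  have := heta _ (le_lt_trans (h 1%N isT hin) (small _ _ eta0 hd)).
  set X := _ / _; rewrite [- 1 * _]mulrC -mulrBr normrM (ger0_norm (powR_ge0 _ _)) => h1.
  by rewrite [leRHS]mulrC; apply: ler_wpM2l => //; exact: powR_ge0.
have e20 : 0 < eps / 2 by rewrite divr_gt0.
have [eta eta0 heta] := @second_diff_form_cvg _ nu (eps / 2) e20.
have [B [d0 [B0 d00 hB]]] := window_bounds HP hth (isT : 2 \in [:: 1%N; 2%N]).
pose d1 := Num.min (Num.min d0 (eta / (2 * K))) (Num.min (m / (20 * M)) (Num.min (1 / (2 * M)) (eps / (4 * M * B ^+ 2)))).
exists d1.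
  by rewrite /d1 !lt_min d00/=; do ?[apply/andP; split];
   do ?[done|apply: divr_gt0|apply: mulr_gt0|apply: exprn_gt0].
move=> n i n1 hd hi; set c := spacing theta n i; have hin := window_in hi; have /andP[i1 _] := hi.
move: hd; rewrite !le_min => /andP[/andP[hd1 hd2] /and3P[hd3 hd4 hd5]].
have i_n : (1 <= i <= n)%N by rewrite i1 (leq_trans (leq_addr _ _) hin).
have /andP[cl cu] := spacing_bounds HP th n1 i_n; rewrite -/c in cl cu.
have c0 : 0 < c by apply: lt_le_trans cl; exact: mulr_gt0 (mesh0 n1).
have tpos : (0 < theta)%N by case/andP: th.
have x0 : 0 < pdist (p n) i (i + theta * 1).
  apply: chord_pos => //; last by apply: leq_trans hin; rewrite leq_add2l leq_mul2l orbT.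
  by rewrite -[X in (X < _)%N]addn0 ltn_add2l muln1.
have y0 : 0 < pdist (p n) i (i + theta * 2).
  by apply: chord_pos => //; rewrite -[X in (X < _)%N]addn0 ltn_add2l muln_gt0 tpos.
have z0 : 0 < pdist (p n) (i + theta * 1) (i + theta * 2).
  by apply: chord_pos => //; rewrite ?ltn_add2l ?ltn_mul2l ?tpos// addn_gt0 i1.
have yx : pdist (p n) i (i + theta * 2) - pdist (p n) i (i + theta * 1) != 0.
  rewrite gt_eqF//; apply: lt_le_trans (window_gap HP n1 i1 hin th hd3).
  by apply: divr_gt0 => //; exact: mulr_gt0 (mesh0 n1).
rewrite (diag_main2 hnu x0 y0 z0 yx c0) /main_const /=.
have [h h'] := rel_chord HP th n1 i1; have sm := small _ _ eta0 hd2.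
have i1n : (i + theta * 1 <= n)%N by apply: leq_trans hin; rewrite leq_add2l leq_mul2l orbT.
have := heta _ _ _ (le_lt_trans (h 1%N isT i1n) sm) (le_lt_trans (h 2%N isT hin) sm) (le_lt_trans (h' hin) sm).
set F := second_diff_form _ _ _ _ => hF.
set q := c `^ _; have q0 : 0 <= q by exact: powR_ge0.
set Q := (if _ then _ else _).
have -> : q * F + Q - (gpos nu 2 - 4 * gpos nu 1) * q = q * (F - (gpos nu 2 - 4 * gpos nu 1)) + Q by ring.
apply: le_trans (ler_normD _ _) _; rewrite (_ : eps * q = q * (eps / 2) + eps / 2 * q); last by field.
apply: lerD; first by rewrite normrM (ger0_norm q0) ler_wpM2l.
rewrite /Q; case: ifPn => hint; last by rewrite normr0 mulr_ge0// ltW.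
(* the logarithmic term, bounded crudely by [B ^ 2 / c] *)
have hsq := window_sq_dist (hB n i n1 hd1 hi).
rewrite normrM; apply: (@le_trans _ _ (c^-1 / 2 * (2 * B ^+ 2))).
  apply: ler_pM => //; rewrite normrM normfV normr_nat ler_wpM2r//.
  apply: abs_ln_le_inv => //; apply: le_trans cu _.
  by rewrite mulrC -ler_pdivlMr// mulr_gt0.
have -> : q = c^-1 ^+ 2.
  rewrite /q (int_lt2 hnu hint) mulr1 (powR_subn 2 4 c0) powR_mulrn ?(ltW c0)//.
  by field; rewrite gt_eqF.
rewrite (_ : c^-1 / 2 * (2 * B ^+ 2) = (B ^+ 2 * c) * c^-1 ^+ 2); last by field; rewrite gt_eqF.
rewrite ler_wpM2r ?sqr_ge0//; apply: le_trans (ler_wpM2l (sqr_ge0 B) cu) _.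
rewrite (_ : B ^+ 2 * (2 * M * mesh n) = mesh n * (4 * M * B ^+ 2) / 2); last by field.
by rewrite ler_wpM2r// -ler_pdivlMr// !mulr_gt0// exprn_gt0.
Qed.

End diag_asymptotics.

(** * Order of the mean *)

Section sums_of_spacings.
Context {R : realType}.

Lemma powR_small (s eta : R) : 0 < s -> 0 < eta ->
  exists2 d, 0 < d & forall x, 0 <= x <= d -> x `^ s <= eta.
Proof.
move=> s0 eta0; exists (eta `^ s^-1); first exact: powR_gt0.
move=> x /andP[x0 hx]; apply: (@le_trans _ _ ((eta `^ s^-1) `^ s)).
  by apply: ge0_ler_powR => //; rewrite ?nnegrE ?(ltW s0)// ltW// powR_gt0.
by rewrite -powRrM mulVf ?gt_eqF// powRr1// ltW.
Qed.

Lemma ler_powRN (q x y : R) : q <= 0 -> 0 < x -> x <= y -> y `^ q <= x `^ q.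
Proof.
move=> q0 x0 xy; have y0 : 0 < y by exact: lt_le_trans xy.
have e z : z `^ q = (z `^ (- q))^-1 by rewrite -powRN opprK.
rewrite !e lef_pV2 ?posrE ?powR_gt0//; apply: ge0_ler_powR => //; rewrite ?nnegrE ?oppr_ge0 ?(ltW x0) ?(ltW y0)//.
Qed.

Lemma powR_divn (x y q : R) : 0 <= x -> 0 < y -> (x / y) `^ q = x `^ q * y `^ (- q).
Proof.
move=> x0 y0; rewrite powRM ?invr_ge0 ?(ltW y0)//; congr (_ * _).
by rewrite -powR_inv1 ?(ltW y0)// -powRrM mulN1r.
Qed.

Variables (L : R) (P tau : R -> 'rV[R]_2) (a : R -> R) (M m : R).
Hypothesis HP : regular_path L P tau a M m.
Local Notation p n := (gridpt L P n).
Local Notation mesh := (mesh L).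
Local Notation spacing := (spacing L a).

Let L0 : 0 < L. Proof. by case: HP. Qed.
Let m0 : 0 < m. Proof. by case: HP. Qed.
Let M0 : 0 < M. Proof. by case: HP. Qed.
Let mesh0 n : (1 < n)%N -> 0 < mesh n. Proof. exact: (mesh_gt0 HP). Qed.

Lemma mesh_bounds n : (1 < n)%N -> L / n%:R <= mesh n <= 2 * L / n%:R.
Proof.
move=> n1; have n0 : (0 : R) < n%:R by rewrite ltr0n (ltn_trans _ n1).
have n1' : (0 : R) < n%:R - 1 by rewrite subr_gt0 ltr1n.
have n2 : (2 : R) <= n%:R by rewrite ler_nat.
have -> : mesh n = L / (n%:R - 1) by [].
apply/andP; split.
  by rewrite ler_pM2l// lef_pV2 ?posrE// gerBl.
rewrite ler_pdivlMr// mulrAC ler_pdivrMr// -mulrA mulrCA ler_pM2l//; lra.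
Qed.

Lemma near_mesh d : 0 < d -> \forall n \near \oo, (1 < n)%N /\ mesh n <= d.
Proof.
move=> d0; near=> n.
have n1 : (1 < n)%N by near: n; exact: nbhs_infty_gt.
split=> //; have /andP[_ h] := mesh_bounds n1; apply: le_trans h _.
rewrite ler_pdivrMr ?ltr0n ?(ltn_trans _ n1)// -ler_pdivrMl//.
near: n; exact: nbhs_infty_ger.
Unshelve. all: end_near. Qed.

Definition spacing_sum theta l q n := \sum_(1 <= i < (n - theta * l).+1) spacing theta n i `^ q.

Lemma window_in_n theta l n i : (1 <= i < (n - theta * l).+1)%N -> (1 <= i <= n)%N.
Proof. by move=> /andP[-> h]/=; rewrite ltnS in h; exact: leq_trans h (leq_subr _ _). Qed.

Lemma spacing_powR_bounds theta n i q : (0 < theta <= 2)%N -> (1 < n)%N -> (1 <= i <= n)%N -> q <= 0 ->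
  (4 * M * L) `^ q * n%:R `^ (- q) <= spacing theta n i `^ q <= (m * L) `^ q * n%:R `^ (- q).
Proof.
move=> th n1 hi q0; have /andP[h1 h2] := spacing_bounds HP th n1 hi.
have n0 : (0 : R) < n%:R by rewrite ltr0n (ltn_trans _ n1).
have /andP[d1 d2] := mesh_bounds n1.
rewrite -!powR_divn//; last 2 first.
- by apply: mulr_ge0; exact: ltW.
- by apply: mulr_ge0 (ltW L0); apply: mulr_ge0 (ltW M0).
have c0 : 0 < spacing theta n i by apply: lt_le_trans h1; exact: mulr_gt0 (mesh0 n1).
apply/andP; split; apply: ler_powRN => //.
  apply: le_trans h2 _; rewrite (_ : 4 * M * L / n%:R = 2 * M * (2 * L / n%:R)); last by field; rewrite gt_eqF.
  by apply: ler_wpM2l => //; apply: mulr_ge0 (ltW M0).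
  by apply: divr_gt0 => //; exact: mulr_gt0.
by apply: le_trans h1; rewrite -mulrA; apply: ler_wpM2l => //; exact: ltW.
Qed.

(** There are between [n / 2] and [n] windows, with spacings comparable to
    [1 / n]. *)
Lemma spacing_sum_bounds theta l q : theta \in [:: 1%N; 2%N] -> l \in [:: 1%N; 2%N] -> q <= 0 ->
  exists K1 K2, [/\ 0 < K1, 0 < K2 & forall n, (8 <= n)%N ->
    K1 * n%:R `^ (1 - q) <= spacing_sum theta l q n <= K2 * n%:R `^ (1 - q)].
Proof.
move=> hth hl q0.
have th : (0 < theta <= 2)%N by move: hth; rewrite !inE => /orP[] /eqP ->.
have l2 : (0 < l <= 2)%N by move: hl; rewrite !inE => /orP[] /eqP ->.
exists ((4 * M * L) `^ q / 2), ((m * L) `^ q); split.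
- by rewrite divr_gt0// powR_gt0//; apply: mulr_gt0 => //; exact: mulr_gt0.
- by rewrite powR_gt0//; exact: mulr_gt0.
move=> n n8; have n1 : (1 < n)%N by apply: leq_trans n8.
have n0 : (0 : R) < n%:R by rewrite ltr0n (ltn_trans _ n1).
have tl4 : (theta * l <= 4)%N by case/andP: th => _ ?; case/andP: l2 => _ ?; exact: (@leq_mul _ _ 2 2).
have -> : (n%:R : R) `^ (1 - q) = n%:R * n%:R `^ (- q).
  by rewrite powRD ?powRr1 ?(ltW n0)// (gt_eqF n0) implybT.
have B i : (1 <= i < (n - theta * l).+1)%N -> _ := fun hi => spacing_powR_bounds th n1 (window_in_n hi) q0.
have cst (c : R) : \sum_(1 <= i < (n - theta * l).+1) c = (n - theta * l)%:R * c.
  by rewrite big_const_nat iter_addr addr0 subSS subn0 mulr_natl.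
apply/andP; split.
  apply: (@le_trans _ _ (\sum_(1 <= i < (n - theta * l).+1) (4 * M * L) `^ q * n%:R `^ (- q))).
    rewrite cst [leLHS](_ : _ = n%:R / 2 * ((4 * M * L) `^ q * n%:R `^ (- q))); last by field.
    apply: ler_wpM2r; first by apply: mulr_ge0; exact: powR_ge0.
    by rewrite ler_pdivrMr// -natrM ler_nat; lia.
  by rewrite /spacing_sum !big_nat; apply: ler_sum => i /B /andP[].
apply: (@le_trans _ _ (\sum_(1 <= i < (n - theta * l).+1) (m * L) `^ q * n%:R `^ (- q))).
  by rewrite /spacing_sum !big_nat; apply: ler_sum => i /B /andP[].
rewrite cst mulrCA ler_wpM2l ?powR_ge0// ler_wpM2r ?powR_ge0// ler_nat leq_subr//.
Qed.

End sums_of_spacings.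

Section diag_covariance.
Context {R : realType}.
Variables (L : R) (P tau : R -> 'rV[R]_2) (a : R -> R) (M m : R).
Hypothesis HP : regular_path L P tau a M m.
Local Notation p n := (gridpt L P n).
Local Notation mesh := (mesh L).
Local Notation spacing := (spacing L a).
Variables (theta l : nat) (nu : R) (beta : nat -> R) (bs : R) (Kt : 'rV[R]_2 -> R).
Hypothesis hth : theta \in [:: 1%N; 2%N].
Hypothesis hl : l \in [:: 1%N; 2%N].
Hypothesis hnu : 0 < nu < l%:R.
Hypothesis hcov : covariance_form nu beta bs Kt.

Let m0 : 0 < m. Proof. by case: HP. Qed.
Let M0 : 0 < M. Proof. by case: HP. Qed.
Let mesh0 n : (1 < n)%N -> 0 < mesh n. Proof. exact: (mesh_gt0 HP). Qed.
Let th : (0 < theta <= 2)%N. Proof. by move: hth; rewrite !inE => /orP[] /eqP ->. Qed.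
Local Notation q := (2 * nu - (2 * l)%:R).
Local Notation inw n i := ((1 <= i <= n - theta * l)%N).

Let q0 : q < 0.
Proof. by rewrite natrM; case/andP: hnu => _ h; rewrite -mulrBr pmulr_rlt0// subr_lt0. Qed.

Lemma near_window : exists2 B, 0 < B & \forall n \near \oo, forall i, inw n i ->
  window_ok theta l B (p n) (mesh n) i.
Proof.
have [B [d0 [B0 d00 hB]]] := window_bounds HP hth hl; exists B => //.
near=> n; have [n1 hd] : (1 < n)%N /\ mesh n <= d0 by near: n; exact: (near_mesh HP).
by move=> i; exact: hB.
Unshelve. all: end_near. Qed.

Lemma near_diag_main eps : 0 < eps -> \forall n \near \oo, forall i, inw n i ->
  `|diag_main theta l (p n) nu i - main_const l nu * spacing theta n i `^ q| <= eps * spacing theta n i `^ q.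
Proof.
move=> e0; have [d1 d10 h] := diag_main_asymp HP hth hl hnu e0.
near=> n; have [n1 hd] : (1 < n)%N /\ mesh n <= d1 by near: n; exact: (near_mesh HP).
by move=> i; exact: h.
Unshelve. all: end_near. Qed.

(** Both error terms of [diag_expansion] are negligible against the power
    [2 * nu - 2 * l] of the mesh: the constant because this exponent is negative,
    the other one because of the additional [tau]. *)
Lemma near_diag_cov eps : 0 < eps -> \forall n \near \oo, forall i, inw n i ->
  `|nabla_cov Kt theta l (p n) i i - 2 * bs * main_const l nu * spacing theta n i `^ q| <= eps * spacing theta n i `^ q.
Proof.
move=> e0; have [t t0 hE] := diag_expansion hl hnu hcov.
have [B B0 hB] := near_window.
have [C [d0 [C0 d00 hC]]] := hE B B0.
have eta0 : 0 < eps / (4 * (1 + `|2 * bs|)) by rewrite divr_gt0// mulr_gt0// ltr_wpDr.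
set eta := eps / _ in eta0.
have K0 : 0 < (2 * M) `^ q by rewrite powR_gt0// mulr_gt0.
have z0 : 0 < eps / 4 * (2 * M) `^ q / C by rewrite !divr_gt0// mulr_gt0// divr_gt0.
have [d1 d10 h1] := powR_small t0 z0.
have nq0 : 0 < - q by rewrite oppr_gt0.
have [d2 d20 h2] := powR_small nq0 z0.
have dm0 : 0 < Num.min d0 (Num.min d1 d2) by rewrite !lt_min d00 d10 d20.
near=> n; have [n1 hd] : (1 < n)%N /\ mesh n <= Num.min d0 (Num.min d1 d2) by near: n; exact: (near_mesh HP).
move: hd; rewrite !le_min => /and3P[hd0 hd1 hd2].
move=> i hi; have dl0 := mesh0 n1.
have W : window_ok theta l B (p n) (mesh n) i by move: i hi; near: n.
have hD : `|diag_main theta l (p n) nu i - main_const l nu * spacing theta n i `^ q| <= eta * spacing theta n i `^ q.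
  by move: (i) (hi); near: n; exact: near_diag_main.
have i_n : (1 <= i <= n)%N by exact: (@window_in_n theta l).
have /andP[cl cu] := spacing_bounds HP th n1 i_n.
set c := spacing theta n i in cl cu hD *.
have c0 : 0 < c by apply: lt_le_trans cl; exact: mulr_gt0.
have cq : (2 * M) `^ q * mesh n `^ q <= c `^ q.
  rewrite -powRM ?(ltW dl0)//; last by rewrite mulr_ge0// ltW.
  by apply: ler_powRN => //; exact: ltW.
have := hC theta (p n) (mesh n) i; rewrite dl0 hd0 => /(_ isT W) hr.
set X := nabla_cov _ _ _ _ _ _ in hr *; set D := diag_main _ _ _ _ _ in hr hD.
have -> : X - 2 * bs * main_const l nu * c `^ q = (X - 2 * bs * D) + 2 * bs * (D - main_const l nu * c `^ q) by ring.
apply: le_trans (ler_normD _ _) _.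
have -> : eps * c `^ q = eps / 2 * c `^ q + eps / 2 * c `^ q by field.
apply: lerD.
  apply: le_trans hr _.
  have dq0 : 0 < mesh n `^ q by rewrite powR_gt0.
  have e1 : 1 = mesh n `^ (- q) * mesh n `^ q by rewrite powRN mulVf// gt_eqF.
  have e2 : mesh n `^ (2 * nu + t) / mesh n ^+ (2 * l) = mesh n `^ t * mesh n `^ q.
    rewrite -powR_subn// -powRD ?(gt_eqF dl0) ?implybT//; congr (_ `^ _); ring.
  have k1 : mesh n `^ t <= eps / 4 * (2 * M) `^ q / C by apply: h1; rewrite (ltW dl0).
  have k2 : mesh n `^ (- q) <= eps / 4 * (2 * M) `^ q / C by apply: h2; rewrite (ltW dl0).
  rewrite e2 [X in C * (X + _)]e1 -mulrDl.
  apply: (@le_trans _ _ (eps / 2 * ((2 * M) `^ q * mesh n `^ q))); last first.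
    by apply: ler_wpM2l cq; rewrite divr_ge0// ltW.
  rewrite !mulrA; apply: ler_wpM2r; first exact: ltW.
  rewrite -mulrA mulrC -ler_pdivlMr//.
  apply: le_trans (lerD k2 k1) _.
  by rewrite le_eqVlt; apply/orP; left; apply/eqP; field; rewrite gt_eqF.
rewrite normrM; apply: le_trans (ler_wpM2l (normr_ge0 _) hD) _.
rewrite mulrA; apply: ler_wpM2r; first exact: powR_ge0.
rewrite /eta mulrA ler_pdivrMr; last by rewrite mulr_gt0// ltr_wpDr.
by have := normr_ge0 (2 * bs); nra.
Unshelve. all: end_near. Qed.

Lemma near_sum_close (S : nat -> nat -> R) (k : R) :
  (forall eps, 0 < eps -> \forall n \near \oo, forall i, inw n i ->
     `|S n i - k * spacing theta n i `^ q| <= eps * spacing theta n i `^ q) ->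
  forall eps, 0 < eps -> \forall n \near \oo,
   `|\sum_(1 <= i < (n - theta * l).+1) S n i - k * spacing_sum L a theta l q n| <= eps * spacing_sum L a theta l q n.
Proof.
move=> h eps e0; near=> n.
have hn : forall i, inw n i -> `|S n i - k * spacing theta n i `^ q| <= eps * spacing theta n i `^ q by near: n; exact: h.
rewrite /spacing_sum !mulr_sumr -sumrB; apply: le_trans (ler_norm_sum _ _ _) _.
by rewrite !big_nat; apply: ler_sum => i; rewrite ltnS; exact: hn.
Unshelve. all: end_near. Qed.

End diag_covariance.

Section main_term_conclusions.
Context {R : realType}.
Variables (EV ft T g : nat -> R) (k K1 K2 : R).
Hypothesis k_neq0 : k != 0.
Hypothesis K10 : 0 < K1.
Hypothesis EV_ge0 : \forall n \near \oo, 0 <= EV n.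
Hypothesis g_gt0 : \forall n \near \oo, 0 < g n.
Hypothesis Tg : \forall n \near \oo, K1 * g n <= T n <= K2 * g n.
Hypothesis ftT : forall eps, 0 < eps -> \forall n \near \oo, `|ft n - k * T n| <= eps * T n.
Hypothesis EVT : forall eps, 0 < eps -> \forall n \near \oo, `|EV n - k * T n| <= eps * T n.

(** The sign of the constant is read off from the nonnegative sequence. *)
Lemma main_const_gt0 : 0 < k.
Proof.
rewrite lt_neqAle eq_sym k_neq0/= leNgt; apply/negP => kn.
have e0 : 0 < - k / 2 by rewrite divr_gt0// oppr_gt0.
near \oo => n.
have h1 : 0 <= EV n by near: n.
have g0 : 0 < g n by near: n.
have /andP[h2 _] : K1 * g n <= T n <= K2 * g n by near: n.
have h3 : `|EV n - k * T n| <= - k / 2 * T n by near: n; exact: EVT.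
have T0 : 0 < T n by apply: lt_le_trans h2; rewrite mulr_gt0.
by move: h3; rewrite ler_distl => /andP[_ h3]; nra.
Unshelve. all: end_near. Qed.

Lemma near_main_lower : \forall n \near \oo, k / 2 * K1 * g n <= EV n.
Proof.
have k0 := main_const_gt0; have e0 : 0 < k / 2 by rewrite divr_gt0.
near=> n.
have /andP[h2 _] : K1 * g n <= T n <= K2 * g n by near: n.
have h3 : `|EV n - k * T n| <= k / 2 * T n by near: n; exact: EVT.
have := ler_wpM2l (ltW e0) h2.
by move: h3; rewrite ler_distl => /andP[h3 _]; lra.
Unshelve. all: end_near. Qed.

Lemma asymp_equiv_main : asymp_equiv EV ft.
Proof.
have k0 := main_const_gt0.
apply/cvgrPdist_le => eps eps0.
pose e := Num.min (k / 2) (eps * k / 4).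
have e0 : 0 < e by rewrite lt_min !divr_gt0// mulr_gt0.
near=> n.
have g0 : 0 < g n by near: n.
have /andP[h2 _] : K1 * g n <= T n <= K2 * g n by near: n.
have T0 : 0 < T n by apply: lt_le_trans h2; rewrite mulr_gt0.
have h3 : `|EV n - k * T n| <= e * T n by near: n; exact: EVT.
have h4 : `|ft n - k * T n| <= e * T n by near: n; exact: ftT.
have e1 : e * T n <= k / 2 * T n by rewrite ler_pM2r// /e ge_min lexx.
have e2 : e * T n <= eps * k / 4 * T n by rewrite ler_pM2r// /e ge_min lexx orbT.
have f0 : k / 2 * T n <= ft n by move: h4; rewrite ler_distl => /andP[h4 _]; lra.
have kT : 0 < k / 2 * T n by rewrite mulr_gt0// divr_gt0.
have f1 : 0 < ft n by exact: lt_le_trans f0.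
have -> : 1 - EV n / ft n = (ft n - EV n) / ft n by field; rewrite gt_eqF.
rewrite normrM normfV (gtr0_norm f1) ler_pdivrMr//.
have -> : ft n - EV n = (ft n - k * T n) - (EV n - k * T n) by ring.
apply: le_trans (ler_normB _ _) _; apply: le_trans (lerD h4 h3) _.
apply: le_trans (_ : eps * (k / 2 * T n) <= _); first by lra.
by rewrite ler_pM2l.
Unshelve. all: end_near. Qed.

Lemma same_order_main : same_order ft g.
Proof.
have k0 := main_const_gt0; have e0 : 0 < k / 2 by rewrite divr_gt0.
have B : \forall n \near \oo, k / 2 * K1 <= ft n / g n <= 2 * k * K2.
  near=> n.
  have g0 : 0 < g n by near: n.
  have /andP[h2 h5] : K1 * g n <= T n <= K2 * g n by near: n.
  have h4 : `|ft n - k * T n| <= k / 2 * T n by near: n; exact: ftT.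
  rewrite ler_pdivlMr// ler_pdivrMr//.
  have := ler_wpM2l (ltW e0) h2; have := ler_wpM2l (ltW k0) h5.
  have T0 : 0 < T n by apply: lt_le_trans h2; rewrite mulr_gt0.
  by move: h4; rewrite ler_distl => /andP[h4 h6]; move=> *; apply/andP; split; nra.
have [N _ hN] := B.
split; last 1 first.
- apply: (@le_lt_trans _ _ (2 * k * K2)%:E); last by rewrite ltry.
  rewrite limn_esup_lim; apply: lime_le; first exact: is_cvg_esups.
  exists N => // n /= Nn; apply: ge_ereal_sup => _ [j /= nj <-].
  by rewrite lee_fin; have /andP[] := hN j (leq_trans Nn nj).
- apply: (@lt_le_trans _ _ (k / 2 * K1)%:E); first by rewrite lte_fin mulr_gt0.
  rewrite limn_einf_lim; apply: lime_ge; first exact: is_cvg_einfs.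
  exists N => // n /= Nn; apply: le_ereal_inf_tmp => _ [j /= nj <-].
  by rewrite lee_fin; have /andP[] := hN j (leq_trans Nn nj).
- exact: limn_einf_sup.
Unshelve. all: end_near. Qed.

End main_term_conclusions.

(** * Partial derivatives *)

Section partial_calculus.
Context {R : realType}.
Implicit Types (f : 'rV[R]_2 -> R) (x y v w : 'rV[R]_2) (U : set 'rV[R]_2).
Local Notation e1 := (delta_mx 0 ord0 : 'rV[R]_2).
Local Notation e2 := (delta_mx 0 ord_max : 'rV[R]_2).

(** Differentiability without difference quotients, so that no case distinction
    at a zero increment is needed. *)
Lemma is_deriveP (V : normedModType R) (F : V -> R) (x v : V) (d : R) : is_derive x v F d <->
  forall e, 0 < e -> exists2 r, 0 < r & forall h : R, `|h| < r -> `|F (h *: v + x) - F x - h * d| <= e * `|h|.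
Proof.
split=> [[dF dv]|H].
  move=> e e0; have : (fun h => h^-1 *: ((F \o shift x) (h *: v) - F x)) @ 0^' --> d.
    by rewrite -dv; exact: dF.
  move=> /cvgrPdist_le /(_ _ e0) [r /= r0 hr]; exists r => // h hh.
  have [->|h0] := eqVneq h 0; first by rewrite scale0r add0r subrr mul0r subrr normr0 mulr0.
  have := hr h; rewrite /= sub0r normrN => /(_ hh h0).
  rewrite /shift/=; set D := F _ - F x => hd.
  have -> : D - h * d = - (h * (d - h^-1 *: D)).
    by rewrite /GRing.scale/=; field.
  by rewrite normrN normrM mulrC ler_wpM2r.
have c : (fun h => h^-1 *: ((F \o shift x) (h *: v) - F x)) @ 0^' --> d.
  apply/cvgrPdist_le => e e0; have [r r0 hr] := H e e0.
  exists r => //= h; rewrite /ball_/= sub0r normrN => hh h0.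
  have := hr h hh; rewrite /shift/=; set D := F _ - F x => hd.
  have -> : d - h^-1 *: D = - (h^-1 * (D - h * d)) by rewrite /GRing.scale/=; field.
  by rewrite normrN normrM normfV mulrC ler_pdivrMr ?normr_gt0.
split; first by apply/cvg_ex; exists d.
exact: cvg_lim.
Qed.

Lemma is_derive_line (V : normedModType R) (F : V -> R) (x v : V) (s d : R) :
  is_derive (s *: v + x) v F d -> is_derive s 1 (fun t => F (t *: v + x)) d.
Proof.
move=> /is_deriveP H; apply/(@is_deriveP R^o) => e /H[r r0 hr]; exists r => // h /hr.
by rewrite addrA -scalerDl /GRing.scale/= mulr1.
Qed.

Definition near_box (r : R) x y := forall j, `|y 0 j - x 0 j| < r.

Lemma open_box U x : open U -> U x -> exists2 r, 0 < r & forall y, near_box r x y -> U y.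
Proof.
move=> oU Ux; have : nbhs x U by exact: open_nbhs_nbhs.
move=> /nbhs_ballP[r /= r0 hr]; exists r => // y hy; apply: hr.
split=> // i j; rewrite ord1 /ball/= distrC; exact: hy.
Qed.

Lemma continuous_box f x : {for x, continuous f} <->
  forall e, 0 < e -> exists2 r, 0 < r & forall y, near_box r x y -> `|f y - f x| <= e.
Proof.
split=> [cf e e0|H].
  move: cf => /cvgrPdist_le /(_ _ e0) /nbhs_ballP[r /= r0 hr]; exists r => // y hy.
  rewrite distrC; apply: hr; split=> // i j; rewrite ord1 /ball/= distrC; exact: hy.
apply/(@cvgrPdist_le _ _ _ (nbhs x)) => e e0; have [r r0 hr] := H e e0.
apply/nbhs_ballP; exists r => // y hy; rewrite distrC; apply: hr => j.
by have [_ /(_ 0 j)] := hy; rewrite /ball/= distrC.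
Qed.

Lemma near_box_sub r r' x y : r <= r' -> near_box r x y -> near_box r' x y.
Proof. by move=> rr h j; apply: lt_le_trans rr. Qed.

Lemma row2E w : w = w 0 ord0 *: e1 + w 0 ord_max *: e2.
Proof.
apply/rowP => j; rewrite !mxE/=.
by case: j => -[|[|//]] i; rewrite ?mulr1 ?mulr0 ?addr0 ?add0r; congr (w _ _); apply/val_inj.
Qed.

Lemma near_box_axes r x (s t : R) : `|s| < r -> `|t| < r -> near_box r x (t *: e2 + (s *: e1 + x)).
Proof.
move=> hs ht j; rewrite !mxE addrA addrK.
by case: j => -[|[|//]] i; rewrite /= ?mulr1 ?mulr0 ?addr0 ?add0r.
Qed.

Lemma near_box_axis1 r x (s : R) : `|s| < r -> near_box r x (s *: e1 + x).
Proof.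
move=> hs; have := @near_box_axes r x s 0 hs; rewrite normr0 scale0r add0r; apply.
exact: le_lt_trans hs.
Qed.

Lemma near_box_axis2 r x (t : R) : `|t| < r -> near_box r x (t *: e2 + x).
Proof.
move=> ht; have := @near_box_axes r x 0 t; rewrite normr0 scale0r add0r; apply=> //.
exact: le_lt_trans ht.
Qed.

Lemma mean_value0 (F F1 : R -> R) (t : R) : (forall s : R, `|s| <= `|t| -> is_derive s 1 F (F1 s)) ->
  exists2 c, `|c| <= `|t| & F t - F 0 = t * F1 c.
Proof.
move=> H; have [|||c [h1 _ _ ->]] := @mean_value R F F1 (- `|t|) `|t| 0 t.
- by move=> s; rewrite -ler_norml; exact: H.
- by rewrite oppr_le0 normr_ge0.
- by rewrite -ler_norml.
by exists c; [rewrite ler_norml|rewrite subr0 mulrC].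
Qed.

(** Partial derivatives that are nearly constant on a box control the increment
    in all directions: move along one axis at a time. *)
Lemma increment_box f f1 f2 x (r e c1 c2 : R) :
  (forall y, near_box r x y -> is_derive y e1 f (f1 y) /\ is_derive y e2 f (f2 y)) ->
  (forall y, near_box r x y -> `|f1 y - c1| <= e /\ `|f2 y - c2| <= e) ->
  forall w, near_box r 0 w ->
    `|f (w + x) - f x - (w 0 ord0 * c1 + w 0 ord_max * c2)| <= e * (`|w 0 ord0| + `|w 0 ord_max|).
Proof.
move=> df df' w hw.
have [w1 w2] : `|w 0 ord0| < r /\ `|w 0 ord_max| < r.
  by split; [have := hw ord0|have := hw ord_max]; rewrite !mxE subr0.
move: (row2E w) w1 w2; set a := w 0 ord0; set b := w 0 ord_max => -> ha hb.
have [|c hc e1E] := @mean_value0 (fun t => f (t *: e1 + x)) (fun t => f1 (t *: e1 + x)) a.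
  move=> s hs; apply: is_derive_line; apply: (df _ _).1; apply: near_box_axis1.
  exact: le_lt_trans ha.
have [|c' hc' e2E] := @mean_value0 (fun t => f (t *: e2 + (a *: e1 + x))) (fun t => f2 (t *: e2 + (a *: e1 + x))) b.
  move=> s hs; apply: is_derive_line; apply: (df _ _).2; apply: near_box_axes => //.
  exact: le_lt_trans hb.
rewrite /= scale0r add0r in e1E; rewrite /= scale0r add0r in e2E.
have -> : a *: e1 + b *: e2 + x = b *: e2 + (a *: e1 + x) by rewrite addrA (addrC (a *: e1)).
set X := f (b *: _ + _) in e2E *; set Y := f (a *: _ + _) in e1E e2E.
have -> : X - f x - (a * c1 + b * c2) = (X - Y - b * c2) + (Y - f x - a * c1) by ring.
rewrite e2E e1E -!mulrBr; apply: le_trans (ler_normD _ _) _; rewrite !normrM addrC mulrDr.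
apply: lerD; rewrite mulrC ler_wpM2r//.
  by apply: (df' _ _).1; apply: near_box_axis1; exact: le_lt_trans ha.
by apply: (df' _ _).2; apply: near_box_axes => //; exact: le_lt_trans hb.
Qed.

Lemma common_radius U x f1 f2 (e : R) : open U -> U x -> 0 < e ->
  {for x, continuous f1} -> {for x, continuous f2} ->
  exists2 r, 0 < r & forall y, near_box r x y -> [/\ U y, `|f1 y - f1 x| <= e & `|f2 y - f2 x| <= e].
Proof.
move=> oU Ux e0 c1 c2; have [r0 r00 h0] := open_box oU Ux.
have [r1 r10 h1] := (continuous_box _ _).1 c1 e e0; have [r2 r20 h2] := (continuous_box _ _).1 c2 e e0.
exists (Num.min r0 (Num.min r1 r2)); first by rewrite !lt_min r00 r10 r20.
by move=> y hy; split; [apply: h0|apply: h1|apply: h2]; apply: near_box_sub hy;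
  rewrite !ge_min lexx ?orbT.
Qed.

Lemma continuous_of_partials U f f1 f2 x : open U -> U x ->
  (forall y, U y -> is_derive y e1 f (f1 y) /\ is_derive y e2 f (f2 y)) ->
  {for x, continuous f1} -> {for x, continuous f2} -> {for x, continuous f}.
Proof.
move=> oU Ux df c1 c2; have [r r0 hr] := common_radius oU Ux ltr01 c1 c2.
apply/continuous_box => e e0.
pose K := `|f1 x| + `|f2 x| + 2; have K0 : 0 < K by rewrite ltr_wpDl// addr_ge0.
exists (Num.min r (e / K)); first by rewrite lt_min r0 divr_gt0.
move=> y hy; pose w := y - x.
have hw : near_box (Num.min r (e / K)) 0 w by move=> j; rewrite !mxE subr0; exact: hy.
have := @increment_box f f1 f2 x r 1 (f1 x) (f2 x) _ _ w.
rewrite subrK mul1r => h.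
have {h} : `|f y - f x - (w 0 ord0 * f1 x + w 0 ord_max * f2 x)| <= `|w 0 ord0| + `|w 0 ord_max|.
  apply: h.
  - by move=> z /hr[Uz _ _]; exact: df.
  - by move=> z /hr[].
  - by apply: near_box_sub hw; rewrite ge_min lexx.
have := hw ord_max; have := hw ord0; rewrite !mxE !subr0 !lt_min => /andP[_ h1] /andP[_ h2].
move: h1 h2; set a := y 0 ord0 - _; set b := y 0 ord_max - _ => h1 h2 h3.
have -> : f y - f x = (f y - f x - (a * f1 x + b * f2 x)) + (a * f1 x + b * f2 x) by ring.
apply: le_trans (ler_normD _ _) _; apply: le_trans (lerD h3 (ler_normD _ _)) _; rewrite !normrM.
have -> : e = e / K * K by field; rewrite gt_eqF.
set z := e / K in h1 h2 *; have z0 : 0 <= z by rewrite divr_ge0// ltW.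
have k1 : `|a| * `|f1 x| <= z * `|f1 x| by rewrite ler_wpM2r// ltW.
have k2 : `|b| * `|f2 x| <= z * `|f2 x| by rewrite ler_wpM2r// ltW.
rewrite /K; move: k1 k2 h1 h2; lra.
Qed.

Lemma derive_of_partials U f f1 f2 x v : open U -> U x ->
  (forall y, U y -> is_derive y e1 f (f1 y) /\ is_derive y e2 f (f2 y)) ->
  {for x, continuous f1} -> {for x, continuous f2} ->
  is_derive x v f (v 0 ord0 * f1 x + v 0 ord_max * f2 x).
Proof.
move=> oU Ux df c1 c2; apply/is_deriveP => e e0.
pose K := `|v 0 ord0| + `|v 0 ord_max| + 1; have K0 : 0 < K by rewrite ltr_wpDl// addr_ge0.
have z0 : 0 < e / K by rewrite divr_gt0.
have [r r0 hr] := common_radius oU Ux z0 c1 c2.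
exists (r / K); first by rewrite divr_gt0.
move=> h; rewrite ltr_pdivlMr// => hh.
have := @increment_box f f1 f2 x r (e / K) (f1 x) (f2 x) _ _ (h *: v).
rewrite !mxE !normrM -!mulrA -mulrDr => H; apply: le_trans (H _ _ _) _.
- by move=> z /hr[Uz _ _]; exact: df.
- by move=> z /hr[].
- move=> j; rewrite !mxE subr0 normrM; apply: le_lt_trans hh; apply: ler_wpM2l => //.
  rewrite /K; have := normr_ge0 (v 0 ord0); have := normr_ge0 (v 0 ord_max).
  case: j => -[|[|//]] i ? ?.
    by rewrite (_ : Ordinal i = ord0); [lra|apply/val_inj].
  by rewrite (_ : Ordinal i = ord_max); [lra|apply/val_inj].
rewrite -mulrDr ler_pM2l// mulrC ler_pdivrMr// ler_wpM2l// /K; lra.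
Qed.

(** The symmetry of mixed derivatives in the form of Peano: the derivative in the
    other order is shown to exist. The second difference over a rectangle with sides
    [h] and [k] is [h * k] times a value of [f12], by two applications of the mean
    value theorem; then let [h] tend to zero with [k] fixed. *)
Lemma mixed_derivative U f f1 f2 f12 x : open U -> U x ->
  (forall y, U y -> [/\ is_derive y e1 f (f1 y), is_derive y e2 f (f2 y) & is_derive y e1 f2 (f12 y)]) ->
  {for x, continuous f12} -> is_derive x e2 f1 (f12 x).
Proof.
move=> oU Ux df c12; apply/is_deriveP => e e0.
have [r r0 hr] := common_radius oU Ux e0 c12 c12.
exists r => // k hk.
have Uk : U (k *: e2 + x) by have [] := hr _ (near_box_axis2 x hk).
have [d1 _ _] := df _ Uk; have [d2 _ _] := df _ Ux.
apply/ler_addgt0Pr => eta eta0; have eta2 : 0 < eta / 2 by rewrite divr_gt0.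
have [ra ra0 ha] := (is_deriveP _ _ _ _).1 d1 _ eta2.
have [rb rb0 hb] := (is_deriveP _ _ _ _).1 d2 _ eta2.
pose h := Num.min r (Num.min ra rb) / 2.
have m0 : 0 < Num.min r (Num.min ra rb) by rewrite !lt_min r0 ra0 rb0.
have h0 : 0 < h by rewrite divr_gt0.
have : h < Num.min r (Num.min ra rb) by rewrite /h; lra.
rewrite !lt_min -{1 2 3}(gtr0_norm h0) => /and3P[hr1 hra hrb].
clearbody h.
have {ha}A := ha h hra; have {hb}B := hb h hrb.
have [|c hc E] := @mean_value0 (fun t => f (t *: e2 + (h *: e1 + x)) - f (t *: e2 + x))
    (fun t => f2 (t *: e2 + (h *: e1 + x)) - f2 (t *: e2 + x)) k.
  move=> s hs; have sr := le_lt_trans hs hk.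
  have [Us _ _] := hr _ (near_box_axes x hr1 sr); have [Us' _ _] := hr _ (near_box_axis2 x sr).
  by apply: is_deriveB; apply: is_derive_line; [have [] := df _ Us|have [] := df _ Us'].
have cr := le_lt_trans hc hk.
have [|c' hc' E'] := @mean_value0 (fun t => f2 (t *: e1 + (c *: e2 + x))) (fun t => f12 (t *: e1 + (c *: e2 + x))) h.
  move=> s hs; apply: is_derive_line; have sr := le_lt_trans hs hr1.
  rewrite addrCA; have [Us _ _] := hr _ (near_box_axes x sr cr).
  by have [] := df _ Us.
have [_ F _] := hr _ (near_box_axes x (le_lt_trans hc' hr1) cr).
rewrite /= !scale0r !add0r in E; rewrite /= scale0r add0r in E'.
rewrite (addrCA (h *: e1)) in A; rewrite (addrCA (h *: e1)) in E'; rewrite (addrCA (c' *: e1)) in E'; rewrite E' in E.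
set X := f12 (c *: e2 + _) in E F; set Q := f12 x in F *.
set p := f (k *: e2 + (h *: e1 + x)) in E A; set p2 := f (k *: e2 + x) in E A.
set p1 := f (h *: e1 + x) in E B; set p0 := f x in E B.
set g := f1 (k *: e2 + x) in A *; set g0 := f1 x in B *.
rewrite -(ler_pM2l h0) -{1}(gtr0_norm h0) -normrM.
have -> : h * (g - g0 - k * Q) = (p1 - p0 - h * g0) - (p - p2 - h * g) + h * (k * (X - Q)).
  by have : p - p2 - (p1 - p0) = k * (h * X) := E; lra.
apply: le_trans (ler_normD _ _) _.
apply: le_trans (lerD (ler_normB _ _) (lexx _)) _.
rewrite (gtr0_norm h0) in A B.
have G : `|h * (k * (X - Q))| <= h * (e * `|k|).
  by rewrite !normrM (gtr0_norm h0) ler_wpM2l ?(ltW h0)// mulrC ler_wpM2r.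
by apply: le_trans (lerD (lerD B A) G) _; rewrite mulrDr; lra.
Qed.

(** The function [g a1 a2] stands for the partial derivative of order
    [(a1, a2)], with no order of differentiation preferred. *)
Definition derivative_family N (g : nat -> nat -> 'rV[R]_2 -> R) U : Prop :=
  (forall a1 a2 y, (a1 + a2 < N)%N -> U y ->
     is_derive y e1 (g a1 a2) (g a1.+1 a2 y) /\ is_derive y e2 (g a1 a2) (g a1 a2.+1 y)) /\
  (forall a1 a2 y, (a1 + a2 <= N)%N -> U y -> {for y, continuous (g a1 a2)}).

(** Decreasing induction on the order [a2] in the second variable. Within a fixed
    [a2], [mixed_derivative] moves one more derivative in the second variable past
    those in the first, by induction on [a1]; then continuity descends from the top
    order by [continuous_of_partials]. *)
Lemma mpderiv_family N f U : open U ->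
  (forall a1 a2, (a1 + a2 = N)%N -> has_mpderiv a1 a2 f U /\
     forall x, U x -> {for x, continuous (mpderiv a1 a2 f)}) ->
  derivative_family N (fun a1 a2 => mpderiv a1 a2 f) U.
Proof.
move=> oU H; set g := fun a1 a2 => mpderiv a1 a2 f.
have d1 a1 a2 y : (a1 + a2 < N)%N -> U y -> is_derive y e1 (g a1 a2) (g a1.+1 a2 y).
  move=> h Uy; have [|[_ hd] _] := H (N - a2)%N a2.
    by rewrite subnK// ltnW// (leq_trans _ h)// ltnS leq_addl.
  by split=> //; apply: hd => //; rewrite ltn_subRL addnC.
have d20 a2 y : (a2 < N)%N -> U y -> is_derive y e2 (g 0%N a2) (g 0%N a2.+1 y).
  move=> h Uy; have [|[hd _] _] := H 0%N N; first by rewrite add0n.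
  by split=> //; apply: hd.
have top a1 a2 y : (a1 + a2 = N)%N -> U y -> {for y, continuous (g a1 a2)}.
  by move=> h Uy; have [_] := H a1 a2 h; apply.
have main k : forall a2, (a2 + k = N)%N ->
   (forall a1 y, (a1 + a2 < N)%N -> U y -> is_derive y e2 (g a1 a2) (g a1 a2.+1 y)) /\
   (forall a1 y, (a1 + a2 <= N)%N -> U y -> {for y, continuous (g a1 a2)}).
  elim: k => [|k IH] a2 hk.
    rewrite addn0 in hk; subst a2; split=> [a1 y|a1 y].
      by rewrite ltnNge leq_addl.
    move=> h; apply: top; apply/eqP; rewrite eqn_leq h leq_addl//.
  have [|IHd IHc] := IH a2.+1; first by rewrite addSnnS.
  have D a1 : forall y, (a1 + a2 < N)%N -> U y -> is_derive y e2 (g a1 a2) (g a1 a2.+1 y).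
    elim: a1 => [|a1 IHa] y h Uy; first exact: d20.
    have h1 : (a1 + a2 < N)%N by apply: ltn_trans h.
    have h2 : (a1 + a2.+1 < N)%N by rewrite addnS -addSn.
    apply: (@mixed_derivative U (g a1 a2) _ (g a1 a2.+1) (g a1.+1 a2.+1)) => //.
      by move=> z Uz; split; [exact: d1|exact: IHa|exact: d1].
    by apply: IHc => //; rewrite addSn.
  split=> [a1 y|]; first exact: D.
  have C j : forall a1 y, (a1 + a2 + j = N)%N -> U y -> {for y, continuous (g a1 a2)}.
    elim: j => [|j IHj] a1 y h Uy; first by apply: top => //; rewrite -h addn0.
    have h1 : (a1 + a2 < N)%N by rewrite -h addnS ltnS leq_addr.
    apply: (@continuous_of_partials U _ (g a1.+1 a2) (g a1 a2.+1)) => //.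
    - by move=> z Uz; split; [exact: d1|exact: D].
    - by apply: IHj => //; rewrite addSn addSnnS.
    - by apply: IHc => //; rewrite addnS.
  by move=> a1 y h; apply: (C (N - (a1 + a2))%N); rewrite subnKC.
split=> a1 a2 y h Uy.
  split; first exact: d1.
  have [|D _] := main (N - a2)%N a2; last exact: D.
  by rewrite subnKC// ltnW// (leq_trans _ h)// ltnS leq_addl.
have [|_] := main (N - a2)%N a2; last exact.
by rewrite subnKC// (leq_trans _ h)// leq_addl.
Qed.

Lemma family_line N g U a1 a2 x v (s : R) : open U -> derivative_family N g U ->
  (a1 + a2 < N)%N -> U (s *: v + x) ->
  is_derive s 1 (fun t => g a1 a2 (t *: v + x))
    (v 0 ord0 * g a1.+1 a2 (s *: v + x) + v 0 ord_max * g a1 a2.+1 (s *: v + x)).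
Proof.
move=> oU [dg cg] h Ux; apply: is_derive_line; apply: (@derive_of_partials U _ (g a1.+1 a2) (g a1 a2.+1)) => //.
- by move=> y Uy; exact: dg.
- by apply: cg => //; rewrite addSn.
- by apply: cg => //; rewrite addnS.
Qed.

End partial_calculus.

(** * Covariances of distant increments *)

Section window_functional.
Context {R : realType}.
Implicit Types (g : nat -> nat -> 'rV[R]_2 -> R) (z : 'rV[R]_2).

(** Differentiability and bounds are required along the segment from [z] to
    [u + z] only, so that weighted sums of translates qualify without a common open
    domain. *)
Definition segment_family l g (u z : 'rV[R]_2) (A : R) : Prop :=
  (forall (s : R) a1 a2, 0 <= s <= 1 -> (a1 + a2 < l)%N ->
    is_derive s 1 (fun t => g a1 a2 (t *: u + z))
      (u 0 ord0 * g a1.+1 a2 (s *: u + z) + u 0 ord_max * g a1 a2.+1 (s *: u + z))) /\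
  (forall (s : R) a1 a2, 0 <= s <= 1 -> (1 <= a1 + a2 <= l)%N -> `|g a1 a2 (s *: u + z)| <= A).

Definition window_const (l : nat) (B : R) : R := l.+1%:R * (2 * B ^+ 2 + 4 * B ^+ 3) + 2 * B.

Lemma pair_bound (u : 'rV[R]_2) (x y A r : R) : enorm u <= r -> `|x| <= A -> `|y| <= A ->
  `|u 0 ord0 * x + u 0 ord_max * y| <= 2 * r * A.
Proof.
move=> hu hx hy; have A0 := le_trans (normr_ge0 _) hx.
have h (j : 'I_2) w : `|w| <= A -> `|u 0 j * w| <= r * A.
  by move=> hw; rewrite normrM; apply: ler_pM => //; apply: le_trans hu; exact: coord_le_enorm.
by apply: le_trans (ler_normD _ _) _; apply: le_trans (lerD (h _ _ hx) (h _ _ hy)) _; lra.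
Qed.

Lemma segment_first_order l g u z A r : (0 < l)%N -> segment_family l g u z A -> enorm u <= r ->
  `|g 0%N 0%N (u + z) - g 0%N 0%N z| <= 2 * r * A.
Proof.
move=> l0 [dg hA] hu.
have [||s [hs _ _ E]] := @mean_value R (fun t => g 0%N 0%N (t *: u + z)) _ 0 1 0 1
   (fun t ht => dg t 0%N 0%N ht l0).
- by rewrite lexx ler01.
- by rewrite lexx ler01.
- move: E; rewrite scale1r scale0r add0r subr0 mulr1 => ->.
  by apply: pair_bound => //; apply: hA => //=.
Qed.

Lemma segment_second_order g u z A r : segment_family 2 g u z A -> enorm u <= r ->
  `|g 0%N 0%N (u + z) - g 0%N 0%N z - (u 0 ord0 * g 1%N 0%N z + u 0 ord_max * g 0%N 1%N z)| <= 4 * r ^+ 2 * A.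
Proof.
move=> [dg hA] hu.
have r0 : 0 <= r by apply: le_trans hu; exact: enorm_ge0.
have z01 : 0 <= (0 : R) <= 1 by apply/andP; split.
have z11 : 0 <= (1 : R) <= 1 by apply/andP; split.
have A0 : 0 <= A by apply: le_trans (hA 0 1%N 0%N z01 isT); exact: normr_ge0.
pose d (s : R) := u 0 ord0 * g 1%N 0%N (s *: u + z) + u 0 ord_max * g 0%N 1%N (s *: u + z).
have [|||s [hs _ _ E]] := @mean_value R (fun t => g 0%N 0%N (t *: u + z)) d 0 1 0 1 => //.
  by move=> t ht; exact: dg.
pose d2 (s : R) := u 0 ord0 * (u 0 ord0 * g 2%N 0%N (s *: u + z) + u 0 ord_max * g 1%N 1%N (s *: u + z))
   + u 0 ord_max * (u 0 ord0 * g 1%N 1%N (s *: u + z) + u 0 ord_max * g 0%N 2%N (s *: u + z)).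
have [t ht|||t [ht _ _ E2]] := @mean_value R d d2 0 1 0 s => //.
  by apply: is_deriveD; apply: is_deriveZ; exact: dg.
have e0 : d 0 = u 0 ord0 * g 1%N 0%N z + u 0 ord_max * g 0%N 1%N z by rewrite /d scale0r add0r.
move: E; rewrite scale1r scale0r add0r subr0 mulr1 => ->; rewrite -e0 E2 subr0 normrM.
have h2 : `|d2 t| <= 2 * r * (2 * r * A).
  by apply: pair_bound => //; apply: pair_bound => //; exact: hA.
case/andP: hs => s0 s1; rewrite (ger0_norm s0); apply: (@le_trans _ _ (2 * r * (2 * r * A) * 1)).
  by apply: ler_pM.
by rewrite mulr1 le_eqVlt; apply/orP; left; apply/eqP; ring.
Qed.

(** A window functional annihilates constants and, when it is of order two,
    nearly annihilates linear functions: it is bounded by the derivatives of order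
    [1] to [l], independently of the mesh [dlt]. *)
Lemma window_functional_le l (b : 'I_l.+1 -> R) (u : 'I_l.+1 -> 'rV[R]_2) g z (B dlt A : R) :
  l \in [:: 1%N; 2%N] -> 0 < B -> 0 < dlt -> 0 <= A ->
  \sum_k b k = 0 -> (forall k, `|b k| <= B / dlt ^+ l) -> enorm (\sum_k b k *: u k) <= B ->
  (forall k, enorm (u k) <= B * dlt) -> (forall k, segment_family l g (u k) z A) ->
  `|\sum_k b k * g 0%N 0%N (u k + z)| <= window_const l B * A.
Proof.
move=> hl B0 d0 A0 sb hb hU hu hg.
have [B20 B30] : 0 < B ^+ 2 /\ 0 < B ^+ 3 by rewrite !exprn_gt0.
have e : \sum_k b k * g 0%N 0%N (u k + z) = \sum_k b k * (g 0%N 0%N (u k + z) - g 0%N 0%N z).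
  by under [RHS]eq_bigr do rewrite mulrBr; rewrite sumrB -mulr_suml sb mul0r subr0.
have sumle (F : 'I_l.+1 -> R) (c : R) : (forall k, `|F k| <= c) -> `|\sum_k b k * F k| <= l.+1%:R * (B / dlt ^+ l * c).
  move=> hF; apply: le_trans (ler_norm_sum _ _ _) _.
  apply: (@le_trans _ _ (\sum_(k < l.+1) B / dlt ^+ l * c)).
    by apply: ler_sum => k _; rewrite normrM; apply: ler_pM.
  by rewrite sumr_const card_ord mulr_natl.
rewrite /window_const; move: hl; rewrite !inE => /orP[] /eqP el; subst l; rewrite e.
  apply: le_trans (sumle _ (2 * (B * dlt) * A) _) _.
    by move=> k; apply: segment_first_order (hg k) (hu k).
  rewrite [X in _ * X](_ : _ = 2 * B ^+ 2 * A); last by field; rewrite gt_eqF.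
  have := mulr_ge0 (ltW B0) A0; have := mulr_ge0 (ltW B30) A0; nra.
pose F k := g 0%N 0%N (u k + z) - g 0%N 0%N z - (u k 0 ord0 * g 1%N 0%N z + u k 0 ord_max * g 0%N 1%N z).
set U := \sum_k b k *: u k in hU.
have UE j : U 0 j = \sum_k b k * u k 0 j by rewrite summxE; apply: eq_bigr => k _; rewrite mxE.
have -> : \sum_k b k * (g 0%N 0%N (u k + z) - g 0%N 0%N z) =
   \sum_k b k * F k + (U 0 ord0 * g 1%N 0%N z + U 0 ord_max * g 0%N 1%N z).
  rewrite !UE !mulr_suml -!big_split/=; apply: eq_bigr => k _; rewrite /F; ring.
apply: le_trans (ler_normD _ _) _.
have h1 := sumle F (4 * (B * dlt) ^+ 2 * A) (fun k => segment_second_order (hg k) (hu k)).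
have [_ hA] := hg ord0; have z01 : 0 <= (0 : R) <= 1 by apply/andP; split.
have h2 : `|U 0 ord0 * g 1%N 0%N z + U 0 ord_max * g 0%N 1%N z| <= 2 * B * A.
  by apply: pair_bound => //; [have := hA 0 1%N 0%N z01 isT|have := hA 0 0%N 1%N z01 isT]; rewrite scale0r add0r.
apply: le_trans (lerD h1 h2) _.
rewrite [X in 3%:R * X](_ : _ = 4 * B ^+ 3 * A); last by field; rewrite gt_eqF.
have := mulr_ge0 (ltW B20) A0; nra.
Qed.

(** Applied in both variables, the window functionals see only the derivatives
    of order between [2] and [2 * l]. *)
Lemma nabla_cov_le theta l g (U : set 'rV[R]_2) (q : nat -> 'rV[R]_2) (B dlt A : R) i j :
  l \in [:: 1%N; 2%N] -> 0 < B -> 0 < dlt -> 0 <= A ->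
  open U -> derivative_family (2 * l) g U ->
  window_ok theta l B q dlt i -> window_ok theta l B q dlt j ->
  (forall (k1 k2 : 'I_l.+1) (s t : R), 0 <= s <= 1 -> 0 <= t <= 1 ->
     let x := t *: - (q (j + theta * k2)%N - q j) + (s *: (q (i + theta * k1)%N - q i) + (q i - q j)) in
     U x /\ forall a1 a2, (2 <= a1 + a2 <= 2 * l)%N -> `|g a1 a2 x| <= A) ->
  `|nabla_cov (g 0%N 0%N) theta l q i j| <= window_const l B * (window_const l B * A).
Proof.
move=> hl B0 d0 A0 oU hg [sb hb hU hu] [sb' hb' hU' hu'] H.
have l0 : (0 < l)%N by move: hl; rewrite !inE => /orP[] /eqP ->.
pose u k := q (i + theta * k)%N - q i; pose v k := - (q (j + theta * k)%N - q j).
(* the weights of the window [j] are applied first; the result is a family of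
   derivatives in the variable of the window [i] *)
pose G a1 a2 w := \sum_(k < l.+1) bcoef theta l q j k * g a1 a2 (v k + w).
have W0 : 0 <= window_const l B.
  by rewrite /window_const addr_ge0 ?mulr_ge0 ?addr_ge0 ?mulr_ge0 ?exprn_ge0 ?(ltW B0).
have -> : nabla_cov (g 0%N 0%N) theta l q i j = \sum_(k < l.+1) bcoef theta l q i k * G 0%N 0%N (u k + (q i - q j)).
  apply: eq_bigr => k1 _; rewrite mulr_sumr; apply: eq_bigr => k2 _; rewrite mulrA; congr (_ * g _ _ _).
  by apply/rowP => c; rewrite /u /v !mxE; ring.
apply: (@window_functional_le _ _ _ _ _ _ dlt) => //; first exact: mulr_ge0.
move=> k1; split=> s a1 a2 hs ha.
  have z11 : 0 <= (1 : R) <= 1 by apply/andP; split.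
  have d (k2 : 'I_l.+1) : is_derive s 1 (fun t => bcoef theta l q j k2 * g a1 a2 (v k2 + (t *: u k1 + (q i - q j))))
     (bcoef theta l q j k2 * (u k1 0 ord0 * g a1.+1 a2 (v k2 + (s *: u k1 + (q i - q j))) +
       u k1 0 ord_max * g a1 a2.+1 (v k2 + (s *: u k1 + (q i - q j))))).
    have [Ux _] := H k1 k2 s 1 hs z11.
    apply: is_deriveZ; rewrite (_ : (fun t => _) = (fun t => g a1 a2 (t *: u k1 + (v k2 + (q i - q j))))).
      rewrite !(addrCA (v k2) (s *: u k1)); apply: (family_line oU hg).
        by rewrite mul2n -addnn (leq_trans ha)// leq_addr.
      by move: Ux; rewrite scale1r addrCA.
    by apply/funext => t; rewrite addrCA.
  have := @is_derive_sum R R R l.+1 _ s 1 _ d.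
  rewrite (_ : \sum_(i0 < l.+1) _ = fun t => G a1 a2 (t *: u k1 + (q i - q j))); last by apply/funext => t; rewrite fct_sumE.
  by move/is_derive_eq; apply; rewrite /G !mulr_sumr -big_split/=; apply: eq_bigr => k _; ring.
pose h c1 c2 := g (a1 + c1)%N (a2 + c2)%N.
have -> : G a1 a2 (s *: u k1 + (q i - q j)) = \sum_(k < l.+1) bcoef theta l q j k * h 0%N 0%N (v k + (s *: u k1 + (q i - q j))).
  by apply: eq_bigr => k _; rewrite /h !addn0.
apply: (@window_functional_le _ _ _ _ _ _ dlt) => //.
- have -> : \sum_(k < l.+1) bcoef theta l q j k *: v k = - \sum_(k < l.+1) bcoef theta l q j k *: (q (j + theta * k)%N - q j).
    by rewrite -sumrN; apply: eq_bigr => k _; rewrite -scalerN.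
  by rewrite enormN.
- by move=> k; rewrite enormN.
move=> k2; split=> t c1 c2 ht hc.
  have [Ux _] := H k1 k2 s t hs ht.
  rewrite /h !addnS; apply: (family_line oU hg) => //.
  by rewrite addnACA mul2n -addnn; case/andP: ha => _ ha; rewrite -addnS leq_add.
have [_] := H k1 k2 s t hs ht; apply; rewrite addnACA mul2n -addnn.
case/andP: ha => ha ha'; case/andP: hc => hc hc'.
by rewrite (leq_add ha' hc') (leq_add ha hc).
Qed.

End window_functional.

Section off_diagonal.
Context {R : realType}.

Lemma convex_segment (Gam : set 'rV[R]_2) (x y : 'rV[R]_2) (s : R) : convex_set Gam ->
  Gam x -> Gam y -> 0 <= s <= 1 -> Gam (s *: (y - x) + x).
Proof.
move=> cG Gx Gy /andP[s0 s1].
have := cG y x (Itv01 s0 s1); rewrite !inE => /(_ Gy Gx).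
have -> : s *: (y - x) + x = s *: y + (1 - s) *: x by apply/rowP => c; rewrite !mxE; ring.
exact: id.
Qed.

(** The finitely many derivatives of top order come with different open sets;
    all of them live on the intersection. *)
Lemma smooth_open (l : nat) Gam (Kt : 'rV[R]_2 -> R) : smooth_off_origin l Gam Kt ->
  exists U, [/\ open U, difference_set Gam `<=` U & derivative_family (2 * l) (fun a1 a2 => mpderiv a1 a2 Kt) U].
Proof.
move=> H.
have sub (U V : set 'rV[R]_2) a1 a2 : V `<=` U -> has_mpderiv a1 a2 Kt U -> has_mpderiv a1 a2 Kt V.
  by move=> VU [h1 h2]; split=> i x hi /VU; [exact: h1|exact: h2].
have : exists U, [/\ open U, difference_set Gam `<=` U & forall a1 a2, (a1 + a2 = 2 * l)%N -> (a1 < (2 * l).+1)%N ->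
    has_mpderiv a1 a2 Kt U /\ forall x, U x -> {for x, continuous (mpderiv a1 a2 Kt)}].
  elim: (2 * l).+1 => [|k [U [oU dU hU]]]; first by exists setT; split=> //; exact: openT.
  have [kl|kl] := leqP k (2 * l); last first.
    by exists U; split=> // a1 a2 e ak; apply: hU => //; apply: leq_ltn_trans kl; rewrite -e leq_addr.
  have [V [oV dV h1 h2]] := H k (2 * l - k)%N (subnKC kl).
  exists (U `&` V); split; [exact: openI|by move=> x dx; split; [exact: dU|exact: dV]|].
  move=> a1 a2 e; rewrite ltnS leq_eqVlt => /orP[/eqP ek|ak].
    have {e} ea : a2 = (2 * l - k)%N by rewrite -e ek addKn.
    by subst a1 a2; split; [apply: sub h1 => ? []|move=> x [_ /h2]].
  have [h3 h4] := hU _ _ e ak.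
  by split; [apply: sub h3 => ? []|move=> x [/h4]].
move=> [U [oU dU hU]]; exists U; split=> //; apply: mpderiv_family => // a1 a2 e.
by apply: hU => //; rewrite ltnS -e leq_addr.
Qed.

Variables (L : R) (P tau : R -> 'rV[R]_2) (a : R -> R) (M m : R).
Hypothesis HP : regular_path L P tau a M m.
Local Notation p n := (gridpt L P n).
Local Notation mesh := (mesh L).
Variables (theta l : nat) (nu : R) (Kt : 'rV[R]_2 -> R) (Gam : set 'rV[R]_2).
Hypothesis hth : theta \in [:: 1%N; 2%N].
Hypothesis hl : l \in [:: 1%N; 2%N].
Hypothesis hnu : 0 < nu < l%:R.
Hypothesis convG : convex_set Gam.
Hypothesis PG : forall u, 0 <= u <= L -> Gam (P u).
Hypothesis smoothK : smooth_off_origin l Gam Kt.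
Hypothesis boundK : derivative_bound l nu Gam Kt.

Let m0 : 0 < m. Proof. by case: HP. Qed.
Let M0 : 0 < M. Proof. by case: HP. Qed.
Let mesh0 n : (1 < n)%N -> 0 < mesh n. Proof. exact: (mesh_gt0 HP). Qed.
Local Notation q := (2 * nu - (2 * l)%:R).
Local Notation inw n i := ((1 <= i <= n - theta * l)%N).
Local Notation gap i j := (i - j + (j - i))%N.

Lemma pdist_gap n i j : (1 < n)%N -> (1 <= i <= n)%N -> (1 <= j <= n)%N ->
  m * ((gap i j)%:R * mesh n) <= pdist (p n) i j.
Proof.
move=> n1; wlog ij : i j / (i <= j)%N => [H hi hj|].
  have [|/ltnW] := leqP i j; first by move=> h; exact: H.
  by move=> h; rewrite pdistC addnC; exact: H.
move=> /andP[i1 _] /andP[_ jn]; have [_ _ /andP[h _] _ _] := gridP HP n1 i1 ij jn.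
by have /eqP -> : (i - j == 0)%N by rewrite subn_eq0.
Qed.

(** Once the gap exceeds a constant, the windows are small compared with their
    distance; by convexity the points on their segments still have their differences
    controlled by the assumption on the derivatives. *)
Lemma off_diag_bound : exists2 K0, (0 < K0)%N & exists2 C, 0 < C & \forall n \near \oo, forall i j,
  inw n i -> inw n j -> (K0 <= gap i j)%N ->
  `|nabla_cov Kt theta l (p n) i j| <= C * ((gap i j)%:R * mesh n) `^ q.
Proof.
have q0 : q <= 0.
  by rewrite natrM; case/andP: hnu => _ h; rewrite -mulrBr pmulr_rle0// subr_le0 ltW.
have [U [oU dU hg]] := smooth_open smoothK; have [C4 hC4] := boundK.
have [B B0 hB] := near_window HP hth hl.
have [K hK] : exists K : nat, 4 * B / m <= K%:R.
  by exists (Num.truncn (4 * B / m)).+1; apply: ltW; exact: truncnS_gt.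
pose W := window_const l B.
have W0 : 0 < W.
  by rewrite /W /window_const addr_gt0 ?mulr_gt0 ?addr_gt0 ?mulr_gt0 ?exprn_gt0.
have c4 : 0 < (`|C4| + 1) * (m / 2) `^ q by rewrite mulr_gt0 ?ltr_wpDl// powR_gt0// divr_gt0.
exists K.+1 => //; exists (W * (W * ((`|C4| + 1) * (m / 2) `^ q))); first exact: mulr_gt0 W0 (mulr_gt0 W0 c4).
near=> n; have n1 : (1 < n)%N by near: n; exact: nbhs_infty_gt.
have hW : forall i, inw n i -> window_ok theta l B (p n) (mesh n) i by near: n.
move=> i j hi hj hij; have d0 := mesh0 n1.
set D := (gap i j)%:R * mesh n.
have g0 : (0 : R) < (gap i j)%:R by rewrite ltr0n; exact: leq_trans hij.
have D0 : 0 < D by rewrite mulr_gt0.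
have in_n k : inw n k -> forall k1 : 'I_l.+1, (1 <= k + theta * k1 <= n)%N.
  move=> hk k1; have h := window_in hk; case/andP: hk => k0 _.
  rewrite (leq_trans k0 (leq_addr _ _)) (leq_trans _ h)// leq_add2l leq_mul2l -ltnS ltn_ord orbT//.
have Gp k : (1 <= k <= n)%N -> Gam (p n k) by move=> hk; apply: PG; exact: (node_in HP).
have in0 k : inw n k -> (1 <= k <= n)%N by move=> /in_n /(_ ord0); rewrite muln0 addn0.
rewrite -!mulrA (_ : (`|C4| + 1) * ((m / 2) `^ q * D `^ q) = (`|C4| + 1) * (m / 2 * D) `^ q); last first.
  by rewrite (@powRM _ (m / 2) D) ?divr_ge0 ?(ltW D0) ?(ltW m0).
apply: (nabla_cov_le hl B0 d0 _ oU hg (hW i hi) (hW j hj)).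
  by rewrite mulr_ge0 ?powR_ge0// addr_ge0.
move=> k1 k2 s t hs ht.
pose x := s *: (p n (i + theta * k1)%N - p n i) + p n i.
pose y := t *: (p n (j + theta * k2)%N - p n j) + p n j.
have -> /= : t *: - (p n (j + theta * k2)%N - p n j) + (s *: (p n (i + theta * k1)%N - p n i) + (p n i - p n j)) = x - y.
  by apply/rowP => c; rewrite /x /y !mxE; ring.
have Gx : Gam x by apply: convex_segment => //; apply: Gp; [exact: in0|exact: in_n].
have Gy : Gam y by apply: convex_segment => //; apply: Gp; [exact: in0|exact: in_n].
have xy : m / 2 * D <= enorm (x - y).
  have h1 := pdist_gap n1 (in0 _ hi) (in0 _ hj).
  have sm r (w : 'rV[R]_2) : 0 <= r <= 1 -> enorm w <= B * mesh n -> enorm (r *: w) <= B * mesh n.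
    move=> /andP[r0 r1] hw; rewrite enormZ ger0_norm//; apply: le_trans hw.
    by rewrite ler_piMl// enorm_ge0.
  have [_ _ _ hu] := hW i hi; have [_ _ _ hv] := hW j hj.
  have h2 := sm s _ hs (hu k1); have h3 := sm t _ ht (hv k2).
  set su := s *: _ in h2; set tv := t *: _ in h3.
  have e : p n i - p n j = (x - y) - (su - tv).
    by apply/rowP => c; rewrite /x /y -/su -/tv !mxE; ring.
  have h4 : pdist (p n) i j <= enorm (x - y) + (B * mesh n + B * mesh n).
    rewrite /pdist e; apply: le_trans (enormD _ _) _; rewrite lerD2l enormN.
    by apply: le_trans (enormD _ _) _; rewrite enormN lerD.
  (* by the choice of [K], the windows have at most a quarter of the size of their
     distance *)
  have h5 : 4 * B * mesh n <= m * D.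
    rewrite /D mulrA ler_wpM2r ?(ltW d0)//.
    rewrite [leRHS]mulrC -ler_pdivrMr//; apply: le_trans hK _; rewrite ler_nat.
    exact: leq_trans hij.
  rewrite -/D in h1; lra.
have mD0 : 0 < m / 2 * D by rewrite mulr_gt0// divr_gt0.
have nxy : x != y.
  by apply: contraTneq (lt_le_trans mD0 xy) => ->; rewrite subrr enorm0 ltxx.
split; first by apply: dU; exists x, y.
move=> a1 a2 ha; apply: le_trans (hC4 _ _ _ _ ha Gx Gy nxy) _.
rewrite -natrM; apply: (@le_trans _ _ ((`|C4| + 1) * enorm (x - y) `^ q)).
  by apply: ler_wpM2r; [exact: powR_ge0|apply: le_trans (ler_norm _) _; rewrite lerDl].
by apply: ler_wpM2l; [rewrite addr_ge0|exact: ler_powRN].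
Unshelve. all: end_near. Qed.

End off_diagonal.

(** * The sum of the squared covariances *)

Section power_sums.
Context {R : realType}.

Definition power_sum (s : R) n := \sum_(0 <= k < n) k.+1%:R `^ s.

Lemma powR_step (s : R) k : s <= 0 -> s + 1 != 0 ->
  k.+2%:R `^ s <= (k.+2%:R `^ (s + 1) - k.+1%:R `^ (s + 1)) / (s + 1).
Proof.
move=> s0 b0.
have k12 : (k.+1%:R : R) <= k.+2%:R by rewrite ler_nat.
have [t ht|||c [/andP[c1 c2] _ _ E]] := @mean_value R (fun x => x `^ (s + 1)) (fun x => (s + 1) * x `^ s) k.+1%:R k.+2%:R k.+1%:R k.+2%:R.
- have := @is_derive1_powR R (s + 1) t; rewrite addrK; apply.
  by case/andP: ht => h _; exact: lt_le_trans h.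
- by rewrite lexx.
- by rewrite k12 lexx.
move: E => /= ->; have -> : (k.+2%:R : R) - k.+1%:R = 1 by rewrite -natrB// subSnn.
have -> : (s + 1) * c `^ s * 1 / (s + 1) = c `^ s by field.
by apply: ler_powRN => //; exact: lt_le_trans c1.
Qed.

(** Comparison of the sum with the integral, by the mean value theorem for the
    power [s + 1]. *)
Lemma power_sum_step (s : R) n : s <= 0 -> s + 1 != 0 ->
  power_sum s n.+1 <= 1 + (n.+1%:R `^ (s + 1) - 1) / (s + 1).
Proof.
move=> s0 b0; elim: n => [|n IH].
  by rewrite /power_sum big_nat1 !powR1 subrr mul0r addr0.
rewrite /power_sum big_nat_recr//=; apply: le_trans (lerD IH (powR_step n s0 b0)) _.
by rewrite le_eqVlt; apply/orP; left; apply/eqP; field.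
Qed.

Lemma power_sum_bounded (s : R) n : s < -1 -> power_sum s n <= 1 - (s + 1)^-1.
Proof.
move=> s1; have s0 : s <= 0 by lra.
have b0 : s + 1 < 0 by lra.
case: n => [|n]; first by rewrite /power_sum big_nil addr_ge0// oppr_ge0 invr_le0 ltW.
apply: le_trans (power_sum_step n s0 (negbT (lt_eqF b0))) _.
by rewrite lerD2l mulrBl mul1r gerDr mulr_ge0_le0 ?powR_ge0// invr_le0 ltW.
Qed.

Lemma power_sum_log n : (0 < n)%N -> power_sum (- 1 : R) n <= 1 + ln n%:R.
Proof.
case: n => // n _; elim: n => [|n IH]; first by rewrite /power_sum big_nat1 powR1 ln1 addr0.
rewrite /power_sum big_nat_recr//=; apply: le_trans (lerD IH (lexx _)) _.
rewrite -addrA lerD2l.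
have n2 : (0 : R) < n.+2%:R by [].
rewrite powR_inv1 ?(ltW n2)//.
have n1 : (n.+1%:R : R) = n.+2%:R - 1 by rewrite -[n.+2]addn1 natrD addrK.
have := @le_ln1Dx R (- n.+2%:R^-1); rewrite ltrN2 invf_lt1// ltr1n => /(_ isT).
have -> : 1 - n.+2%:R^-1 = n.+1%:R / n.+2%:R :> R by rewrite n1; field.
by rewrite ln_div ?posrE//; move: (ln _) (ln _) (_^-1) => x y z; lra.
Qed.

Lemma power_sum_power (s : R) n : -1 < s -> s <= 0 -> (0 < n)%N ->
  power_sum s n <= (1 + (s + 1)^-1) * n%:R `^ (s + 1).
Proof.
move=> s1 s0; case: n => // n _; have b0 : 0 < s + 1 by lra.
apply: le_trans (power_sum_step n s0 (negbT (gt_eqF b0))) _.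
have h : 1 <= n.+1%:R `^ (s + 1) by rewrite -[leLHS](powRr0 n.+1%:R); apply: ler_powR (ltW b0); rewrite ler1n.
have : 0 < (s + 1)^-1 by rewrite invr_gt0.
by rewrite mulrBl mulrDl !mul1r (mulrC (_ `^ _)); move: h (_^-1) (_^-1 * _) => h u v; lra.
Qed.

Lemma power_sum_le (s s' : R) n : s <= s' -> power_sum s n <= power_sum s' n.
Proof. by move=> h; apply: ler_sum => k _; apply: ler_powR => //; rewrite ler1n. Qed.

Lemma powR_sqr (x s : R) : (x `^ s) ^+ 2 = x `^ (2 * s).
Proof. by rewrite -powR_mulrn ?powR_ge0// -powRrM mulrC. Qed.

(** Each gap is attained at most twice. *)
Lemma gap_sum (f : nat -> R) N i : (forall k, 0 <= f k) -> (1 <= i < N.+1)%N ->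
  \sum_(1 <= j < N.+1) f (i - j + (j - i))%N <= 2 * \sum_(0 <= k < N) f k.
Proof.
move=> f0 /andP[i1 iN]; rewrite (@big_cat_nat _ _ _ i)//=; last exact: ltnW.
have sub a : (a <= N)%N -> \sum_(0 <= k < a) f k <= \sum_(0 <= k < N) f k.
  by move=> aN; rewrite [leRHS](@big_cat_nat _ _ _ a)//= lerDl sumr_ge0.
rewrite mulr_natl mulr2n; apply: lerD.
  rewrite big_nat_rev/=; apply: le_trans (sub i _); last by lia.
  rewrite [leRHS](@big_cat_nat _ _ _ 1%N)//=; apply: ler_wpDl; first exact: sumr_ge0.
  rewrite !big_nat; apply: ler_sum => j hj; rewrite le_eqVlt; apply/orP; left; apply/eqP; congr f; lia.
rewrite -{1}[i]add0n big_addn; apply: le_trans (sub (N.+1 - i)%N _); last by lia.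
by rewrite !big_nat; apply: ler_sum => j hj; rewrite le_eqVlt; apply/orP; left; apply/eqP; congr f; lia.
Qed.

End power_sums.

Section covariance_sums.
Context {R : realType}.
Variables (L : R) (P tau : R -> 'rV[R]_2) (a : R -> R) (M m : R).
Hypothesis HP : regular_path L P tau a M m.
Local Notation p n := (gridpt L P n).
Local Notation mesh := (mesh L).
Variables (theta l : nat) (nu : R) (beta : nat -> R) (bs : R) (Kt : 'rV[R]_2 -> R) (Gam : set 'rV[R]_2).
Hypothesis hth : theta \in [:: 1%N; 2%N].
Hypothesis hl : l \in [:: 1%N; 2%N].
Hypothesis hnu : 0 < nu < l%:R.
Hypothesis hcov : covariance_form nu beta bs Kt.
Hypothesis convG : convex_set Gam.
Hypothesis PG : forall u, 0 <= u <= L -> Gam (P u).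
Hypothesis smoothK : smooth_off_origin l Gam Kt.
Hypothesis boundK : derivative_bound l nu Gam Kt.
Hypothesis cov_ge0 : forall n i, 0 <= nabla_cov Kt theta l (p n) i i.
Hypothesis cov_sqr : forall n i j,
  nabla_cov Kt theta l (p n) i j ^+ 2 <= nabla_cov Kt theta l (p n) i i * nabla_cov Kt theta l (p n) j j.

Local Notation q := (2 * nu - (2 * l)%:R).
Local Notation inw n i := ((1 <= i <= n - theta * l)%N).
Local Notation gap i j := (i - j + (j - i))%N.

Let L0 : 0 < L. Proof. by case: HP. Qed.
Let m0 : 0 < m. Proof. by case: HP. Qed.
Let q0 : q <= 0.
Proof. by rewrite natrM; case/andP: hnu => _ h; rewrite -mulrBr pmulr_rle0// subr_le0 ltW. Qed.
Let th : (0 < theta <= 2)%N. Proof. by move: hth; rewrite !inE => /orP[] /eqP ->. Qed.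

Lemma near_diag_upper : exists2 D, 0 < D & \forall n \near \oo, forall i, inw n i ->
  nabla_cov Kt theta l (p n) i i <= D * n%:R `^ (- q).
Proof.
set k := 2 * bs * main_const l nu.
have mL0 : 0 < (m * L) `^ q by rewrite powR_gt0// mulr_gt0.
exists ((`|k| + 1) * (m * L) `^ q); first by rewrite mulr_gt0// ltr_wpDl.
near=> n; have n1 : (1 < n)%N by near: n; exact: nbhs_infty_gt.
have h : forall i, inw n i ->
    `|nabla_cov Kt theta l (p n) i i - k * spacing L a theta n i `^ q| <= 1 * spacing L a theta n i `^ q.
  by near: n; exact: (near_diag_cov HP hth hl hnu hcov).
move=> i hi; have := h i hi; rewrite ler_distl mul1r => /andP[_ h1].
have i_n : (1 <= i <= n)%N by exact: (@window_in_n theta l).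
have /andP[_ h2] := spacing_powR_bounds HP th n1 i_n q0.
apply: le_trans h1 _; apply: (@le_trans _ _ ((`|k| + 1) * spacing L a theta n i `^ q)).
  by rewrite [leRHS]mulrDl mul1r lerD2r; apply: ler_wpM2r; [exact: powR_ge0|exact: ler_norm].
by rewrite -mulrA ler_wpM2l// addr_ge0.
Unshelve. all: end_near. Qed.

(** The successor of the gap accommodates the diagonal. For small gaps the
    Cauchy--Schwarz inequality reduces the bound to the diagonal one. *)
Lemma near_cov_bound : exists2 D, 0 < D & \forall n \near \oo, forall i j, inw n i -> inw n j ->
  nabla_cov Kt theta l (p n) i j ^+ 2 <= D * n%:R `^ (- (2 * q)) * (gap i j).+1%:R `^ (2 * q).
Proof.
have [D1 D10 h1] := near_diag_upper.
have [K0 K00 [C C0 h2]] := off_diag_bound HP hth hl hnu convG PG smoothK boundK.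
have K0R : (0 : R) < K0%:R by rewrite ltr0n.
have e1 : 0 < D1 ^+ 2 * K0%:R `^ (- (2 * q)) by rewrite mulr_gt0 ?exprn_gt0 ?powR_gt0.
have e2 : 0 < (C * (L / 2) `^ q) ^+ 2 by rewrite exprn_gt0// mulr_gt0// powR_gt0// divr_gt0.
exists (D1 ^+ 2 * K0%:R `^ (- (2 * q)) + (C * (L / 2) `^ q) ^+ 2); first exact: addr_gt0.
near=> n; have n1 : (1 < n)%N by near: n; exact: nbhs_infty_gt.
have g1 : forall i, inw n i -> nabla_cov Kt theta l (p n) i i <= D1 * n%:R `^ (- q) by near: n.
have g2 : forall i j, inw n i -> inw n j -> (K0 <= gap i j)%N ->
    `|nabla_cov Kt theta l (p n) i j| <= C * ((gap i j)%:R * mesh n) `^ q by near: n.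
move=> i j hi hj; have n0 : (0 : R) < n%:R by rewrite ltr0n (ltn_trans _ n1).
have N0 : 0 < (n%:R : R) `^ (- (2 * q)) by rewrite powR_gt0.
set G := (gap i j).+1%:R `^ (2 * q); have G0 : 0 < G by rewrite powR_gt0.
have [hK|hK] := leqP K0 (gap i j).
  have g0 : (0 : R) < (gap i j)%:R by rewrite ltr0n (leq_trans _ hK).
  have two k : (0 < k)%N -> (k.+1 <= k * 2)%N by clear; lia.
  (* the successor of a positive gap is at most twice the gap *)
  have hd : (gap i j).+1%:R * (L / 2) / n%:R <= (gap i j)%:R * mesh n.
    have /andP[hm _] := mesh_bounds HP n1.
    apply: (@le_trans _ _ ((gap i j)%:R * (L / n%:R))); last by rewrite ler_wpM2l// ltW.
    have -> : (gap i j).+1%:R * (L / 2) / n%:R = (gap i j).+1%:R / 2 * (L / n%:R) by field; rewrite gt_eqF.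
    by rewrite ler_wpM2r ?divr_ge0 ?(ltW L0)// ler_pdivrMr// -natrM ler_nat two// (leq_trans _ hK).
  have p0 : 0 < (gap i j).+1%:R * (L / 2) / n%:R by rewrite divr_gt0// mulr_gt0// divr_gt0.
  have := le_trans (g2 i j hi hj hK) (ler_wpM2l (ltW C0) (ler_powRN q0 p0 hd)).
  rewrite powR_divn ?mulr_ge0 ?divr_ge0 ?(ltW L0)// powRM ?divr_ge0 ?(ltW L0)// => h.
  rewrite -(real_normK (num_real (nabla_cov _ _ _ _ _ _))).
  apply: le_trans (_ : (C * ((gap i j).+1%:R `^ q * (L / 2) `^ q * n%:R `^ (- q))) ^+ 2 <= _).
    by rewrite lerXn2r// nnegrE mulr_ge0 ?mulr_ge0 ?powR_ge0 ?(ltW C0).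
  have -> : (C * ((gap i j).+1%:R `^ q * (L / 2) `^ q * n%:R `^ (- q))) ^+ 2 =
    (C * (L / 2) `^ q) ^+ 2 * (n%:R `^ (- q)) ^+ 2 * ((gap i j).+1%:R `^ q) ^+ 2 by ring.
  rewrite !powR_sqr [2 * - q]mulrN -/G ler_wpM2r ?(ltW G0)// ler_wpM2r ?(ltW N0)//.
  by rewrite lerDr ltW.
apply: le_trans (cov_sqr n i j) _.
apply: (@le_trans _ _ ((D1 * n%:R `^ (- q)) * (D1 * n%:R `^ (- q)))).
  by apply: ler_pM; rewrite ?g1.
rewrite (_ : D1 * _ * _ = D1 ^+ 2 * (n%:R `^ (- q)) ^+ 2); last by ring.
rewrite powR_sqr [2 * - q]mulrN.
have GK : 1 <= K0%:R `^ (- (2 * q)) * G.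
  rewrite powRN mulrC ler_pdivlMr ?powR_gt0// mul1r; apply: ler_powRN => //.
    by rewrite pmulr_rle0.
  by rewrite ler_nat.
apply: (@le_trans _ _ (D1 ^+ 2 * K0%:R `^ (- (2 * q)) * n%:R `^ (- (2 * q)) * G)).
  rewrite [leRHS](_ : _ = D1 ^+ 2 * n%:R `^ (- (2 * q)) * (K0%:R `^ (- (2 * q)) * G)); last by ring.
  by apply: ler_peMr GK; apply: mulr_ge0 (sqr_ge0 _) (ltW N0).
by rewrite ler_wpM2r ?(ltW G0)// ler_wpM2r ?(ltW N0)// lerDl ltW.
Unshelve. all: end_near. Qed.

Lemma near_cov_sq : exists2 D, 0 < D & \forall n \near \oo,
  nabla_cov_sq Kt theta l (p n) n <= D * n%:R `^ (1 - 2 * q) * power_sum (2 * q) n.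
Proof.
have [D D0 h] := near_cov_bound; exists (2 * D); first by rewrite mulr_gt0.
near=> n; have n1 : (1 < n)%N by near: n; exact: nbhs_infty_gt.
have n0 : (0 : R) < n%:R by rewrite ltr0n (ltn_trans _ n1).
have hn : forall i j, inw n i -> inw n j ->
  nabla_cov Kt theta l (p n) i j ^+ 2 <= D * n%:R `^ (- (2 * q)) * (gap i j).+1%:R `^ (2 * q) by near: n.
set N := (n - theta * l)%N in hn *; set E := D * _ in hn.
have E0 : 0 <= E by rewrite mulr_ge0 ?powR_ge0 ?(ltW D0).
have Nn : (N <= n)%N by rewrite leq_subr.
pose f k : R := k.+1%:R `^ (2 * q).
have S0 : 0 <= power_sum (2 * q) n by apply: sumr_ge0 => k _; exact: powR_ge0.
apply: (@le_trans _ _ (\sum_(1 <= i < N.+1) E * (2 * power_sum (2 * q) n))).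
  rewrite /nabla_cov_sq -/N !big_nat; apply: ler_sum => i hi.
  apply: (@le_trans _ _ (\sum_(1 <= j < N.+1) E * f (gap i j))).
    by rewrite !big_nat; apply: ler_sum => j hj; apply: hn; rewrite -ltnS.
  rewrite -mulr_sumr ler_wpM2l//; apply: le_trans (gap_sum _ hi) _.
    by move=> k; exact: powR_ge0.
  rewrite ler_pM2l// /power_sum [leRHS](@big_cat_nat _ _ _ N)//= lerDl.
  by apply: sumr_ge0 => k _; exact: powR_ge0.
rewrite big_const_nat iter_addr addr0 subSS subn0 -[leLHS]mulr_natl.
apply: (@le_trans _ _ (n%:R * (E * (2 * power_sum (2 * q) n)))).
  by rewrite ler_wpM2r ?ler_nat//; apply: mulr_ge0 E0 _; exact: mulr_ge0.
have -> : (n%:R : R) `^ (1 - 2 * q) = n%:R * n%:R `^ (- (2 * q)).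
  by rewrite powRD ?powRr1 ?(ltW n0)// (gt_eqF n0) implybT.
by rewrite le_eqVlt; apply/orP; left; apply/eqP; rewrite /E; ring.
Unshelve. all: end_near. Qed.

End covariance_sums.

(** * Rates and the theorem *)

Section rates.
Context {R : realType}.

Lemma near_powR_small (s eta : R) : s < 0 -> 0 < eta -> \forall n \near \oo, n%:R `^ s <= eta.
Proof.
move=> s0 eta0; have ns0 : 0 < - s by rewrite oppr_gt0.
have [d d0 h] := powR_small ns0 eta0.
near=> n; have n1 : (0 < n)%N by near: n; exact: nbhs_infty_gt.
have n0 : (0 : R) < n%:R by rewrite ltr0n.
have -> : n%:R `^ s = (1 / n%:R) `^ (- s) by rewrite powR_divn// powR1 opprK [RHS]mul1r.
apply: h.
rewrite divr_ge0//= ler_pdivrMr// -ler_pdivrMl// mulr1.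
near: n; exact: nbhs_infty_ger.
Unshelve. all: end_near. Qed.

Variables (S EV : nat -> R) (q c D : R).
Hypothesis q0 : q < 0.
Hypothesis c0 : 0 < c.
Hypothesis S_ge0 : forall n, 0 <= S n.
Hypothesis EV_lower : \forall n \near \oo, c * n%:R `^ (1 - q) <= EV n.
Hypothesis S_upper : \forall n \near \oo, S n <= D * n%:R `^ (1 - 2 * q) * power_sum (2 * q) n.

Lemma near_EV_gt0 : \forall n \near \oo, 0 < EV n.
Proof.
near=> n; have n1 : (0 < n)%N by near: n; exact: nbhs_infty_gt.
have : c * n%:R `^ (1 - q) <= EV n by near: n.
by apply: lt_le_trans; rewrite mulr_gt0// powR_gt0// ltr0n.
Unshelve. all: end_near. Qed.

Lemma near_ratio : \forall n \near \oo, S n / EV n ^+ 2 <= `|D| / c ^+ 2 * (n%:R^-1 * power_sum (2 * q) n).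
Proof.
near=> n; have n1 : (0 < n)%N by near: n; exact: nbhs_infty_gt.
have n0 : (0 : R) < n%:R by rewrite ltr0n.
have h1 : c * n%:R `^ (1 - q) <= EV n by near: n.
have h2 : S n <= D * n%:R `^ (1 - 2 * q) * power_sum (2 * q) n by near: n.
have h0 : 0 < EV n by near: n; exact: near_EV_gt0.
have p0 : 0 < n%:R `^ (1 - q) by rewrite powR_gt0.
rewrite ler_pdivrMr ?exprn_gt0//; apply: le_trans h2 _.
have S0 : 0 <= power_sum (2 * q) n by apply: sumr_ge0 => k _; exact: powR_ge0.
have h3 : (c * n%:R `^ (1 - q)) ^+ 2 <= EV n ^+ 2.
  by rewrite lerXn2r ?nnegrE// ?(ltW h0)// mulr_ge0 ?(ltW c0) ?(ltW p0).
have e : n%:R * (n%:R : R) `^ (1 - 2 * q) = (n%:R `^ (1 - q)) ^+ 2.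
  rewrite powR_sqr -{1}(powRr1 (ltW n0)) -powRD ?(gt_eqF n0) ?implybT//; congr (_ `^ _); ring.
apply: (@le_trans _ _ (`|D| / c ^+ 2 * (n%:R^-1 * power_sum (2 * q) n) * (c * n%:R `^ (1 - q)) ^+ 2)).
  have -> : `|D| / c ^+ 2 * (n%:R^-1 * power_sum (2 * q) n) * (c * n%:R `^ (1 - q)) ^+ 2 =
    `|D| * (n%:R^-1 * power_sum (2 * q) n) * (n%:R `^ (1 - q)) ^+ 2 by field; rewrite !gt_eqF.
  rewrite -e; have -> : `|D| * (n%:R^-1 * power_sum (2 * q) n) * (n%:R * n%:R `^ (1 - 2 * q)) =
     `|D| * n%:R `^ (1 - 2 * q) * power_sum (2 * q) n by field; rewrite gt_eqF.
  by rewrite ler_wpM2r// ler_wpM2r ?powR_ge0// ler_norm.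
apply: ler_wpM2l h3; apply: mulr_ge0; first by rewrite divr_ge0// exprn_ge0// ltW.
by apply: mulr_ge0 S0; rewrite invr_ge0 ltW.
Unshelve. all: end_near. Qed.

Let ratio_le (u : nat -> R) (C : R) : (\forall n \near \oo, n%:R^-1 * power_sum (2 * q) n <= C * u n) ->
  exists C', \forall n \near \oo, S n / EV n ^+ 2 <= C' * u n.
Proof.
move=> h; exists (`|D| / c ^+ 2 * C); near=> n.
apply: le_trans (_ : `|D| / c ^+ 2 * (n%:R^-1 * power_sum (2 * q) n) <= _).
  by near: n; exact: near_ratio.
rewrite -[leRHS]mulrA; apply: ler_wpM2l; last by near: n.
by rewrite divr_ge0// exprn_ge0// ltW.
Unshelve. all: end_near. Qed.

Lemma ratio_subcritical : 2 * q < -1 -> exists C, \forall n \near \oo, S n / EV n ^+ 2 <= C * n%:R^-1.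
Proof.
move=> h; apply: (@ratio_le _ (1 - (2 * q + 1)^-1)); near=> n.
by rewrite mulrC ler_wpM2r ?invr_ge0// power_sum_bounded.
Unshelve. all: end_near. Qed.

Lemma ratio_critical : 2 * q = -1 -> exists C, \forall n \near \oo, S n / EV n ^+ 2 <= C * (n%:R^-1 * ln n%:R).
Proof.
move=> h; apply: (@ratio_le _ (1 + (ln 2)^-1)); near=> n.
have n2 : (2 <= n)%N by near: n; exact: nbhs_infty_ge.
have ln2 : 0 < ln (2 : R) by rewrite ln_gt0// ltr1n.
have l2 : ln 2 <= ln (n%:R : R) by rewrite ler_ln ?posrE ?ltr0n ?ler_nat// (ltn_trans _ n2).
rewrite [leRHS]mulrCA ler_wpM2l ?invr_ge0// h; apply: le_trans (power_sum_log _) _.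
  exact: ltn_trans n2.
by rewrite mulrDl mul1r addrC lerD2l mulrC ler_pdivlMr// mul1r.
Unshelve. all: end_near. Qed.

Lemma ratio_power s : -1 < s -> s <= 0 -> 2 * q <= s ->
  exists C, \forall n \near \oo, S n / EV n ^+ 2 <= C * n%:R `^ s.
Proof.
move=> h s0 hs; apply: (@ratio_le _ (1 + (s + 1)^-1)); near=> n.
have n1 : (0 < n)%N by near: n; exact: nbhs_infty_gt.
have n0 : (0 : R) < n%:R by rewrite ltr0n.
rewrite mulrC ler_pdivrMr//; apply: le_trans (power_sum_le n hs) _.
apply: le_trans (power_sum_power h s0 n1) _.
rewrite -mulrA ler_wpM2l//; first by rewrite addr_ge0// invr_ge0; lra.
by rewrite powRD ?powRr1 ?(ltW n0)// (gt_eqF n0) implybT.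
Unshelve. all: end_near. Qed.

(** In all three regimes the ratio of the sum of squares to the squared mean is
    bounded by a negative power [s] of [n]; a large moment turns it into a
    summable sequence. *)
Lemma ratio_moment : exists k K, [/\ (0 < k)%N,
    \forall n \near \oo, 4 * (2 * k)%:R * Num.sqrt (S n) <= EV n &
    \forall n \near \oo, (12 * (2 * k)%:R * (Num.sqrt (S n) / EV n)) ^+ (2 * k) <= K * (n%:R ^+ 2)^-1].
Proof.
(* an exponent above the critical one, so that a single regime covers all cases *)
pose s := Num.max (2 * q) (- 2^-1).
have s0 : s < 0 by rewrite /s gt_max pmulr_rlt0// q0/= oppr_lt0 invr_gt0.
have s1 : -1 < s by rewrite /s lt_max ltrN2 invf_lt1// ltr1n orbT.
have [|C hC] := ratio_power s1 (ltW s0); first by rewrite /s le_max lexx.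
pose k := (Num.truncn (2 / - s)).+1.
have hk : s * k%:R <= - 2.
  have : 2 / - s <= k%:R by apply: ltW; exact: truncnS_gt.
  by rewrite ler_pdivrMr ?oppr_gt0//; lra.
exists k, (((12 * (2 * k)%:R) ^+ 2 * `|C|) ^+ k); split=> //.
  have e0 : 0 < (1 + (4 * (2 * k)%:R) ^+ 2 * `|C|)^-1.
    by rewrite invr_gt0 ltr_wpDr// mulr_ge0// sqr_ge0.
  near=> n; have h0 : 0 < EV n by near: n; exact: near_EV_gt0.
  have h1 : S n / EV n ^+ 2 <= C * n%:R `^ s by near: n.
  have h2 : n%:R `^ s <= (1 + (4 * (2 * k)%:R) ^+ 2 * `|C|)^-1 by near: n; exact: near_powR_small.
  rewrite -ler_sqr ?nnegrE ?(ltW h0) ?mulr_ge0 ?sqrtr_ge0// exprMn sqr_sqrtr//.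
  move: h1; rewrite ler_pdivrMr ?exprn_gt0// => h1.
  apply: le_trans (ler_wpM2l (sqr_ge0 _) h1) _; rewrite mulrA ler_piMl ?sqr_ge0//.
  apply: (@le_trans _ _ ((4 * (2 * k)%:R) ^+ 2 * `|C| * n%:R `^ s)).
    by rewrite -mulrA ler_wpM2l ?sqr_ge0// ler_wpM2r ?powR_ge0// ler_norm.
  have A0 : 0 <= (4 * (2 * k)%:R) ^+ 2 * `|C| by rewrite mulr_ge0// sqr_ge0.
  apply: le_trans (ler_wpM2l A0 h2) _; rewrite ler_pdivrMr; last by rewrite ltr_wpDr.
  by rewrite mul1r lerDr.
near=> n; have n1 : (0 < n)%N by near: n; exact: nbhs_infty_gt.
have n0 : (0 : R) < n%:R by rewrite ltr0n.
have h0 : 0 < EV n by near: n; exact: near_EV_gt0.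
have h1 : S n / EV n ^+ 2 <= C * n%:R `^ s by near: n.
have e : (12 * (2 * k)%:R * (Num.sqrt (S n) / EV n)) ^+ 2 = (12 * (2 * k)%:R) ^+ 2 * (S n / EV n ^+ 2).
  by rewrite exprMn; congr (_ * _); rewrite exprMn exprVn sqr_sqrtr.
rewrite exprM e.
apply: (@le_trans _ _ (((12 * (2 * k)%:R) ^+ 2 * `|C| * n%:R `^ s) ^+ k)).
  have r0 : 0 <= S n / EV n ^+ 2 by rewrite divr_ge0// exprn_ge0// ltW.
  apply: lerXn2r; rewrite ?nnegrE.
  - exact: mulr_ge0 (sqr_ge0 _) r0.
  - by apply: mulr_ge0 (powR_ge0 _ _); apply: mulr_ge0 (sqr_ge0 _) _.
  rewrite -mulrA ler_wpM2l ?sqr_ge0//; apply: le_trans h1 _.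
  by rewrite ler_wpM2r ?powR_ge0// ler_norm.
rewrite exprMn ler_wpM2l; first by [].
  by rewrite exprn_ge0// mulr_ge0// sqr_ge0.
rewrite -powR_mulrn ?powR_ge0// -powRrM -powR_mulrn ?(ltW n0)// -powRN.
by apply: ler_powR => //; rewrite ler1n.
Unshelve. all: end_near. Qed.

End rates.

Section sampled_variation.
Context d (T : measurableType d) (R : realType) (P : probability T R).

Lemma quad_var_ae (X : 'rV[R]_2 -> {RV P >-> R}) (mu : R) (Kt : 'rV[R]_2 -> R) theta l
    (p : nat -> nat -> 'rV[R]_2) (k : nat) (K : R) :
  gaussian_field X -> stationary_isotropic X mu Kt -> (0 < k)%N ->
  (\forall n \near \oo, forall i, (1 <= i <= n - theta * l)%N -> \sum_(j < l.+1) bcoef theta l (p n) i j = 0) ->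
  (\forall n \near \oo, 0 < nabla_var Kt theta l (p n) n) ->
  (\forall n \near \oo, 4 * k%:R * Num.sqrt (nabla_cov_sq Kt theta l (p n) n) <= nabla_var Kt theta l (p n) n) ->
  (\forall n \near \oo, (12 * k%:R * (Num.sqrt (nabla_cov_sq Kt theta l (p n) n) / nabla_var Kt theta l (p n) n)) ^+ k
      <= K * (n%:R ^+ 2)^-1) ->
  {ae P, forall w, quad_var theta l n (p n) (fun i => X (p n i) w) / nabla_var Kt theta l (p n) n @[n --> \oo] --> (1 : R)}.
Proof.
move=> hg hs k0 hb h0 h1 h2.
have [N _ hN] := filterI hb h0.
(* for small [n] the weights may be degenerate *)
pose f n w := if (N <= n)%N then quad_var theta l n (p n) (fun i => X (p n i) w) / nabla_var Kt theta l (p n) n - 1 else 0.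
have := @ae_cvg0_moments _ _ _ P f k K k0.
have mf n : has_moments P (f n).
  rewrite /f; case: leqP => [/hN[hb' _]|_]; last exact: has_moments_cst.
  apply: has_momentsD; last exact: has_moments_cst.
  by apply: has_momentsM; [exact: (quad_var_has_moments hg hs hb')|exact: has_moments_cst].
move=> /(_ mf) H.
have {}H : {ae P, forall w, f n w @[n --> \oo] --> (0 : R)}.
  apply: H; near=> n.
  have Nn : (N <= n)%N by near: n; exact: nbhs_infty_ge.
  have [hb' h0'] := hN n Nn.
  have -> : (fun w => f n w ^+ (2 * k)) =
      (fun w => (quad_var theta l n (p n) (fun i => X (p n i) w) / nabla_var Kt theta l (p n) n - 1) ^+ (2 * k)).
    by apply/funext => w; rewrite /f Nn.
  apply: le_trans (quad_var_moment_le hg hs hb' h0' _) _; first by near: n.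
  by near: n.
apply: filterS H => w fw.
have : f n w + 1 @[n --> \oo] --> (0 + 1 : R) by apply: cvgD => //; exact: cvg_cst.
rewrite add0r; apply: cvg_trans.
apply: near_eq_cvg; near=> n.
have Nn : (N <= n)%N by near: n; exact: nbhs_infty_ge.
by rewrite /f Nn /= subrK.
Unshelve. all: end_near. Qed.

End sampled_variation.

Unset Implicit Arguments.
Set Strict Implicit.

Theorem theorem3 (d : measure_display) (T : measurableType d) (R : realType)
    (P : probability T R) (theta l : nat) (nu mu : R)
    (beta : nat -> R) (betastar : R)
    (X : 'rV[R]_2 -> {RV P >-> R}) (Kt : 'rV[R]_2 -> R)
    (eps L : R) (gamma : R -> 'rV[R]_2) (phi : R -> R)
    (htheta : theta \in [:: 1%N; 2%N]) (hl : l \in [:: 1%N; 2%N])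
    (hnu : 0 < nu < l%:R)
    (hgauss : gaussian_field X)
    (hstat : stationary_isotropic X mu Kt)
    (hcov : covariance_form nu beta betastar Kt)
    (hC2 : arclength_C2_curve eps L gamma)
    (hC3 : chord_arc L gamma)
    (hC4 : sampling_map L phi) :
  let V := Vtilde theta l L phi gamma X in
  let EV := fun n => fine (EVtilde theta l L phi gamma X n) in
  let ft := fun n =>
    ftilde theta l n (sample_points L phi gamma n) betastar nu in
  (asymp_equiv EV ft /\
   same_order ft (fun n => n%:R `^ (2 * l%:R + 1 - 2 * nu))) /\
  forall Gam : set 'rV[R]_2,
    compact Gam -> convex_set Gam ->
    [set gamma t | t in `[0, L]] `<=` Gam ->
    smooth_off_origin l Gam Kt ->
    derivative_bound l nu Gam Kt ->
    {ae P, forall w, (fun n => V n w / EV n) @ \oo --> (1 : R)} /\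
    let varV := fun n => 'V_P[(fun w => V n w / EV n)%R]%E in
    let nu0 := (4 * l%:R - 1) / 4 in
    [/\ nu < nu0 -> ebigO varV (fun n => n%:R^-1),
        nu = nu0 -> ebigO varV (fun n => n%:R^-1 * ln n%:R)
      & nu > nu0 -> ebigO varV (fun n => n%:R `^ (- 4 * l%:R + 4 * nu))].
Proof.
move=> V EV ft.
have [phi_in [M [m HP]]] := sampled_curve_regular hC2 hC3 hC4.
set Q := fun u => gamma (phi u) in HP; pose p := gridpt L Q.
pose q := 2 * nu - (2 * l)%:R.
have q0 : q < 0.
  by rewrite /q natrM; case/andP: hnu => _ h; rewrite -mulrBr pmulr_rlt0// subr_lt0.
have [B B0 hB] := near_window HP htheta hl.
have hb : \forall n \near \oo, forall i, (1 <= i <= n - theta * l)%N -> \sum_(j < l.+1) bcoef theta l (p n) i j = 0.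
  by apply: filterS hB => n h i /h[].
pose W n := nabla_var Kt theta l (p n) n.
have EVW : \forall n \near \oo, EV n = W n.
  by apply: filterS hb => n h; exact: (quad_var_mean hgauss hstat h).
(* from here on [W] is the mean for large [n], and [S] the sum of the squared
   covariances *)
have W0 n : 0 <= W n by exact: (nabla_var_ge0 hgauss hstat).
pose S n := nabla_cov_sq Kt theta l (p n) n.
have S0 n : 0 <= S n by exact: (nabla_cov_sq_ge0 hgauss hstat).
pose Tn n := spacing_sum L (derive1 phi) theta l q n.
pose k := 2 * betastar * main_const l nu.
have k0 : k != 0.
  by case: hcov => b0 _; rewrite !mulf_neq0// main_const_neq0.
have [K1 [K2 [K10 K20 hK]]] := spacing_sum_bounds HP htheta hl (ltW q0).
pose g n : R := n%:R `^ (1 - q).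
have g0 : \forall n \near \oo, 0 < g n.
  by near=> n; rewrite powR_gt0// ltr0n; near: n; exact: nbhs_infty_gt.
have Tg : \forall n \near \oo, K1 * g n <= Tn n <= K2 * g n.
  by near=> n; apply: hK; near: n; exact: nbhs_infty_ge.
have WT e : 0 < e -> \forall n \near \oo, `|W n - k * Tn n| <= e * Tn n.
  by apply: near_sum_close => e' e'0; exact: (near_diag_cov HP htheta hl hnu hcov).
have ftT e : 0 < e -> \forall n \near \oo, `|ft n - k * Tn n| <= e * Tn n.
  move=> e0; have e1 : 0 < e / (1 + `|2 * betastar|) by rewrite divr_gt0// ltr_wpDr.
  have := near_sum_close (near_diag_main HP htheta hl hnu) e1.
  apply: filterS => n h.
  have -> : ft n - k * Tn n = 2 * betastar *
      (\sum_(1 <= i < (n - theta * l).+1) diag_main theta l (p n) nu i - main_const l nu * Tn n).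
    by rewrite mulrBr /k !mulrA.
  rewrite normrM; apply: le_trans (ler_wpM2l (normr_ge0 _) h) _.
  have T0 : 0 <= Tn n by apply: sumr_ge0 => i _; exact: powR_ge0.
  rewrite mulrA; apply: ler_wpM2r => //.
  rewrite mulrA ler_pdivrMr; last by rewrite ltr_wpDr.
  by rewrite mulrC ler_wpM2l ?(ltW e0)// lerDr.
have EV0 : \forall n \near \oo, 0 <= EV n by apply: filterS EVW => n ->.
have EVT e : 0 < e -> \forall n \near \oo, `|EV n - k * Tn n| <= e * Tn n.
  by move=> /WT; apply: filterS2 EVW => n ->.
split.
  split; first exact: (asymp_equiv_main k0 K10 EV0 g0 Tg ftT EVT).
  have -> : (fun n : nat => n%:R `^ (2 * l%:R + 1 - 2 * nu)) = g.
    by apply/funext => n; congr (_ `^ _); rewrite /q natrM; ring.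
  exact: (same_order_main k0 K10 EV0 g0 Tg ftT EVT).
move=> Gam _ convG GQ smoothK boundK.
have PG u : 0 <= u <= L -> Gam (Q u).
  by move=> hu; apply: GQ; exists (phi u) => //=; rewrite in_itv/=; exact: phi_in.
have [D D0 hS] := near_cov_sq HP htheta hl hnu hcov convG PG smoothK boundK
  (fun n => nabla_cov_ge0 hgauss hstat theta l (p n)) (fun n => nabla_cov_sqr_le hgauss hstat theta l (p n)).
(* the positive lower bound on the mean, needed to divide by it *)
have kpos := main_const_gt0 k0 K10 EV0 g0 Tg EVT.
have c0 : 0 < k / 2 * K1 by rewrite mulr_gt0// divr_gt0.
have Wlow : \forall n \near \oo, k / 2 * K1 * n%:R `^ (1 - q) <= W n.
  by have := near_main_lower k0 K10 EV0 g0 Tg EVT; apply: filterS2 EVW => n ->.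
have Wpos := near_EV_gt0 c0 Wlow.
split.
  have [j [K [j0 h1 h2]]] := ratio_moment q0 c0 S0 Wlow hS.
  have := quad_var_ae hgauss hstat _ hb Wpos h1 h2.
  rewrite muln_gt0 j0 => /(_ isT); apply: filterS => w; apply: cvg_trans.
  by apply: near_eq_cvg; apply: filterS EVW => n ->.
move=> varV nu0.
have varE (u : nat -> R) : (exists C, \forall n \near \oo, S n / W n ^+ 2 <= C * u n) -> ebigO varV u.
  move=> [C hC]; exists (2 * C); near=> n.
  have h1 : EV n = W n by near: n.
  have h2 : forall i, (1 <= i <= n - theta * l)%N -> \sum_(j < l.+1) bcoef theta l (p n) i j = 0 by near: n.
  have h3 : 0 < W n by near: n.
  have h4 : S n / W n ^+ 2 <= C * u n by near: n.
  have -> : varV n = (2 * S n / W n ^+ 2)%:E.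
    rewrite /varV h1; exact: (quad_var_variance hgauss hstat h2 (lt0r_neq0 h3)).
  rewrite abse_EFin lee_fin ger0_norm; last first.
    by rewrite divr_ge0 ?exprn_ge0 ?(ltW h3)// mulr_ge0.
  by rewrite -mulrA -[leRHS]mulrA ler_wpM2l.
have qE : 2 * q = 4 * nu - 4 * l%:R by rewrite /q natrM; ring.
split=> hn; apply: varE.
- by apply: (ratio_subcritical c0 Wlow hS); rewrite qE; move: hn; rewrite /nu0; lra.
- by apply: (ratio_critical c0 Wlow hS); rewrite qE hn /nu0; lra.
- have := @ratio_power _ S W q _ D c0 Wlow hS (2 * q).
  rewrite (_ : - 4 * l%:R + 4 * nu = 2 * q); last by rewrite qE; ring.
  apply; [|by rewrite pmulr_rle0// ltW|exact: lexx].
  by rewrite qE; move: hn; rewrite /nu0; lra.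
Unshelve. all: end_near. Qed.
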